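(* Let $A$ be a positive operator on a Banach space $X$ (that is, $A$ is non-negative and $0\in\rho(A)$), and let $s>0$ and $0<q\le\infty$. Then: (i) $A^{-\gamma}$ is continuous from $B^{s,A}_{q,X}$ to $B^{s+\operatorname{Re}\gamma,A}_{q,X}$ for each $\gamma\in\mathbb{C}_+$. (ii) $\|A^{-\gamma}\,\cdot\,\|_{B^{s+\operatorname{Re}\gamma,A}_{q,X}}$ is an equivalent quasi-norm on $B^{s,A}_{q,X}$ for each $\gamma\in\mathbb{C}_+$. (iii) $\|A^{\gamma}\,\cdot\,\|_{B^{s-\operatorname{Re}\gamma,A}_{q,X}}$ is an equivalent quasi-norm on $B^{s,A}_{q,X}$ for each $\gamma\in\mathbb{C}_+$ satisfying $0<\operatorname{Re}\gamma<s$.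
   Context: $X$ is a complex Banach space. A closed linear operator $A$ on $X$ (not necessarily densely defined or with dense range) is non-negative if $(-\infty,0)\subset\rho(A)$ and $\sup_{\lambda>0}\|\lambda(\lambda+A)^{-1}\|<\infty$. $\mathbb{C}_+=\{\alpha\in\mathbb{C}:\operatorname{Re}\alpha>0\}$ and $\mathbb{C}_+^*=\mathbb{C}_+\cup\{0\}$. Fractional powers, for $\alpha\in\mathbb{C}_+$: if $A$ is bounded, $A^\alpha=\frac{\Gamma(n)}{\Gamma(\alpha)\Gamma(n-\alpha)}\int_0^\infty\lambda^{\alpha}A^n(\lambda+A)^{-n}\frac{d\lambda}{\lambda}$ for any integer $n>\operatorname{Re}\alpha$; if $A$ is unbounded and $0\in\rho(A)$, $A^\alpha=[(A^{-1})^\alpha]^{-1}$; if $A$ is unbounded and $0\in\sigma(A)$, $A^\alpha$ is the strong limit of $(A+\epsilon)^\alpha$ as $\epsilon\to0^+$, with maximal domain. $A^0=I$; $A^{-\alpha}=(A^\alpha)^{-1}$ when $A$ is injective. Besov spaces: for $s\in\mathbb{R}$, $0<q\le\infty$, $k\in\mathbb{Z}$ and $\alpha,\beta\in\mathbb{C}_+^*$ with $-\operatorname{Re}\alpha<s<\operatorname{Re}\beta$, let $|x|_{R^{s,A}_{q,X}(k,\alpha,\beta)}=\big\{\sum_{i=k}^\infty\|2^{i(s+\alpha)}A^\beta(2^i+A)^{-\alpha-\beta}x\|^q\big\}^{1/q}$ (supremum if $q=\infty$) and $R^{s,A}_{q,X}(k,\alpha,\beta)=\{x\in\overline{D(A)}:|x|_{R^{s,A}_{q,X}(k,\alpha,\beta)}<\infty\}$.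 $B^{s,A}_{q,X}$ is the completion of $R^{s,A}_{q,X}(k,\alpha,\beta)$ with respect to the quasi-norm $\|x\|_{B^{s,A}_{q,X}}=\|(2^k+A)^{-\alpha}x\|+|x|_{R^{s,A}_{q,X}(k,\alpha,\beta)}$; different admissible $k,\alpha,\beta$ give the same space with equivalent quasi-norms, which are not distinguished. For $s>0$ no completion is needed: $B^{s,A}_{q,X}=R^{s,A}_{q,X}(k,\alpha,\beta)\subset X$. *)

(* Defs.v *)
From Stdlib Require Import Reals ZArith Lra.
From Coquelicot Require Import Coquelicot.
Set Implicit Arguments.
Open Scope R_scope.

(** A complex Banach space is a [CompleteNormedModule C_AbsRing], whereas
    Coquelicot integrates functions with values in modules over [R]; the
    scalars of such a space are therefore restricted to [R]. *)

Section RestrictScalars.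

Variable X : CompleteNormedModule C_AbsRing.

Lemma real_scal_assoc (a b : R) (u : X) :
  scal (RtoC a) (scal (RtoC b) u) = scal (RtoC (mult a b)) u.
Proof. rewrite scal_assoc. f_equal. symmetry. apply RtoC_mult. Qed.

Lemma real_scal_one (u : X) : scal (RtoC one) u = u.
Proof. exact (scal_one u). Qed.

Lemma real_scal_distr_l (a : R) (u v : X) :
  scal (RtoC a) (plus u v) = plus (scal (RtoC a) u) (scal (RtoC a) v).
Proof. apply (scal_distr_l (RtoC a : C_AbsRing) u v). Qed.

Lemma real_scal_distr_r (a b : R) (u : X) :
  scal (RtoC (plus a b)) u = plus (scal (RtoC a) u) (scal (RtoC b) u).
Proof. rewrite RtoC_plus. apply (scal_distr_r (RtoC a : C_AbsRing) (RtoC b) u). Qed.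

Definition real_ModuleSpace_mixin : ModuleSpace.mixin_of R_Ring X :=
  ModuleSpace.Mixin R_Ring X (fun (a : R) (u : X) => scal (RtoC a) u)
    real_scal_assoc real_scal_one real_scal_distr_l real_scal_distr_r.

Definition real_NormedModuleAux_class : NormedModuleAux.class_of R_AbsRing X :=
  NormedModuleAux.Class R_AbsRing X
    (ModuleSpace.Class R_Ring X (AbelianGroup.class X) real_ModuleSpace_mixin)
    (UniformSpace.class X).

Definition real_NormedModuleAux : NormedModuleAux R_AbsRing :=
  NormedModuleAux.Pack R_AbsRing X real_NormedModuleAux_class X.

Lemma real_norm_scal (a : R) (u : X) :
  norm (scal (RtoC a) u) <= Rabs a * norm u.
Proof. rewrite <- Cmod_R. apply (norm_scal (RtoC a : C_AbsRing) u). Qed.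

Definition real_NormedModule_mixin :
  NormedModule.mixin_of R_AbsRing real_NormedModuleAux :=
  NormedModule.Mixin R_AbsRing real_NormedModuleAux (fun u : X => norm u)
    (@norm_factor C_AbsRing X) (@norm_triangle C_AbsRing X) real_norm_scal
    (@norm_compat1 C_AbsRing X) (@norm_compat2 C_AbsRing X)
    (@norm_eq_zero C_AbsRing X).

Definition real_CompleteNormedModule : CompleteNormedModule R_AbsRing :=
  CompleteNormedModule.Pack R_AbsRing X
    (CompleteNormedModule.Class R_AbsRing X
       (NormedModule.Class R_AbsRing X real_NormedModuleAux_class
          real_NormedModule_mixin)
       (CompleteNormedModule.mixin C_AbsRing X
          (CompleteNormedModule.class C_AbsRing X))) X.

End RestrictScalars.

(** [t ^ z] for [0 < t]. *)
Definition rcpow (t : R) (z : C) : C :=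
  Cmult (RtoC (exp (Re z * ln t))) (cos (Im z * ln t), sin (Im z * ln t)).

(** [t ^ q] for [0 <= t] and [0 < q]; [Rpower] itself has [Rpower 0 q = 1]. *)
Definition nnpow (t q : R) : R := if Req_EM_T t 0 then 0 else Rpower t q.

(** Euler's integral, for [0 < Re z]. *)
Definition CGamma (z : C) : C :=
  @RInt_gen C_R_CompleteNormedModule
    (fun t : R => Cmult (rcpow t (Cminus z (RtoC 1))) (RtoC (exp (- t))))
    (at_right 0) (Rbar_locally p_infty).

(** An operator is given by its graph: [T x y] means [x] is in [D(T)] and
    [T x = y]. *)
Definition operator (X : CompleteNormedModule C_AbsRing) := X -> X -> Prop.

Section Operators.

Variable X : CompleteNormedModule C_AbsRing.
Implicit Types (T S A : operator X).

Definition op_dom T (x : X) : Prop := exists y, T x y.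

(** The value [T x]; meaningful when [x] is in the domain of [T]. *)
Definition op_app T (x : X) : X := iota (T x).

Definition op_id : operator X := fun x y => y = x.

Definition op_comp T S : operator X := fun x z => exists y, S x y /\ T y z.

Fixpoint op_iter T (n : nat) : operator X :=
  match n with O => op_id | S m => op_comp T (op_iter T m) end.

Definition op_inv T : operator X := fun y x => T x y.

Definition op_shift (z : C) T : operator X :=
  fun x w => exists y, T x y /\ w = plus (scal z x) y.

Record linear_operator T : Prop := {
  linear_functional : forall x y y', T x y -> T x y' -> y = y';
  linear_zero : T zero zero;
  linear_plus : forall x y x' y', T x y -> T x' y' -> T (plus x x') (plus y y');
  linear_scal : forall (z : C) x y, T x y -> T (scal z x) (scal z y) }.

Definition closed_operator T : Prop :=
  closed (fun p : X * X => T (fst p) (snd p)).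

Definition bounded_operator T : Prop :=
  (forall x, exists! y, T x y) /\
  exists M : R, forall x y, T x y -> norm y <= M * norm x.

Definition in_resolvent_set A (z : C) : Prop :=
  bounded_operator (op_inv (op_shift (Copp z) A)).

Record nonnegative_operator A : Prop := {
  nonneg_linear : linear_operator A;
  nonneg_closed : closed_operator A;
  nonneg_resolvent : forall l : R, l < 0 -> in_resolvent_set A (RtoC l);
  nonneg_bound : exists M : R, forall l : R, 0 < l ->
    forall x y, op_inv (op_shift (RtoC l) A) x y ->
    norm (scal (RtoC l) y) <= M * norm x }.

Definition positive_operator A : Prop :=
  nonnegative_operator A /\ in_resolvent_set A (RtoC 0).

(** The formula for bounded [A] does not depend on the integer [n > Re a]; the
    least one is used. *)
Definition fpow_bounded A (a : C) : operator X := fun x y =>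
  let n := Z.to_nat (up (Re a)) in
  exists v : X,
    @is_RInt_gen (real_CompleteNormedModule X)
      (fun l : R =>
         scal (Cdiv (rcpow l a) (RtoC l))
           (op_app (op_comp (op_iter A n)
                      (op_iter (op_inv (op_shift (RtoC l) A)) n)) x))
      (at_right 0) (Rbar_locally p_infty) v /\
    y = scal (Cdiv (CGamma (RtoC (INR n)))
                (Cmult (CGamma a) (CGamma (Cminus (RtoC (INR n)) a)))) v.

(** The case [0] in the resolvent set of [A], or [A] bounded. *)
Definition fpow_regular A (a : C) : operator X := fun x y =>
  (bounded_operator A /\ fpow_bounded A a x y) \/
  (~ bounded_operator A /\ in_resolvent_set A (RtoC 0) /\
   op_inv (fpow_bounded (op_inv A) a) x y).

(** In the last case [x] is in the domain as soon as the limit exists. *)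
Definition fpow A (a : C) : operator X := fun x y =>
  fpow_regular A a x y \/
  (~ bounded_operator A /\ ~ in_resolvent_set A (RtoC 0) /\
   exists g : R -> X,
     at_right 0 (fun e => fpow_regular (op_shift (RtoC e) A) a x (g e)) /\
     filterlim g (at_right 0) (locally y)).

(** [A ^ z] for [z] in [C_+], [z = 0] or [- z] in [C_+]; no other exponent is
    used. *)
Definition op_pow A (z : C) : operator X := fun x y =>
  (0 < Re z /\ fpow A z x y) \/
  (z = RtoC 0 /\ op_id x y) \/
  (Re z < 0 /\ op_inv (fpow A (Copp z)) x y).

Definition Cplus_star (a : C) : Prop := 0 < Re a \/ a = RtoC 0.

Record besov_param (s : R) := {
  bp_k : Z;
  bp_alpha : C;
  bp_beta : C;
  bp_alpha_star : Cplus_star bp_alpha;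
  bp_beta_star : Cplus_star bp_beta;
  bp_lower : - Re bp_alpha < s;
  bp_upper : s < Re bp_beta }.

(** The [l^q] (quasi-)norm of a nonnegative sequence, for [0 < q <= +oo]. *)
Definition lq_norm (q : Rbar) (a : nat -> R) : Rbar :=
  match q with
  | Finite r =>
      match Lim_seq (sum_n (fun j => nnpow (a j) r)) with
      | Finite v => Finite (nnpow v (/ r))
      | l => l
      end
  | _ => Sup_seq (fun j => Finite (a j))
  end.

(** [j : nat] stands for the summation index [i = k + j]. *)
Definition besov_seminorm A (q : Rbar) (s : R) (p : besov_param s) (x : X)
  : Rbar :=
  let alpha := bp_alpha p in
  let beta := bp_beta p in
  lq_norm q (fun j : nat =>
    let i := (bp_k p + Z.of_nat j)%Z in
    norm (scal (rcpow 2 (Cmult (RtoC (IZR i)) (Cplus (RtoC s) alpha)))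
            (op_app
               (op_comp (op_pow A beta)
                  (op_pow (op_shift (RtoC (powerRZ 2 i)) A)
                     (Cminus (Copp alpha) beta))) x))).

Definition in_closure (D : X -> Prop) (x : X) : Prop :=
  forall eps : posreal, exists z, D z /\ norm (minus x z) < eps.

(** For [0 < s] the Besov space is this subspace of [X], no completion being
    needed. *)
Definition besov_space A (q : Rbar) (s : R) (p : besov_param s) (x : X)
  : Prop :=
  in_closure (op_dom A) x /\ Rbar_lt (besov_seminorm A q p x) p_infty.

Definition besov_norm A (q : Rbar) (s : R) (p : besov_param s) (x : X) : R :=
  norm (op_app (op_pow (op_shift (RtoC (powerRZ 2 (bp_k p))) A)
                  (Copp (bp_alpha p))) x)
  + real (besov_seminorm A q p x).

Definition maps_into (B B' : X -> Prop) T : Prop :=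
  forall x, B x -> op_dom T x /\ B' (op_app T x).

Definition continuous_between (B : X -> Prop) (N : X -> R)
    (B' : X -> Prop) (N' : X -> R) T : Prop :=
  maps_into B B' T /\
  forall x, B x -> forall eps : posreal, exists delta : posreal,
    forall y, B y -> N (minus y x) < delta ->
      N' (minus (op_app T y) (op_app T x)) < eps.

Record quasi_norm (B : X -> Prop) (N : X -> R) : Prop := {
  quasi_norm_ge0 : forall x, B x -> 0 <= N x;
  quasi_norm_eq0 : forall x, B x -> (N x = 0 <-> x = zero);
  quasi_norm_scal : forall (z : C) x, B x -> N (scal z x) = Cmod z * N x;
  quasi_norm_triangle : exists K : R, forall x y, B x -> B y ->
    N (plus x y) <= K * (N x + N y) }.

Definition equivalent_quasi_norm (B : X -> Prop) (N N' : X -> R) : Prop :=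
  quasi_norm B N' /\
  exists c C : R, 0 < c /\ 0 < C /\
    forall x, B x -> c * N x <= N' x <= C * N x.

End Operators.

Arguments quasi_norm {X} B N.
Arguments equivalent_quasi_norm {X} B N N'.

(* Main.v *)
Require Import Defs.
From Stdlib Require Import Reals ZArith Lra Lia Psatz Classical ClassicalEpsilon.
From Stdlib Require Import FunctionalExtensionality ProofIrrelevance.
From Coquelicot Require Import Coquelicot.
Open Scope R_scope.

(** Write [B] for the inverse of [A] and [R_t] for the resolvent [(t + A)^(-1)],
    [t >= 0]. All operators below commute with whatever commutes with [B]; such
    bounded operators form a commutative ring, and in that ring an identity can
    be checked after multiplication by an injective factor such as [R_t].
    Unbounded operators and their domains thus only occur where the definitions
    of the fractional powers and of the seminorms are unfolded.

    Powers. For [0 < Re a] the operator [J a t], that is [(t + A)^(-a)], is the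
    Balakrishnan integral of [z^(n-a-1) R_(t+z)^n] over [z > 0], divided by a
    Beta value. As a function of [t] it solves [F' = - a R_t F] and it satisfies
    [t^a F(t) B^j -> B^j] for some [j]. These two properties determine it
    ([powfam_unique]), and the product of the solutions for [a] and [c] solves
    the problem for [a + c]; so [J] is a semigroup in [a] ([J_plus]) and no
    double integral occurs. The inverses of the fractional powers of
    [t + A] are multiples of [J], both for bounded and for unbounded [A]
    ([fpow_J]), by factors that are nonzero because the Beta and Gamma functions
    have no zeros in the right half-plane ([beta_neq_0], [CGamma_neq_0]).

    Besov quasi-norms. The ratio [Y d t u], that is [(t + A)^d (u + A)^(-d)], is
    bounded, uniformly for [t <= u] and by a multiple of [(t/u)^(Re d)] for
    [u <= t] ([Y_bound]). With [F_(a,c)(t) = A^c (t + A)^(-a-c)], the seminorm is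
    the [l^q] quasi-norm of the sequence [t_i^(s+a) F_(a,c)(t_i) x] for
    [t_i = 2^(k+i)]. Increasing both exponents multiplies [F] by bounded
    operators of the right size. Decreasing one of them by [1] is a telescoping
    sum over the scales above or below [t_i] ([lower_a], [lower_c]), which amounts
    to a discrete convolution with a geometric kernel; that is bounded on every
    [l^q] ([lq_conv]). Hence all admissible [k], [a], [c] give equivalent
    quasi-norms ([dominates_all]).

    Conclusion. Since [F_(a,c)(t) A^(-g) = F_(a+g,c-g)(t)], the sequence of
    [A^(-g) x] for the smoothness [s + Re g] and the exponents [a], [c] is the
    sequence of [x] for [s], [a + g], [c - g] ([besov_term_J]); so [A^(-g)]
    preserves the quasi-norms up to constants ([besov_shift]). This gives (i) and
    (ii). For (iii) the same equivalence is applied to [A^g x], once [x] in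
    [B^s] is known to be [A^(-g) y] with [y] in the closure of [D(A)]: the vectors
    [A^g (u R_u)^n x], for [u] along the powers of two, form a Cauchy sequence
    because their increments are bounded by terms of the Besov sequence
    ([negative_power_preimage]). *)

Notation int0oo f l := (is_RInt_gen f (at_right 0) (Rbar_locally p_infty) l).
Notation CR := C_R_CompleteNormedModule.
Notation intC f l := (@is_RInt_gen CR f (at_right 0) (Rbar_locally p_infty) l).

(** * Integrals over the half-line *)

Lemma minus_plus_plus (G : AbelianGroup) (p q r : G) :
  minus (plus p q) (plus q r) = minus p r.
Proof.
  unfold minus. rewrite opp_plus, (plus_assoc (plus p q)), <- (plus_assoc p q).
  now rewrite plus_opp_r, plus_zero_r.
Qed.

Section HalfLine.

Variable V : CompleteNormedModule R_AbsRing.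

Lemma half_line_eventually (P : R * R -> Prop) (d m : R) :
  0 < d -> (forall a b, 0 < a < d -> m < b -> P (a, b)) ->
  filter_prod (at_right 0) (Rbar_locally p_infty) P.
Proof.
  intros hd h.
  exists (fun a => 0 < a < d) (fun b => m < b).
  - exists (mkposreal d hd). intros y hy h0.
    unfold ball in hy; simpl in hy; unfold AbsRing_ball, abs, minus, plus, opp in hy; simpl in hy.
    rewrite Ropp_0, Rplus_0_r in hy. apply Rabs_def2 in hy. lra.
  - exists m. auto.
  - intros a b ha hb. apply h; auto.
Qed.

Lemma ex_RInt_half_line (f : R -> V) (a b : R) :
  (forall z, 0 < z -> continuous f z) -> 0 < a -> 0 < b -> ex_RInt f a b.
Proof.
  intros hf ha hb. apply (@ex_RInt_continuous V). intros z hz. apply hf.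
  apply Rlt_le_trans with (2 := proj1 hz). apply Rmin_glb_lt; auto.
Qed.

(** [is_RInt_gen] asks for integrals over the bounded intervals, not only for
    their limit; continuity supplies them. *)
Lemma int0oo_of_lim (f : R -> V) (l : V) :
  (forall z, 0 < z -> continuous f z) ->
  filterlim (fun ab : R * R => RInt f (fst ab) (snd ab))
    (filter_prod (at_right 0) (Rbar_locally p_infty)) (locally l) ->
  int0oo f l.
Proof.
  intros hf hl P hP. specialize (hl P hP). unfold filtermap in hl. unfold filtermapi.
  assert (h0 : filter_prod (at_right 0) (Rbar_locally p_infty)
     (fun ab : R * R => 0 < fst ab /\ 0 < snd ab)).
  { apply half_line_eventually with 1 0; try lra. simpl; intros; lra. }
  generalize (filter_and _ _ hl h0). apply filter_imp.
  intros [a b] [h [h1 h2]]; simpl in *.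
  exists (RInt f a b). split; auto.
  apply (@RInt_correct V). apply ex_RInt_half_line; auto.
Qed.

Lemma vnorm_opp (x : V) : norm (opp x) = norm x.
Proof. apply (@norm_opp R_AbsRing V x). Qed.

Lemma vnorm_triangle (x y : V) : norm (plus x y) <= norm x + norm y.
Proof. apply (@norm_triangle R_AbsRing V x y). Qed.

Lemma norm_ball (x y : V) (e : posreal) : norm (minus y x) < e -> ball x e y.
Proof. apply (@norm_compat1 R_AbsRing V x y e). Qed.

(** The integral of [norm f] over [[a, b]] is at most [D b - D a], and [D] has
    limits at both ends, so that the integrals of [f] are Cauchy. Giving an
    antiderivative of the bound replaces a theory of absolutely convergent
    improper integrals. *)
Lemma int0oo_dominated (f : R -> V) (D D' : R -> R) (L : R) :
  (forall z, 0 < z -> continuous f z) ->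
  (forall z, 0 < z -> is_derive D z (D' z)) ->
  (forall z, 0 < z -> continuous D' z) ->
  (forall z, 0 < z -> norm (f z) <= D' z) ->
  filterlim D (at_right 0) (locally 0) ->
  filterlim D (Rbar_locally p_infty) (locally L) ->
  exists v, int0oo f v /\ norm v <= L.
Proof.
  intros hf hD hD' hle h0 hL.
  assert (hRI : forall a b, 0 < a -> a <= b -> is_RInt D' a b (D b - D a)).
  { intros a b ha hab. apply (@is_RInt_derive R_CompleteNormedModule).
    - intros x hx. apply hD. rewrite Rmin_left in hx; lra.
    - intros x hx. apply hD'. rewrite Rmin_left in hx; lra. }
  assert (hb : forall a b, 0 < a -> a <= b -> norm (RInt f a b) <= D b - D a).
  { intros a b ha hab.
    apply (norm_RInt_le f D' a b); auto.
    - intros x hx. apply hle. lra.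
    - apply (@RInt_correct V). apply ex_RInt_half_line; auto; lra. }
  assert (hb' : forall a b, 0 < a -> 0 < b -> norm (RInt f a b) <= Rabs (D b - D a)).
  { intros a b ha hb1. destruct (Rle_dec a b) as [h|h].
    - eapply Rle_trans; [apply hb; auto|apply Rle_abs].
    - rewrite <- (@opp_RInt_swap V); [|apply ex_RInt_half_line; auto].
      eapply Rle_trans; [apply Req_le, vnorm_opp|].
      eapply Rle_trans; [apply hb; auto; lra|].
      rewrite Rabs_minus_sym. apply Rle_abs. }
  assert (hlim : exists v, filterlim (fun ab : R * R => RInt f (fst ab) (snd ab))
    (filter_prod (at_right 0) (Rbar_locally p_infty)) (locally v)).
  { apply (proj1 (filterlim_locally_cauchy (U := V)
       (F := filter_prod (at_right 0) (Rbar_locally p_infty))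
       (fun ab : R * R => RInt f (fst ab) (snd ab)))).
    intros eps. assert (he : 0 < eps / 4) by (destruct eps; simpl; lra).
    exists (fun ab : R * R => (0 < fst ab /\ Rabs (D (fst ab)) < eps / 4) /\
                              (0 < snd ab /\ Rabs (D (snd ab) - L) < eps / 4)).
    split.
    - specialize (h0 _ (locally_ball 0 (mkposreal _ he))).
      specialize (hL _ (locally_ball L (mkposreal _ he))).
      unfold filtermap in *.
      exists (fun a => 0 < a /\ Rabs (D a) < eps/4) (fun b => 0 < b /\ Rabs (D b - L) < eps/4).
      + apply filter_and.
        * exists (mkposreal 1 Rlt_0_1). intros; auto.
        * revert h0. apply filter_imp. intros x hx.
          unfold ball in hx; simpl in hx; unfold AbsRing_ball, abs, minus, plus, opp in hx; simpl in hx.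
          now rewrite Ropp_0, Rplus_0_r in hx.
      + apply filter_and.
        * exists 0; auto.
        * revert hL. apply filter_imp. intros x hx. exact hx.
      + intros a b ha hb2. simpl. auto.
    - intros [a b] [a' b'] [[h1 h2] [h3 h4]] [[h5 h6] [h7 h8]]. simpl in *.
      apply norm_ball.
      assert (heq : minus (RInt f a' b') (RInt f a b) = minus (RInt f a' a) (RInt f b' b)).
      { rewrite <- (@RInt_Chasles V f a' a b'); try (apply ex_RInt_half_line; auto).
        rewrite <- (@RInt_Chasles V f a b' b); try (apply ex_RInt_half_line; auto).
        apply minus_plus_plus. }
      rewrite heq. unfold minus. eapply Rle_lt_trans; [apply vnorm_triangle|].
      rewrite vnorm_opp.
      generalize (hb' a' a h5 h1) (hb' b' b h7 h3); intros k1 k2.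
      assert (Rabs (D a - D a') < eps/2).
      { unfold Rminus. eapply Rle_lt_trans; [apply Rabs_triang|]. rewrite Rabs_Ropp. lra. }
      assert (Rabs (D b - D b') < eps/2).
      { replace (D b - D b') with ((D b - L) + - (D b' - L)) by ring.
        eapply Rle_lt_trans; [apply Rabs_triang|]. rewrite Rabs_Ropp. lra. }
      lra. }
  destruct hlim as [v hv]. exists v.
  assert (hI := int0oo_of_lim f v hf hv). split; auto.
  apply (RInt_gen_norm (Fa := at_right 0) (Fb := Rbar_locally p_infty) f D' v L); auto.
  - apply half_line_eventually with 1 1; simpl; intros; lra.
  - apply half_line_eventually with 1 1; try lra. simpl; intros; apply hle; lra.
  - replace L with (L - 0) by ring.
    intros P hP.
    assert (hsub : filterlim (fun ab : R*R => D (snd ab) - D (fst ab))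
       (filter_prod (at_right 0) (Rbar_locally p_infty)) (locally (L - 0))).
    { apply (filterlim_comp_2 (G := locally L) (H := locally 0)
              (F := filter_prod (at_right 0) (Rbar_locally p_infty))
              (fun ab : R*R => D (snd ab)) (fun ab => D (fst ab)) Rminus).
      - eapply filterlim_comp; [apply filterlim_snd|exact hL].
      - eapply filterlim_comp; [apply filterlim_fst|exact h0].
      - unfold Rminus. eapply filterlim_comp_2; [apply filterlim_fst| |].
        + eapply filterlim_comp; [apply filterlim_snd|]. apply (filterlim_opp (K := R_AbsRing) (V := R_NormedModule) 0).
        + apply (filterlim_plus (K := R_AbsRing) (V := R_NormedModule)). }
    specialize (hsub P hP). unfold filtermap, filtermapi in *.
    assert (h1 : filter_prod (at_right 0) (Rbar_locally p_infty)
     (fun ab : R * R => 0 < fst ab <= snd ab)).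
    { apply half_line_eventually with 1 1; simpl; intros; lra. }
    generalize (filter_and _ _ hsub h1). apply filter_imp.
    intros [a b] [k1 k2]; simpl in *. exists (D b - D a). split; auto. apply hRI; lra.
Qed.

End HalfLine.

(** * Powers on the half-line *)

Lemma Rpower_pos (x y : R) : 0 < Rpower x y.
Proof. apply exp_pos. Qed.

Lemma is_derive_Rpower (x y : R) : 0 < x ->
  is_derive (fun t => Rpower t y) x (y * Rpower x (y - 1)).
Proof. intros h. apply is_derive_Reals. now apply derivable_pt_lim_power. Qed.

Lemma continuous_Rpower (x y : R) : 0 < x -> continuous (fun t => Rpower t y) x.
Proof.
  intros h. apply (ex_derive_continuous (K := R_AbsRing) (V := R_NormedModule)).
  eexists; apply is_derive_Rpower; auto.
Qed.

Lemma Rle_Rpower_neg (a b c : R) : c <= 0 -> 0 < a <= b -> Rpower b c <= Rpower a c.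
Proof.
  intros hc hab. replace c with (- (- c)) by ring. rewrite (Rpower_Ropp b), (Rpower_Ropp a).
  apply Rinv_le_contravar; [apply Rpower_pos|]. apply Rle_Rpower_l; lra.
Qed.

Lemma Rpower_lim_0 (y : R) : 0 < y ->
  filterlim (fun t => Rpower t y) (at_right 0) (locally 0).
Proof.
  intros hy. unfold Rpower.
  apply (filterlim_comp _ _ _ (fun t => y * ln t) exp (at_right 0) (Rbar_locally m_infty) (locally 0)).
  - apply (filterlim_comp _ _ _ ln (fun t => y * t) (at_right 0) (Rbar_locally m_infty) (Rbar_locally m_infty)).
    + apply is_lim_ln_0.
    + intros P [M hM]. exists (M / y). intros t ht. apply hM.
      apply (Rmult_lt_compat_l y) in ht; auto. replace (y * (M/y)) with M in ht; auto. field; lra.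
  - apply is_lim_exp_m.
Qed.

Lemma Rpower_lim_oo (y : R) : y < 0 ->
  filterlim (fun t => Rpower t y) (Rbar_locally p_infty) (locally 0).
Proof.
  intros hy. unfold Rpower.
  apply (filterlim_comp _ _ _ (fun t => y * ln t) exp (Rbar_locally p_infty) (Rbar_locally m_infty) (locally 0)).
  - apply (filterlim_comp _ _ _ ln (fun t => y * t) (Rbar_locally p_infty) (Rbar_locally p_infty) (Rbar_locally m_infty)).
    + apply is_lim_ln_p.
    + intros P [M hM]. exists (M / y). intros t ht. apply hM.
      apply (Rmult_lt_gt_compat_neg_l y) in ht; auto. replace (y * (M/y)) with M in ht; auto. field; lra.
  - apply is_lim_exp_m.
Qed.

(** A bound, up to the power [t^(x-m)], for the Beta integral of
    [z^(x-1) (t+z)^(-m)]. *)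
Definition Kpow (x m : R) : R := 4 / Rmin x (m - x).

Lemma Kpow_pos x m : 0 < x < m -> 0 < Kpow x m.
Proof.
  intros h. unfold Kpow. apply Rdiv_lt_0_compat; try lra. apply Rmin_glb_lt; lra.
Qed.

(** The function [z^e / (t^e + z^e)] with [e = min(x, m-x)] increases from [0] to
    [1], and its derivative dominates [z^(x-1) (t+z)^(-m)] up to the factor
    [Kpow x m * t^(x-m)]: compare separately on [z <= t] and on [z >= t]. *)
Lemma int0oo_power (V : CompleteNormedModule R_AbsRing) (f : R -> V) (C t x m : R) :
  0 < t -> 0 < x < m -> 0 <= C ->
  (forall z, 0 < z -> continuous f z) ->
  (forall z, 0 < z -> norm (f z) <= C * (Rpower z (x - 1) * Rpower (t + z) (- m))) ->
  exists v, int0oo f v /\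
    norm v <= C * (Kpow x m * Rpower t (x - m)).
Proof.
  intros ht hx hC hf hle.
  (* the largest exponent for which the comparison holds at both ends *)
  set (e := Rmin x (m - x)).
  assert (he : 0 < e) by (apply Rmin_glb_lt; lra).
  assert (he1 : e <= x) by apply Rmin_l.
  assert (he2 : e <= m - x) by apply Rmin_r.
  set (K := C * (Kpow x m * Rpower t (x - m))).
  assert (hK : 0 <= K).
  { unfold K. apply Rmult_le_pos; auto. apply Rmult_le_pos; apply Rlt_le;
    [apply Kpow_pos; lra|apply Rpower_pos]. }
  set (T := Rpower t e).
  assert (hT : 0 < T) by apply Rpower_pos.
  apply (int0oo_dominated V f (fun z => K * (Rpower z e / (T + Rpower z e)))
     (fun z => K * (e * Rpower z (e - 1) * T / (T + Rpower z e) ^ 2))); auto.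
  - intros z hz. assert (hp := Rpower_pos z e).
    assert (hd := is_derive_Rpower z e hz).
    evar_last.
    { apply (is_derive_scal (fun z => Rpower z e / (T + Rpower z e)) z K).
      apply (is_derive_div (fun z => Rpower z e) (fun z => T + Rpower z e)).
      - exact hd.
      - apply (is_derive_plus (K := R_AbsRing) (fun _ => T) (fun z => Rpower z e)).
        apply (is_derive_const (K := R_AbsRing)). exact hd.
      - lra. }
    unfold plus, zero; simpl. field. lra.
  - intros z hz. assert (hp := Rpower_pos z e).
    apply (continuous_mult (K := R_AbsRing) (fun _ => K)); [apply continuous_const|].
    apply (continuous_mult (K := R_AbsRing) (fun z => e * Rpower z (e-1) * T)).
    + apply (continuous_mult (K := R_AbsRing) (fun z => e * Rpower z (e-1))); [|apply continuous_const].
      apply (continuous_mult (K := R_AbsRing) (fun z => e)); [apply continuous_const|].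
      now apply continuous_Rpower.
    + apply (continuous_comp (fun z => (T + Rpower z e)^2) Rinv).
      * apply (continuous_comp (fun z => T + Rpower z e) (fun y => y^2)).
        -- apply (continuous_plus (K := R_AbsRing) (V := R_NormedModule) (fun _ => T)); [apply continuous_const|].
           now apply continuous_Rpower.
        -- apply (ex_derive_continuous (K := R_AbsRing) (V := R_NormedModule)). auto_derive; auto.
      * apply continuous_Rinv. apply pow_nonzero. lra.
  - intros z hz. eapply Rle_trans; [apply hle; auto|]. unfold K, Kpow. fold e.
    rewrite !Rmult_assoc. apply Rmult_le_compat_l; auto.
    assert (hp := Rpower_pos z e).
    match goal with |- _ <= ?r => replace r with
      (4 * Rpower t (x - m) * Rpower z (e - 1) * T / (T + Rpower z e) ^ 2) by (field; lra) end.
    destruct (Rle_dec z t) as [hzt|hzt].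
    + apply Rle_trans with (Rpower z (x - 1) * Rpower t (- m)).
      { apply Rmult_le_compat_l; [apply Rlt_le, Rpower_pos|]. apply Rle_Rpower_neg; lra. }
      apply Rle_trans with (Rpower t (x - m) * Rpower z (e - 1) / T).
      { replace (x - 1) with ((x - e) + (e - 1)) by ring.
        replace (Rpower t (x - m) * Rpower z (e - 1) / T) with
          (Rpower t (x - e) * Rpower z (e - 1) * Rpower t (- m)).
        - rewrite Rpower_plus. apply Rmult_le_compat_r; [apply Rlt_le, Rpower_pos|].
          apply Rmult_le_compat_r; [apply Rlt_le, Rpower_pos|]. apply Rle_Rpower_l; lra.
        - unfold T. unfold Rdiv. rewrite <- Rpower_Ropp.
          replace (x - e) with ((x - m) + - e + m) by ring. rewrite !Rpower_plus.
          rewrite (Rpower_Ropp t m). field. apply Rgt_not_eq, Rpower_pos. }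
      assert (hTz : Rpower z e <= T) by (apply Rle_Rpower_l; lra).
      apply (Rle_div_r _ _ ((T + Rpower z e) ^ 2)); [apply pow_lt; lra|].
      assert (h3 := Rpower_pos t (x-m)). assert (h4 := Rpower_pos z (e - 1)).
      replace (Rpower t (x - m) * Rpower z (e - 1) / T * (T + Rpower z e) ^ 2)
       with (Rpower t (x - m) * Rpower z (e - 1) * ((T + Rpower z e) ^ 2 / T)) by (field; lra).
      replace (4 * Rpower t (x - m) * Rpower z (e - 1) * T) with
       (Rpower t (x - m) * Rpower z (e - 1) * (4 * T)) by ring.
      apply Rmult_le_compat_l; [nra|]. apply Rle_div_l; [lra|]. nra.
    + apply Rle_trans with (Rpower z (x - 1) * Rpower z (- m)).
      { apply Rmult_le_compat_l; [apply Rlt_le, Rpower_pos|]. apply Rle_Rpower_neg; lra. }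
      apply Rle_trans with (Rpower t (x - m) * T * Rpower z (- e - 1)).
      { unfold T. rewrite <- !Rpower_plus.
        replace (x - 1 + - m) with (x - m + e + (- e - 1)) by ring.
        rewrite (Rpower_plus (x - m + e)). apply Rmult_le_compat_r; [apply Rlt_le, Rpower_pos|].
        apply Rle_Rpower_neg; lra. }
      assert (hTz : T <= Rpower z e) by (apply Rle_Rpower_l; lra).
      apply (Rle_div_r _ _ ((T + Rpower z e) ^ 2)); [apply pow_lt; lra|].
      assert (h3 := Rpower_pos t (x-m)). assert (h4 := Rpower_pos z (- e - 1)).
      replace (e - 1) with (e + e + (- e - 1)) by ring. rewrite !Rpower_plus.
      replace (4 * Rpower t (x - m) * (Rpower z e * Rpower z e * Rpower z (- e - 1)) * T)
       with (Rpower t (x - m) * T * Rpower z (- e - 1) * (4 * (Rpower z e)^2)) by ring.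
      apply Rmult_le_compat_l; [|nra]. apply Rmult_le_pos; [|lra]. nra.
  - replace (locally 0) with (locally (K * (0 / (T + 0)))) by (f_equal; field; lra).
    apply (filterlim_comp _ _ _ (fun z => Rpower z e) (fun y => K * (y / (T + y))) _ (locally 0)).
    + now apply Rpower_lim_0.
    + apply (ex_derive_continuous (K := R_AbsRing) (V := R_NormedModule) (fun y => K * (y / (T + y)))).
      auto_derive. lra.
  - replace (locally K) with (locally (K * (1 / (T * 0 + 1)))) by (f_equal; field).
    apply filterlim_ext_loc with (fun z => K * (1 / (T * Rpower z (- e) + 1))).
    + exists 0. intros z hz. rewrite Rpower_Ropp. assert (hp := Rpower_pos z e). field. split; lra.
    + apply (filterlim_comp _ _ _ (fun z => Rpower z (- e)) (fun y => K * (1 / (T * y + 1))) _ (locally 0)).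
      * apply Rpower_lim_oo; lra.
      * apply (ex_derive_continuous (K := R_AbsRing) (V := R_NormedModule) (fun y => K * (1 / (T * y + 1)))).
        auto_derive. lra.
Qed.

(** * Linear maps, antiderivatives and substitution under the integral *)

Section Calculus.

Variables V W : CompleteNormedModule R_AbsRing.

Lemma is_RInt_linear (L : V -> W) (f : R -> V) (a b : R) (v : V) :
  is_linear L -> is_RInt f a b v -> is_RInt (fun z => L (f z)) a b (L v).
Proof.
  intros hL hf. unfold is_RInt in *.
  assert (hS : forall ptd, Riemann_sum (fun z => L (f z)) ptd = L (Riemann_sum f ptd)).
  { intros ptd. apply (SF_cons_ind (T := R) (fun ptd =>
      Riemann_sum (fun z => L (f z)) ptd = L (Riemann_sum f ptd))).
    - intros x0. unfold Riemann_sum; simpl. symmetry. apply (linear_zero L hL).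
    - intros h s hs. rewrite !Riemann_sum_cons, hs.
      rewrite (linear_plus L hL). f_equal. symmetry. apply (linear_scal L hL). }
  apply (filterlim_ext (fun ptd => L (scal (sign (b - a)) (Riemann_sum f ptd)))).
  { intros ptd. rewrite hS. apply (linear_scal L hL). }
  eapply filterlim_comp; [exact hf|]. apply (linear_cont L v hL).
Qed.

Lemma is_RInt_gen_linear (L : V -> W) (f : R -> V) (Fa Fb : (R -> Prop) -> Prop)
  {FFa : Filter Fa} {FFb : Filter Fb} (v : V) :
  is_linear L -> is_RInt_gen f Fa Fb v -> is_RInt_gen (fun z => L (f z)) Fa Fb (L v).
Proof.
  intros hL hf P hP.
  assert (hc := linear_cont L v hL P hP).
  specialize (hf _ hc). unfold filtermapi, filtermap in *.
  revert hf. apply filter_imp. intros [a b] [y [h1 h2]].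
  exists (L y). split; auto. simpl in *. now apply is_RInt_linear.
Qed.

Lemma int0oo_derive (F f : R -> V) (l0 l1 : V) :
  (forall z, 0 < z -> is_derive F z (f z)) ->
  (forall z, 0 < z -> continuous f z) ->
  filterlim F (at_right 0) (locally l0) ->
  filterlim F (Rbar_locally p_infty) (locally l1) ->
  int0oo f (minus l1 l0).
Proof.
  intros hF hf h0 h1 P hP.
  assert (hsub : filterlim (fun ab : R*R => minus (F (snd ab)) (F (fst ab)))
       (filter_prod (at_right 0) (Rbar_locally p_infty)) (locally (minus l1 l0))).
  { unfold minus.
    apply (filterlim_comp_2 (F := filter_prod (at_right 0) (Rbar_locally p_infty))
      (G := locally l1) (H := locally (opp l0))
      (fun ab : R * R => F (snd ab)) (fun ab : R * R => opp (F (fst ab))) plus).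
    - apply (filterlim_comp _ _ _ (fun ab : R * R => snd ab) F _ (Rbar_locally p_infty)); auto.
      apply filterlim_snd.
    - apply (filterlim_comp _ _ _ (fun ab : R * R => F (fst ab)) opp _ (locally l0)).
      + apply (filterlim_comp _ _ _ (fun ab : R * R => fst ab) F _ (at_right 0)); auto.
        apply filterlim_fst.
      + apply (filterlim_opp (K := R_AbsRing) (V := V) l0).
    - apply (filterlim_plus (K := R_AbsRing) (V := V)). }
  specialize (hsub P hP). unfold filtermap, filtermapi in *.
  assert (hpos : filter_prod (at_right 0) (Rbar_locally p_infty)
     (fun ab : R * R => 0 < fst ab <= snd ab)).
  { apply half_line_eventually with 1 1; simpl; intros; lra. }
  generalize (filter_and _ _ hsub hpos). apply filter_imp.
  intros [a b] [k1 k2]; simpl in *. exists (minus (F b) (F a)). split; auto.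
  apply (@is_RInt_derive V); intros x hx; rewrite Rmin_left in hx by lra; [apply hF|apply hf]; lra.
Qed.

Lemma int0oo_subst (f : R -> V) (g dg : R -> R) (Fa Fb : (R -> Prop) -> Prop)
  {FFa : Filter Fa} {FFb : Filter Fb} (v : V) :
  (forall z, 0 < z -> continuous f z) ->
  (forall z, 0 < z -> 0 < g z /\ is_derive g z (dg z) /\ continuous dg z) ->
  filterlim g (at_right 0) Fa -> filterlim g (Rbar_locally p_infty) Fb ->
  is_RInt_gen f Fa Fb v ->
  int0oo (fun z => scal (dg z) (f (g z))) v.
Proof.
  intros hf hg ha hb hv P hP.
  specialize (hv P hP). unfold filtermapi in *.
  assert (hpb : filter_prod (at_right 0) (Rbar_locally p_infty)
     (fun ab => exists y, is_RInt f (g (fst ab)) (g (snd ab)) y /\ P y)).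
  { destruct hv as [Q1 Q2 hQ1 hQ2 hQ].
    exists (fun a => Q1 (g a)) (fun b => Q2 (g b)).
    - apply (ha _ hQ1).
    - apply (hb _ hQ2).
    - intros a b k1 k2. apply (hQ _ _ k1 k2). }
  assert (hpos : filter_prod (at_right 0) (Rbar_locally p_infty)
     (fun ab : R * R => 0 < fst ab <= snd ab)).
  { apply half_line_eventually with 1 1; simpl; intros; lra. }
  generalize (filter_and _ _ hpb hpos). apply filter_imp.
  intros [a b] [[y [k1 k2]] k3]; simpl in *. exists y. split; auto.
  rewrite <- (@is_RInt_unique V _ _ _ _ k1).
  apply (@is_RInt_comp V); intros x hx; rewrite Rmin_left in hx by lra.
  - apply hf. apply hg. lra.
  - apply hg. lra.
Qed.

Lemma int0oo_ext (f g : R -> V) (v : V) :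
  (forall z, 0 < z -> f z = g z) ->
  int0oo f v ->
  int0oo g v.
Proof.
  intros h. apply is_RInt_gen_ext; try apply _.
  apply half_line_eventually with 1 1; try lra. simpl. intros a b ha hb x hx.
  apply h. rewrite Rmin_left in hx; lra.
Qed.

(** The substitution [z -> 1/z] exchanges the two ends. *)
Lemma int0oo_inv (f : R -> V) (v : V) :
  (forall z, 0 < z -> continuous f z) ->
  int0oo f v ->
  int0oo (fun z => scal (/ z ^ 2) (f (/ z))) v.
Proof.
  intros hf hv.
  apply is_RInt_gen_swap in hv; try apply _.
  apply (int0oo_subst f Rinv (fun z => - / z ^ 2)) in hv; try apply _; auto.
  - apply is_RInt_gen_opp in hv; try apply _. rewrite opp_opp in hv.
    revert hv. apply int0oo_ext. intros z hz. rewrite <- (@scal_opp_l R_Ring V).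
    unfold opp; simpl. now rewrite Ropp_involutive.
  - intros z hz. split; [now apply Rinv_0_lt_compat|]. split.
    + auto_derive; [lra|]. field. lra.
    + apply (ex_derive_continuous (K := R_AbsRing) (V := R_NormedModule)). auto_derive.
      apply Rmult_integral_contrapositive_currified; [lra|]. lra.
  - apply filterlim_Rinv_0_right.
  - intros P [d hd]. unfold filtermap. exists (/ d).
    intros x hx. assert (hd0 := cond_pos d). assert (0 < x).
    { apply Rlt_trans with (2 := hx). now apply Rinv_0_lt_compat. }
    apply hd; [|now apply Rinv_0_lt_compat].
    unfold ball; simpl; unfold AbsRing_ball, abs, minus, plus, opp; simpl.
    rewrite Ropp_0, Rplus_0_r, Rabs_pos_eq; [|apply Rlt_le, Rinv_0_lt_compat; auto].
    rewrite <- (Rinv_inv d). apply Rinv_lt_contravar; auto.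
    apply Rmult_lt_0_compat; auto. now apply Rinv_0_lt_compat.
Qed.

Lemma int0oo_scale (f : R -> V) (v : V) (t : R) : 0 < t ->
  (forall z, 0 < z -> continuous f z) ->
  int0oo f v ->
  int0oo (fun z => scal t (f (t * z))) v.
Proof.
  intros ht hf hv.
  apply (int0oo_subst f (fun z => t * z) (fun _ => t)) in hv; try apply _; auto.
  - intros z hz. split; [nra|]. split; [|apply continuous_const].
    auto_derive; auto. ring.
  - intros P [d hd]. unfold filtermap.
    assert (hdt : 0 < d / t) by (apply Rdiv_lt_0_compat; auto; apply cond_pos).
    exists (mkposreal _ hdt). intros x hx h0.
    unfold ball in hx; simpl in hx; unfold AbsRing_ball, abs, minus, plus, opp in hx; simpl in hx.
    rewrite Ropp_0, Rplus_0_r, Rabs_pos_eq in hx by lra.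
    apply hd; [|nra].
    unfold ball; simpl; unfold AbsRing_ball, abs, minus, plus, opp; simpl.
    rewrite Ropp_0, Rplus_0_r, Rabs_pos_eq by nra.
    apply (Rmult_lt_compat_l t) in hx; auto. replace (t * (d / t)) with (pos d) in hx; auto. field; lra.
  - intros P [M hM]. exists (M / t). intros x hx. apply hM.
    apply (Rmult_lt_compat_l t) in hx; auto. replace (t * (M / t)) with M in hx; auto. field; lra.
Qed.

Lemma int0oo_unique (f : R -> V) (v w : V) :
  int0oo f v ->
  int0oo f w -> v = w.
Proof.
  intros hv hw. rewrite <- (is_RInt_gen_unique f v hv). now apply is_RInt_gen_unique.
Qed.

End Calculus.

(** * Complex powers of positive numbers *)

Lemma rcpow_pair (t : R) (z : C) :
  rcpow t z = (exp (Re z * ln t) * cos (Im z * ln t), exp (Re z * ln t) * sin (Im z * ln t)).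
Proof. unfold rcpow, Cmult, RtoC; simpl. f_equal; ring. Qed.

Lemma Cmod_rcpow (t : R) (z : C) : Cmod (rcpow t z) = Rpower t (Re z).
Proof.
  rewrite rcpow_pair. unfold Cmod; simpl.
  replace (exp (Re z * ln t) * cos (Im z * ln t) * (exp (Re z * ln t) * cos (Im z * ln t) * 1) +
   exp (Re z * ln t) * sin (Im z * ln t) * (exp (Re z * ln t) * sin (Im z * ln t) * 1))
  with ((exp (Re z * ln t))^2 * (Rsqr (sin (Im z * ln t)) + Rsqr (cos (Im z * ln t)))) by (unfold Rsqr; ring).
  rewrite sin2_cos2, Rmult_1_r, sqrt_pow2; auto. apply Rlt_le, exp_pos.
Qed.

Lemma rcpow_plus (t : R) (a b : C) : rcpow t (Cplus a b) = Cmult (rcpow t a) (rcpow t b).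
Proof.
  rewrite !rcpow_pair. unfold Cmult; simpl. unfold Re, Im; simpl.
  rewrite !Rmult_plus_distr_r, exp_plus, cos_plus, sin_plus. f_equal; ring.
Qed.

Lemma rcpow_real (t r : R) : rcpow t (RtoC r) = RtoC (Rpower t r).
Proof.
  rewrite rcpow_pair. unfold RtoC, Re, Im, Rpower; simpl.
  rewrite Rmult_0_l, cos_0, sin_0. f_equal; ring.
Qed.

Lemma rcpow_mult (t u : R) (z : C) : 0 < t -> 0 < u ->
  rcpow (t * u) z = Cmult (rcpow t z) (rcpow u z).
Proof.
  intros ht hu. rewrite !rcpow_pair, ln_mult by auto. unfold Cmult; simpl.
  rewrite !Rmult_plus_distr_l, exp_plus, cos_plus, sin_plus. f_equal; ring.
Qed.

Lemma rcpow_inv (t : R) (z : C) : 0 < t -> rcpow (/ t) z = rcpow t (Copp z).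
Proof.
  intros ht. rewrite !rcpow_pair, ln_Rinv by auto. unfold Copp, Re, Im; simpl.
  f_equal; f_equal; f_equal; ring.
Qed.

Lemma rcpow_pow (t : R) (n : nat) : 0 < t -> rcpow t (RtoC (INR n)) = RtoC (t ^ n).
Proof. intros ht. now rewrite rcpow_real, Rpower_pow. Qed.

Lemma rcpow_minus_1 (t : R) (z : C) : 0 < t ->
  rcpow t (Cminus z (RtoC 1)) = Cdiv (rcpow t z) (RtoC t).
Proof.
  intros ht. assert (h : RtoC t <> RtoC 0) by (intros h; apply RtoC_inj in h; lra).
  replace (rcpow t z) with (Cmult (rcpow t (Cminus z (RtoC 1))) (RtoC t)).
  - unfold Cdiv. rewrite <- Cmult_assoc, Cinv_r, Cmult_1_r; auto.
  - replace (RtoC t) with (rcpow t (RtoC 1)).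
    + rewrite <- rcpow_plus. f_equal. ring.
    + rewrite rcpow_real, Rpower_1; auto.
Qed.

Lemma is_derive_rcpow_re (t : R) (z : C) : 0 < t ->
  is_derive (fun t => Re (rcpow t z)) t (Re (Cmult z (rcpow t (Cminus z (RtoC 1))))).
Proof.
  intros ht.
  apply (is_derive_ext (fun t => exp (Re z * ln t) * cos (Im z * ln t))).
  { intros u. now rewrite rcpow_pair. }
  rewrite rcpow_minus_1, rcpow_pair by auto. destruct z as [x y]. simpl.
  auto_derive; auto. unfold Cdiv, Cinv, Cmult, RtoC, Re, Im; simpl. field. lra.
Qed.

Lemma is_derive_rcpow_im (t : R) (z : C) : 0 < t ->
  is_derive (fun t => Im (rcpow t z)) t (Im (Cmult z (rcpow t (Cminus z (RtoC 1))))).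
Proof.
  intros ht.
  apply (is_derive_ext (fun t => exp (Re z * ln t) * sin (Im z * ln t))).
  { intros u. now rewrite rcpow_pair. }
  rewrite rcpow_minus_1, rcpow_pair by auto. destruct z as [x y]. simpl.
  auto_derive; auto. unfold Cdiv, Cinv, Cmult, RtoC, Re, Im; simpl. field. lra.
Qed.

Lemma continuous_rcpow_re (t : R) (z : C) : 0 < t -> continuous (fun t => Re (rcpow t z)) t.
Proof.
  intros ht. apply (ex_derive_continuous (K := R_AbsRing) (V := R_NormedModule)).
  eexists; now apply is_derive_rcpow_re.
Qed.

Lemma continuous_rcpow_im (t : R) (z : C) : 0 < t -> continuous (fun t => Im (rcpow t z)) t.
Proof.
  intros ht. apply (ex_derive_continuous (K := R_AbsRing) (V := R_NormedModule)).
  eexists; now apply is_derive_rcpow_im.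
Qed.

(** * Mellin transforms and the Gamma and Beta constants *)

Lemma CR_norm (z : C) : @norm R_AbsRing CR z = Cmod z.
Proof.
  change (sqrt ((Rabs (fst z)) ^ 2 + (Rabs (snd z)) ^ 2) = Cmod z).
  unfold Cmod. now rewrite !RPow_abs, !Rabs_pos_eq by apply pow2_ge_0.
Qed.

Lemma continuous_CR (g : R -> C) u :
  continuous (fun t => Re (g t)) u -> continuous (fun t => Im (g t)) u ->
  continuous (g : R -> CR) u.
Proof.
  intros h1 h2. apply (continuous_ext (fun t => (Re (g t), Im (g t)) : CR)).
  { intros t. now destruct (g t). }
  apply filterlim_locally. intros eps.
  generalize (proj1 (filterlim_locally _ _) h1 eps) (proj1 (filterlim_locally _ _) h2 eps).
  intros k1 k2. generalize (filter_and _ _ k1 k2). apply filter_imp.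
  intros x [l1 l2]. split; auto.
Qed.

Lemma linear_Re : is_linear (U := CR) (V := R_CompleteNormedModule) (fun z : CR => Re z : R).
Proof.
  apply Build_is_linear.
  - reflexivity.
  - reflexivity.
  - exists 1. split; [lra|]. intros x. rewrite CR_norm, Rmult_1_l. apply re_le_Cmod.
Qed.

Lemma linear_Cmult (z : C) : is_linear (U := CR) (V := CR) (fun y : CR => Cmult z y : CR).
Proof.
  apply Build_is_linear.
  - intros x y. change (Cmult z (Cplus x y) = Cplus (Cmult z x) (Cmult z y)). ring.
  - intros k x. destruct x as [p q]. unfold scal; simpl. unfold prod_scal, Cmult, scal, mult; simpl.
    unfold mult; simpl. f_equal; ring.
  - exists (Cmod z + 1). split; [generalize (Cmod_ge_0 z); lra|]. intros x. rewrite !CR_norm.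
    rewrite Cmod_mult. generalize (Cmod_ge_0 x). nra.
Qed.

Lemma cos_lower (x : R) : 1 - x ^ 2 / 2 <= cos x.
Proof.
  assert (hpos : forall y, 0 < y -> sin y ^ 2 <= y ^ 2).
  { intros y hy. assert (h1 := sin_lt_x y hy).
    assert (h2 : - y <= sin y).
    { destruct (Rle_dec y PI) as [h|h].
      - generalize (sin_ge_0 y (Rlt_le _ _ hy) h). lra.
      - generalize (SIN_bound y) PI2_1. intros. unfold PI2 in *. lra. }
    nra. }
  assert (hs : sin (x / 2) ^ 2 <= (x / 2) ^ 2).
  { destruct (Rtotal_order (x / 2) 0) as [h|[h|h]].
    - replace (x / 2) with (- (- (x / 2))) by ring. rewrite sin_neg.
      generalize (hpos (- (x / 2)) ltac:(lra)). simpl. lra.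
    - rewrite h, sin_0. lra.
    - now apply hpos. }
  replace x with (2 * (x / 2)) at 2 by field. rewrite cos_2a_sin. nra.
Qed.

(** With [u = s^2] this is [ln s <= s - 1 <= s - 1/s], squared; the right side
    is a combination of [u], [1] and [1/u], whose integrals against a Mellin
    weight are known. *)
Lemma ln_sqr_le (u : R) : 0 < u -> (ln u) ^ 2 <= 4 * (u - 2 + / u).
Proof.
  assert (hmain : forall v, 1 <= v -> (ln v) ^ 2 <= 4 * (v - 2 + / v)).
  { intros v hv. set (s := sqrt v).
    assert (hs : 1 <= s) by (rewrite <- sqrt_1; apply sqrt_le_1_alt; auto).
    assert (hsv : v = s * s) by (symmetry; apply sqrt_def; lra).
    assert (hl : 0 <= ln s <= s - 1).
    { split; [rewrite <- ln_1; apply ln_le; lra|].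
      generalize (exp_ineq1_le (ln s)). rewrite exp_ln by lra. lra. }
    rewrite hsv, ln_mult by lra.
    replace (s * s - 2 + / (s * s)) with ((s - / s) ^ 2) by (field; lra).
    assert (h1 : s - 1 <= s - / s).
    { assert (/ s <= 1) by (rewrite <- Rinv_1; apply Rinv_le_contravar; lra). lra. }
    assert ((s - 1)^2 <= (s - / s) ^ 2) by (apply pow_incr; lra).
    assert ((ln s)^2 <= (s - 1) ^ 2) by (apply pow_incr; lra). nra. }
  intros hu. destruct (Rle_dec 1 u) as [h|h]; [now apply hmain|].
  assert (h1 : 1 <= / u).
  { rewrite <- Rinv_1. apply Rinv_le_contravar; lra. }
  generalize (hmain (/ u) h1). rewrite ln_Rinv, Rinv_inv by auto.
  intros h2. simpl in *. lra.
Qed.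

Lemma int0oo_ge_0 (f : R -> R) (l : R) :
  (forall z, 0 < z -> 0 <= f z) -> int0oo f l -> 0 <= l.
Proof.
  intros hf hl.
  assert (h0 : is_RInt_gen (V := R_NormedModule) (fun _ => 0) (at_right 0) (Rbar_locally p_infty) 0).
  { assert (h := is_RInt_gen_scal (V := R_NormedModule) f 0 l hl).
    match type of h with is_RInt_gen _ _ _ ?v => replace v with 0 in h by (symmetry; apply Rmult_0_l) end.
    revert h. apply (int0oo_ext R_CompleteNormedModule). intros z _. unfold scal; simpl; unfold mult; simpl; ring. }
  eapply Rle_trans; [apply (norm_ge_0 (V := R_NormedModule) 0)|].
  apply (RInt_gen_norm (V := R_CompleteNormedModule) (Fa := at_right 0) (Fb := Rbar_locally p_infty)
    (fun _ => 0) f 0 l); auto.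
  - apply half_line_eventually with 1 1; simpl; intros; lra.
  - apply half_line_eventually with 1 1; try lra. simpl; intros a b ha hb x hx.
    change (Rabs 0 <= f x). rewrite Rabs_R0. apply hf. lra.
Qed.

Lemma int0oo_gt_0 (f : R -> R) (l : R) :
  (forall z, 0 < z -> continuous f z) ->
  (forall z, 0 < z -> 0 < f z) -> int0oo f l -> 0 < l.
Proof.
  intros hc hf hl.
  assert (h1 : is_RInt f 1 2 (RInt f 1 2)).
  { apply (RInt_correct (V := R_CompleteNormedModule)). apply (ex_RInt_half_line R_CompleteNormedModule); auto; lra. }
  assert (hp : 0 < RInt f 1 2).
  { apply RInt_gt_0; [lra| |]; intros; [apply hf|apply hc]; lra. }
  apply Rlt_le_trans with (1 := hp).
  apply Rnot_lt_le. intros hlt.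
  assert (he : 0 < RInt f 1 2 - l) by lra.
  destruct (hl (fun y => Rabs (y - l) < RInt f 1 2 - l)) as [Q1 Q2 hQ1 hQ2 hQ].
  { exists (mkposreal _ he). intros y hy. exact hy. }
  assert (k1 : exists a, Q1 a /\ 0 < a < 1).
  { destruct hQ1 as [d hd]. exists (Rmin (d / 2) (1/2)).
    assert (hd0 := cond_pos d).
    assert (hm : 0 < Rmin (d / 2) (1 / 2)) by (apply Rmin_glb_lt; lra).
    assert (Rmin (d/2) (1/2) <= d / 2) by apply Rmin_l.
    assert (Rmin (d/2) (1/2) <= 1 / 2) by apply Rmin_r.
    split; [|lra]. apply hd; auto.
    unfold ball; simpl; unfold AbsRing_ball, abs, minus, plus, opp; simpl.
    rewrite Ropp_0, Rplus_0_r, Rabs_pos_eq; lra. }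
  assert (k2 : exists c, Q2 c /\ 2 < c).
  { destruct hQ2 as [M hM]. exists (Rmax (M + 1) 3).
    assert (M + 1 <= Rmax (M + 1) 3) by apply Rmax_l.
    assert (3 <= Rmax (M + 1) 3) by apply Rmax_r.
    split; [apply hM|]; lra. }
  destruct k1 as [a [q1 ha]], k2 as [c [q2 hc2]].
  destruct (hQ a c q1 q2) as [y [hy hyl]]. simpl in hy.
  assert (hex : forall p q, 0 < p -> 0 < q -> ex_RInt f p q).
  { intros. apply (ex_RInt_half_line R_CompleteNormedModule); auto. }
  rewrite <- (is_RInt_unique (V := R_CompleteNormedModule) _ _ _ _ hy) in hyl.
  rewrite <- (RInt_Chasles (V := R_CompleteNormedModule) f a 1 c) in hyl by (apply hex; lra).
  rewrite <- (RInt_Chasles (V := R_CompleteNormedModule) f 1 2 c) in hyl by (apply hex; lra).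
  unfold plus in hyl; simpl in hyl.
  assert (0 <= RInt f a 1) by (apply RInt_ge_0; [lra|apply hex; lra|intros; apply Rlt_le, hf; lra]).
  assert (0 <= RInt f 2 c) by (apply RInt_ge_0; [lra|apply hex; lra|intros; apply Rlt_le, hf; lra]).
  apply Rabs_def2 in hyl. lra.
Qed.

(** The integral [I] of [z^(iy) w(z)] is rotated by [m^(-iy)], and the real part
    is bounded below by [cos x >= 1 - x^2/2] and [ln_sqr_le] applied to [z/m].
    The resulting lower bound involves only the moments [I0], [I1], [I2] of [w];
    it is positive when [w] is concentrated near [m]. *)
Lemma concentrated_neq_0 (w : R -> R) (y m I0 I1 I2 : R) (I : C) :
  0 < m ->
  (forall z, 0 < z -> continuous w z) ->
  (forall z, 0 < z -> 0 < w z) ->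
  int0oo w I0 -> int0oo (fun z => z * w z) I1 -> int0oo (fun z => / z * w z) I2 ->
  intC (fun z => Cmult (rcpow z (0, y)) (RtoC (w z))) I ->
  2 * y ^ 2 * (I1 / m + m * I2 - 2 * I0) < I0 -> I <> RtoC 0.
Proof.
  intros hm hc hw h0 h1 h2 hI hlt hI0. subst I.
  set (g := rcpow (/ m) (0, y)).
  assert (hmi : 0 < / m) by (apply Rinv_0_lt_compat; auto).
  assert (hlin := is_linear_comp (K := R_AbsRing) (U := CR) (V := CR) (W := R_CompleteNormedModule)
    (fun z : CR => Cmult g z : CR) (fun z : CR => Re z : R) (linear_Cmult g) linear_Re).
  apply (is_RInt_gen_linear CR R_CompleteNormedModule _ _ (at_right 0) (Rbar_locally p_infty) _ hlin) in hI.
  replace (Re (Cmult g (RtoC 0))) with 0 in hI by (unfold Re, Cmult, RtoC; simpl; ring).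
  assert (hall : int0oo (fun z => (Re (Cmult g (Cmult (rcpow z (0, y)) (RtoC (w z)))))
     - (w z + (- (2 * y ^ 2 / m)) * (z * w z) + (- (2 * y ^ 2 * m)) * (/ z * w z) + (4 * y ^ 2) * w z))
     (0 - (I0 + (- (2 * y ^ 2 / m)) * I1 + (- (2 * y ^ 2 * m)) * I2 + (4 * y ^ 2) * I0))).
  { apply (is_RInt_gen_minus (V := R_NormedModule)); [exact hI|].
    apply (is_RInt_gen_plus (V := R_NormedModule) (fun z => w z + (- (2 * y ^ 2 / m)) * (z * w z)
       + (- (2 * y ^ 2 * m)) * (/ z * w z)) (fun z => (4 * y ^ 2) * w z)).
    - apply (is_RInt_gen_plus (V := R_NormedModule) (fun z => w z + (- (2 * y ^ 2 / m)) * (z * w z))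
        (fun z => (- (2 * y ^ 2 * m)) * (/ z * w z))).
      + apply (is_RInt_gen_plus (V := R_NormedModule) w (fun z => (- (2 * y ^ 2 / m)) * (z * w z))); [exact h0|].
        exact (is_RInt_gen_scal (V := R_NormedModule) _ (- (2 * y ^ 2 / m)) _ h1).
      + exact (is_RInt_gen_scal (V := R_NormedModule) _ (- (2 * y ^ 2 * m)) _ h2).
    - exact (is_RInt_gen_scal (V := R_NormedModule) _ (4 * y ^ 2) _ h0). }
  apply int0oo_ge_0 in hall.
  - replace (2 * y ^ 2 * (I1 / m + m * I2 - 2 * I0)) with
      (2 * y ^ 2 / m * I1 + 2 * y ^ 2 * m * I2 - 4 * y ^ 2 * I0) in hlt by (field; lra). lra.
  - intros z hz.
    replace (Re (Cmult g (Cmult (rcpow z (0, y)) (RtoC (w z))))) with (cos (y * ln (z / m)) * w z).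
    + assert (hzm : 0 < z / m) by (apply Rdiv_lt_0_compat; auto).
      assert (k1 := cos_lower (y * ln (z / m))). assert (k2 := ln_sqr_le (z / m) hzm).
      assert (k3 := hw z hz).
      replace (w z + (- (2 * y ^ 2 / m)) * (z * w z) + (- (2 * y ^ 2 * m)) * (/ z * w z) + (4 * y ^ 2) * w z)
       with ((1 - y ^ 2 / 2 * (4 * (z / m - 2 + / (z / m)))) * w z) by (field; lra).
      assert (k4 := pow2_ge_0 y).
      assert (k5 : y ^ 2 / 2 * (ln (z / m)) ^ 2 <= y ^ 2 / 2 * (4 * (z / m - 2 + / (z / m)))).
      { apply Rmult_le_compat_l; lra. }
      replace ((y * ln (z / m)) ^ 2) with (y ^ 2 * (ln (z / m)) ^ 2) in k1 by ring. nra.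
    + transitivity (Re (Cmult (Cmult (rcpow z (0, y)) g) (RtoC (w z)))); [|f_equal; ring].
      unfold g. rewrite <- rcpow_mult by auto. rewrite rcpow_pair.
      unfold Re, Im, Cmult, RtoC, Rdiv; simpl. rewrite Rmult_0_l, exp_0. ring.
Qed.

(** The integrand of the Mellin transform of [h] at [z]. *)
Definition mker (h : R -> R) (z : C) (t : R) : C :=
  Cmult (rcpow t (Cminus z (RtoC 1))) (RtoC (h t)).

Lemma continuous_mker h z t : 0 < t -> continuous h t -> continuous (mker h z : R -> CR) t.
Proof.
  intros ht hh. apply continuous_CR.
  - apply (continuous_ext (fun t => Re (rcpow t (Cminus z (RtoC 1))) * h t)).
    { intros u. unfold mker, Cmult, RtoC, Re; simpl. ring. }
    apply (continuous_mult (K := R_AbsRing)); auto. now apply continuous_rcpow_re.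
  - apply (continuous_ext (fun t => Im (rcpow t (Cminus z (RtoC 1))) * h t)).
    { intros u. unfold mker, Cmult, RtoC, Im; simpl. ring. }
    apply (continuous_mult (K := R_AbsRing)); auto. now apply continuous_rcpow_im.
Qed.

Lemma Cmod_mker h z t : Cmod (mker h z t) = Rpower t (Re z - 1) * Rabs (h t).
Proof. unfold mker. now rewrite Cmod_mult, Cmod_rcpow, Cmod_R. Qed.

Lemma mellin_ex h z C m : 0 < Re z < m -> 0 <= C ->
  (forall t, 0 < t -> continuous h t) ->
  (forall t, 0 < t -> Rabs (h t) <= C * Rpower (1 + t) (- m)) ->
  exists v, intC (mker h z) v.
Proof.
  intros hz hC hc hb.
  destruct (int0oo_power CR (mker h z) C 1 (Re z) m) as [v [hv _]]; try lra; auto.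
  - intros t ht. apply continuous_mker; auto.
  - intros t ht. rewrite CR_norm, Cmod_mker.
    rewrite (Rmult_comm C), Rmult_assoc. apply Rmult_le_compat_l; [apply Rlt_le, Rpower_pos|].
    rewrite Rmult_comm. auto.
  - now exists v.
Qed.

Lemma is_derive_CR (g : R -> C) t (l : C) :
  is_derive (fun t => Re (g t)) t (Re l) -> is_derive (fun t => Im (g t)) t (Im l) ->
  is_derive (g : R -> CR) t l.
Proof.
  intros h1 h2.
  assert (hs : forall (k : R) (c : C), @scal R_Ring CR k c = (k * fst c, k * snd c)) by reflexivity.
  apply (is_derive_ext (V := CR) (fun t => plus (scal (Re (g t)) ((1, 0) : CR)) (scal (Im (g t)) ((0, 1) : CR)))).
  { intros u. rewrite !hs. change (Cplus (Re (g u) * 1, Re (g u) * 0) (Im (g u) * 0, Im (g u) * 1) = g u).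
    destruct (g u) as [p q]. unfold Cplus, Re, Im; simpl. f_equal; ring. }
  evar_last.
  - apply (is_derive_plus (K := R_AbsRing) (V := CR)); apply (is_derive_scal_l (K := R_AbsRing) (V := CR)); eassumption.
  - rewrite !hs. change (Cplus (Re l * 1, Re l * 0) (Im l * 0, Im l * 1) = l).
    destruct l as [p q]. unfold Cplus, Re, Im; simpl. f_equal; ring.
Qed.

Lemma CR_lim_0 (F : R -> C) (g : R -> R) (Fl : (R -> Prop) -> Prop) {FF : Filter Fl} :
  Fl (fun z => Cmod (F z) <= g z) -> filterlim g Fl (locally 0) ->
  filterlim (F : R -> CR) Fl (locally (RtoC 0 : CR)).
Proof.
  intros h hg P [eps hP].
  assert (h1 := hg _ (locally_ball 0 eps)). unfold filtermap in *.
  generalize (filter_and _ _ h h1). apply filter_imp. intros z [k1 k2].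
  apply hP. apply (norm_compat1 (V := CR)). rewrite CR_norm.
  match goal with |- Cmod ?m < _ => replace m with (F z) end.
  - eapply Rle_lt_trans; [exact k1|]. eapply Rle_lt_trans; [apply Rle_abs|].
    unfold ball in k2; simpl in k2; unfold AbsRing_ball, abs, minus, plus, opp in k2; simpl in k2.
    now rewrite Ropp_0, Rplus_0_r in k2.
  - symmetry. change (Cminus (F z) (RtoC 0) = F z). ring.
Qed.

(** Integration by parts with the primitive [t^z h(t)], which vanishes at both
    ends. *)
Lemma mellin_ibp (h h' : R -> R) z K m (I I' : C) : 0 < Re z < m -> 0 <= K ->
  (forall t, 0 < t -> is_derive h t (h' t)) ->
  (forall t, 0 < t -> continuous h' t) ->
  (forall t, 0 < t -> Rabs (h t) <= K * Rpower (1 + t) (- m)) ->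
  intC (mker h z) I ->
  intC (mker h' (Cplus z (RtoC 1))) I' ->
  Cplus (Cmult z I) I' = RtoC 0.
Proof.
  intros hz hK hd hc hb hI hI'.
  set (F := fun t => Cmult (rcpow t z) (RtoC (h t))).
  set (f := fun t => Cplus (Cmult z (mker h z t)) (mker h' (Cplus z (RtoC 1)) t)).
  assert (hlin := linear_Cmult z).
  assert (h1 : intC f (Cplus (Cmult z I) I')).
  { apply (is_RInt_gen_plus (V := CR)); auto.
    apply (is_RInt_gen_linear CR CR (fun y : CR => Cmult z y : CR)); try apply _; auto. }
  assert (hpow : forall t y, 0 < t -> 0 < Re z < m -> Rabs (h t) <= y ->
     Cmod (F t) <= Rpower t (Re z) * y).
  { intros t y ht _ hy. unfold F. rewrite Cmod_mult, Cmod_rcpow, Cmod_R.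
    apply Rmult_le_compat_l; auto. apply Rlt_le, Rpower_pos. }
  refine (int0oo_unique CR f _ _ h1 _).
  replace (RtoC 0) with (@minus CR (RtoC 0) (RtoC 0)).
  2:{ change (Cminus (RtoC 0) (RtoC 0) = RtoC 0). ring. }
  apply (int0oo_derive CR F f).
  - intros t ht. apply is_derive_CR.
    + apply (is_derive_ext (fun t => Re (rcpow t z) * h t)).
      { intros u. unfold F, Cmult, RtoC, Re; simpl. ring. }
      evar_last.
      * apply (is_derive_mult (K := R_AbsRing) (fun t => Re (rcpow t z)) h).
        -- now apply is_derive_rcpow_re.
        -- now apply hd.
        -- intros; apply Rmult_comm.
      * unfold f, mker. replace (Cminus (Cplus z (RtoC 1)) (RtoC 1)) with z by ring.
        unfold plus, mult; simpl. unfold Cmult, Cplus, RtoC, Re; simpl. ring.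
    + apply (is_derive_ext (fun t => Im (rcpow t z) * h t)).
      { intros u. unfold F, Cmult, RtoC, Im; simpl. ring. }
      evar_last.
      * apply (is_derive_mult (K := R_AbsRing) (fun t => Im (rcpow t z)) h).
        -- now apply is_derive_rcpow_im.
        -- now apply hd.
        -- intros; apply Rmult_comm.
      * unfold f, mker. replace (Cminus (Cplus z (RtoC 1)) (RtoC 1)) with z by ring.
        unfold plus, mult; simpl. unfold Cmult, Cplus, RtoC, Im; simpl. ring.
  - intros t ht. apply (continuous_plus (K := R_AbsRing) (V := CR)).
    + apply (continuous_comp (V := CR) (W := CR) (mker h z) (fun y : CR => Cmult z y : CR)).
      * apply continuous_mker; auto. apply (ex_derive_continuous (K := R_AbsRing) (V := R_NormedModule)).
        eexists; apply hd; auto.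
      * apply (linear_cont (K := R_AbsRing) (U := CR) (V := CR)), hlin.
    + apply continuous_mker; auto.
  - apply (CR_lim_0 F (fun t => Rpower t (Re z) * K) (at_right 0)).
    + exists (mkposreal 1 Rlt_0_1). intros t _ ht. apply hpow; auto.
      eapply Rle_trans; [apply hb; auto|]. rewrite <- (Rmult_1_r K) at 2.
      apply Rmult_le_compat_l; auto.
      apply Rle_trans with (Rpower (1 + t) 0); [|rewrite Rpower_O; lra].
      apply Rle_Rpower; lra.
    + replace (locally 0) with (locally (0 * K)) by (f_equal; ring).
      apply (filterlim_comp _ _ _ (fun z0 => Rpower z0 (Re z)) (fun y => y * K) _ (locally 0)).
      * apply Rpower_lim_0. lra.
      * apply (continuous_mult (K := R_AbsRing) (fun y => y) (fun _ => K));
          [apply continuous_id|apply continuous_const].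
  - apply (CR_lim_0 F (fun t => Rpower t (Re z - m) * K) (Rbar_locally p_infty)).
    + exists 0. intros t ht. eapply Rle_trans; [apply hpow; auto|].
      unfold Rminus. rewrite Rpower_plus, Rmult_assoc, (Rmult_comm _ K).
      apply Rmult_le_compat_l; [apply Rlt_le, Rpower_pos|]. apply Rmult_le_compat_l; auto.
      apply Rle_Rpower_neg; lra.
    + replace (locally 0) with (locally (0 * K)) by (f_equal; ring).
      apply (filterlim_comp _ _ _ (fun z0 => Rpower z0 (Re z - m)) (fun y => y * K) _ (locally 0)).
      * apply Rpower_lim_oo. lra.
      * apply (continuous_mult (K := R_AbsRing) (fun y => y) (fun _ => K));
          [apply continuous_id|apply continuous_const].
Qed.

(** The first moments of the weight [t^(Re z - 1) h(t)] are values of the same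
    Mellin transform on the real axis; the ratios [p] and [q] come from a
    functional equation. *)
Lemma mellin_neq_0 (h : R -> R) (z : C) (m p q : R) (I A0 A1 A2 : C) :
  0 < m ->
  (forall t, 0 < t -> continuous h t) -> (forall t, 0 < t -> 0 < h t) ->
  intC (mker h z) I ->
  intC (mker h (RtoC (Re z))) A0 ->
  intC (mker h (RtoC (Re z + 1))) A1 ->
  intC (mker h (RtoC (Re z - 1))) A2 ->
  A1 = Cmult (RtoC p) A0 -> A2 = Cmult (RtoC q) A0 ->
  2 * Im z ^ 2 * (p / m + m * q - 2) < 1 -> I <> RtoC 0.
Proof.
  intros hm hc hp hI h0 h1 h2 e1 e2 hlt. subst A1 A2.
  set (w := fun t => Rpower t (Re z - 1) * h t).
  assert (hre : forall x (A : C), intC (mker h (RtoC x)) A ->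
     int0oo (fun t => Rpower t (x - 1) * h t) (Re A)).
  { intros x A hA.
    apply (is_RInt_gen_linear CR R_CompleteNormedModule _ _ (at_right 0) (Rbar_locally p_infty) _ linear_Re) in hA.
    revert hA. apply (int0oo_ext R_CompleteNormedModule). intros t ht. unfold mker.
    rewrite <- RtoC_minus, rcpow_real, <- RtoC_mult. reflexivity. }
  apply hre in h0, h1, h2.
  assert (hr : forall x (A : C), Re (Cmult (RtoC x) A) = x * Re A).
  { intros x A. unfold Re, Cmult, RtoC; simpl. ring. }
  rewrite hr in h1, h2.
  assert (hcw : forall t, 0 < t -> continuous w t).
  { intros t ht. apply (continuous_mult (K := R_AbsRing)); auto. now apply continuous_Rpower. }
  assert (hpw : forall t, 0 < t -> 0 < w t).
  { intros t ht. apply Rmult_lt_0_compat; auto. apply Rpower_pos. }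
  assert (hpos : 0 < Re A0) by (apply (int0oo_gt_0 w); auto).
  apply (concentrated_neq_0 w (Im z) m (Re A0) (p * Re A0) (q * Re A0)); auto.
  - revert h1. apply (int0oo_ext R_CompleteNormedModule). intros t ht. unfold w.
    replace (Re z + 1 - 1) with (1 + (Re z - 1)) by ring. rewrite Rpower_plus, Rpower_1 by auto. 
    apply Rmult_assoc.
  - revert h2. apply (int0oo_ext R_CompleteNormedModule). intros t ht. unfold w.
    replace (Re z - 1 - 1) with (Ropp 1 + (Re z - 1)) by ring.
    rewrite Rpower_plus, Rpower_Ropp, Rpower_1 by auto. apply Rmult_assoc.
  - revert hI. apply (int0oo_ext CR). intros t ht. unfold mker, w.
    rewrite RtoC_mult, <- rcpow_real, Cmult_assoc, <- rcpow_plus. f_equal. f_equal.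
    destruct z as [x y]. unfold Cminus, Cplus, Copp, RtoC, Re, Im; simpl. f_equal; ring.
  - replace (p * Re A0 / m + m * (q * Re A0) - 2 * Re A0) with
      ((p / m + m * q - 2) * Re A0) by (field; lra). nra.
Qed.

Definition beta_weight (n : nat) (t : R) : R := Rpower (1 + t) (- INR n).

(** The Beta value [B(z, n - z)]. *)
Definition beta (n : nat) (z : C) : C :=
  @RInt_gen CR (mker (beta_weight n) z) (at_right 0) (Rbar_locally p_infty).

Lemma beta_weight_pos n t : 0 < beta_weight n t.
Proof. apply Rpower_pos. Qed.

Lemma is_derive_beta_weight n t : 0 < t -> is_derive (beta_weight n) t (- INR n * beta_weight (S n) t).
Proof.
  intros ht. evar_last.
  - apply (is_derive_comp (fun t => Rpower t (- INR n)) (fun t => 1 + t)).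
    + apply is_derive_Rpower. lra.
    + auto_derive; auto.
  - unfold scal; simpl; unfold mult; simpl. unfold beta_weight. rewrite S_INR.
    replace (- INR n - 1) with (- (INR n + 1)) by ring. ring.
Qed.

Lemma continuous_beta_weight n t : 0 < t -> continuous (beta_weight n) t.
Proof.
  intros ht. apply (ex_derive_continuous (K := R_AbsRing) (V := R_NormedModule)).
  eexists; now apply is_derive_beta_weight.
Qed.

Lemma beta_spec n z : 0 < Re z < INR n ->
  intC (mker (beta_weight n) z) (beta n z).
Proof.
  intros hz. destruct (mellin_ex (beta_weight n) z 1 (INR n) hz) as [v hv]; try lra.
  - intros; now apply continuous_beta_weight.
  - intros t ht. rewrite Rabs_pos_eq by apply Rlt_le, beta_weight_pos. unfold beta_weight. lra.
  - unfold beta. now rewrite (is_RInt_gen_unique (V := CR) _ _ hv).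
Qed.

Lemma beta_raise n z : 0 < Re z < INR n ->
  Cmult (RtoC (INR n)) (beta (S n) (Cplus z (RtoC 1))) = Cmult z (beta n z).
Proof.
  intros hz.
  assert (h2 : 0 < Re (Cplus z (RtoC 1)) < INR (S n)).
  { rewrite S_INR. change (Re (Cplus z (RtoC 1))) with (Re z + 1). lra. }
  assert (h : Cplus (Cmult z (beta n z)) (Cmult (Copp (RtoC (INR n))) (beta (S n) (Cplus z (RtoC 1)))) = RtoC 0).
  { apply (mellin_ibp (beta_weight n) (fun t => - INR n * beta_weight (S n) t) z 1 (INR n)); try lra.
    - intros; now apply is_derive_beta_weight.
    - intros t ht. apply (continuous_mult (K := R_AbsRing) (fun _ => - INR n));
        [apply continuous_const|now apply continuous_beta_weight].
    - intros t ht. rewrite Rabs_pos_eq by apply Rlt_le, beta_weight_pos. unfold beta_weight. lra.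
    - now apply beta_spec.
    - apply (int0oo_ext CR (fun t => Cmult (Copp (RtoC (INR n))) (mker (beta_weight (S n)) (Cplus z (RtoC 1)) t))).
      + intros t ht. unfold mker. match goal with |- ?a = ?c => change (@eq C a c) end. rewrite RtoC_mult, RtoC_opp. ring.
      + apply (is_RInt_gen_linear CR CR (fun y : CR => Cmult (Copp (RtoC (INR n))) y : CR)); try apply _.
        * apply linear_Cmult.
        * now apply beta_spec. }
  transitivity (Cminus (Cmult z (beta n z)) (Cplus (Cmult z (beta n z)) (Cmult (Copp (RtoC (INR n))) (beta (S n) (Cplus z (RtoC 1)))))).
  - ring.
  - rewrite h. ring.
Qed.

Lemma beta_split n z : 0 < Re z < INR n ->
  beta n z = Cplus (beta (S n) z) (beta (S n) (Cplus z (RtoC 1))).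
Proof.
  intros hz. apply (int0oo_unique CR (mker (beta_weight n) z)); [now apply beta_spec|].
  apply (int0oo_ext CR (fun t => plus (mker (beta_weight (S n)) z t : CR) (mker (beta_weight (S n)) (Cplus z (RtoC 1)) t : CR))).
  - intros t ht. change (Cplus (mker (beta_weight (S n)) z t) (mker (beta_weight (S n)) (Cplus z (RtoC 1)) t) = mker (beta_weight n) z t).
    unfold mker. replace (Cminus (Cplus z (RtoC 1)) (RtoC 1)) with (Cplus (Cminus z (RtoC 1)) (RtoC 1)) by ring.
    rewrite rcpow_plus, rcpow_real, Rpower_1 by auto.
    replace (beta_weight n t) with (beta_weight (S n) t * (1 + t)).
    + rewrite RtoC_mult, RtoC_plus. ring.
    + unfold beta_weight. rewrite S_INR. rewrite <- (Rpower_1 (1 + t)) at 2 by lra.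
      rewrite <- Rpower_plus. f_equal. ring.
  - apply (is_RInt_gen_plus (V := CR)); apply beta_spec; rewrite S_INR.
    + lra.
    + change (Re (Cplus z (RtoC 1))) with (Re z + 1). lra.
Qed.

Lemma RtoC_neq_0 x : x <> 0 -> RtoC x <> RtoC 0.
Proof. intros h h'. now apply RtoC_inj in h'. Qed.

Lemma Re_gt_neq_0 z : 0 < Re z -> z <> RtoC 0.
Proof. intros h e. rewrite e in h. change (Re (RtoC 0)) with 0 in h. lra. Qed.

Lemma beta_up n z : 0 < Re z < INR n ->
  Cmult (RtoC (INR n)) (beta (S n) z) = Cmult (Cminus (RtoC (INR n)) z) (beta n z).
Proof.
  intros hz.
  transitivity (Cminus (Cmult (RtoC (INR n)) (Cplus (beta (S n) z) (beta (S n) (Cplus z (RtoC 1)))))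
     (Cmult (RtoC (INR n)) (beta (S n) (Cplus z (RtoC 1))))); [ring|].
  rewrite <- beta_split, beta_raise by auto. ring.
Qed.

(** [B(x+1, y-1) = x / (y-1) B(x, y)]. *)
Lemma beta_shift n z : 0 < Re z < INR n ->
  Cmult (Cminus (RtoC (INR n)) z) (beta (S n) (Cplus z (RtoC 1))) = Cmult z (beta (S n) z).
Proof.
  intros hz. assert (hn : RtoC (INR n) <> RtoC 0) by (apply RtoC_neq_0; lra).
  assert (h1 := beta_raise n z hz). assert (h2 := beta_up n z hz).
  apply (f_equal (Cmult (Cminus (RtoC (INR n)) z))) in h1.
  apply (f_equal (Cmult z)) in h2.
  assert (h3 : Cmult (RtoC (INR n)) (Cmult (Cminus (RtoC (INR n)) z) (beta (S n) (Cplus z (RtoC 1))))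
     = Cmult (RtoC (INR n)) (Cmult z (beta (S n) z))).
  { transitivity (Cmult (Cminus (RtoC (INR n)) z) (Cmult z (beta n z))).
    - rewrite <- h1. ring.
    - transitivity (Cmult z (Cmult (Cminus (RtoC (INR n)) z) (beta n z))); [ring|]. rewrite <- h2. ring. }
  transitivity (Cmult (Cmult (Cinv (RtoC (INR n))) (RtoC (INR n)))
    (Cmult (Cminus (RtoC (INR n)) z) (beta (S n) (Cplus z (RtoC 1))))).
  - rewrite Cinv_l by auto. ring.
  - rewrite <- Cmult_assoc, h3, Cmult_assoc, Cinv_l by auto. ring.
Qed.

Lemma Cmult_cancel_0 (a c : C) : a <> RtoC 0 -> Cmult a c = RtoC 0 -> c = RtoC 0.
Proof.
  intros ha h. transitivity (Cmult (Cinv a) (Cmult a c)).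
  - rewrite Cmult_assoc, Cinv_l by exact ha. ring.
  - rewrite h. ring.
Qed.

(** Zeros propagate towards large arguments, where the weight is concentrated
    enough to exclude them. *)
Lemma beta_climb n z : 0 < Re z < INR n -> beta n z = RtoC 0 -> forall N : nat,
  beta (n + N + N) (Cplus z (RtoC (INR N))) = RtoC 0.
Proof.
  intros hz h0 N. induction N as [|N IH].
  - rewrite <- !plus_n_O. replace (Cplus z (RtoC (INR 0))) with z by (simpl; ring). exact h0.
  - set (k := (n + N + N)%nat) in *. set (u := Cplus z (RtoC (INR N))) in *.
    replace (n + S N + S N)%nat with (S (S k)) by (unfold k; lia).
    replace (Cplus z (RtoC (INR (S N)))) with (Cplus u (RtoC 1)).
    2:{ unfold u. rewrite S_INR, RtoC_plus. ring. }
    assert (hu : 0 < Re u < INR k).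
    { change (Re u) with (Re z + INR N). unfold k. rewrite !plus_INR. generalize (pos_INR N). lra. }
    assert (h1 := beta_up k u hu). rewrite IH, Cmult_0_r in h1.
    assert (h1' : beta (S k) u = RtoC 0).
    { apply (Cmult_cancel_0 (RtoC (INR k))); [apply RtoC_neq_0; lra|exact h1]. }
    assert (hu' : 0 < Re u < INR (S k)) by (rewrite S_INR; lra).
    assert (h2 := beta_raise (S k) u hu'). rewrite h1', Cmult_0_r in h2.
    apply (Cmult_cancel_0 (RtoC (INR (S k)))); [|exact h2].
    apply RtoC_neq_0. rewrite S_INR. lra.
Qed.

(** At [z + N] in place of [z], with [n + 2N] in place of [n], the ratios of
    consecutive moments tend to [1] like [1/N], while [Im z] stays fixed; so
    [mellin_neq_0] applies for large [N], against [beta_climb]. *)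
Lemma beta_neq_0 n z : 0 < Re z < INR n -> beta n z <> RtoC 0.
Proof.
  intros hz h0.
  (* bounds the asymmetry of the two arguments of the Beta function, which
     is unchanged by the climb *)
  set (L := Rabs (Re z - (INR n - Re z)) + 1).
  assert (hL : 1 <= L) by (unfold L; generalize (Rabs_pos (Re z - (INR n - Re z))); lra).
  assert (hq : 0 <= 4 * Im z ^ 2 * L) by (generalize (pow2_ge_0 (Im z)); intros; nra).
  destruct (nfloor_ex (4 * Im z ^ 2 * L + 2)) as [N [_ hN]]; [lra|].
  rewrite <- S_INR in hN. assert (h := beta_climb n z hz h0 (S N)). revert h.
  set (M := INR (S N)) in *.
  assert (hk : exists k, (n + S N + S N)%nat = S (S k) /\ INR k = INR n + M + M - 2).
  { exists (n + N + N)%nat. split; [lia|]. unfold M. rewrite !plus_INR, S_INR. lra. }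
  destruct hk as [k [ek hk]]. rewrite ek.
  set (u := Cplus z (RtoC M)).
  assert (hu : Re u = Re z + M) by reflexivity.
  assert (hui : Im u = Im z) by (unfold u, Im; simpl; ring).
  assert (hSk : INR (S k) = INR n + M + M - 1) by (rewrite S_INR; lra).
  assert (hSSk : INR (S (S k)) = INR n + M + M) by (rewrite S_INR, hSk; lra).
  set (x := Re z + M) in *. set (y := INR n - Re z + M).
  assert (hp1 : 0 < INR (S k) - x) by (rewrite hSk; unfold x; lra).
  assert (hp2 : 0 < x - 1) by (unfold x; lra).
  apply (mellin_neq_0 (beta_weight (S (S k))) u 1 (x / (y - 1)) (y / (x - 1)) _
    (beta (S (S k)) (RtoC (Re u))) (beta (S (S k)) (RtoC (Re u + 1))) (beta (S (S k)) (RtoC (Re u - 1)))); try lra.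
  - intros; now apply continuous_beta_weight.
  - intros; apply beta_weight_pos.
  - apply beta_spec. rewrite hu, hSSk. unfold x. lra.
  - apply beta_spec. change (Re (RtoC (Re u))) with (Re u). rewrite hu, hSSk. unfold x. lra.
  - apply beta_spec. change (Re (RtoC (Re u + 1))) with (Re u + 1). rewrite hu, hSSk. unfold x. lra.
  - apply beta_spec. change (Re (RtoC (Re u - 1))) with (Re u - 1). rewrite hu, hSSk. unfold x. lra.
  - rewrite hu, RtoC_plus.
    assert (h := beta_shift (S k) (RtoC x)). change (Re (RtoC x)) with x in h.
    specialize (h ltac:(unfold x in *; lra)).
    rewrite <- RtoC_minus in h. replace (INR (S k) - x) with (y - 1) in h by (rewrite hSk; unfold x, y; lra).
    assert (hy : RtoC (y - 1) <> RtoC 0) by (apply RtoC_neq_0; unfold x, y in *; lra).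
    rewrite RtoC_div by (unfold x, y in *; lra).
    transitivity (Cmult (Cinv (RtoC (y - 1))) (Cmult (RtoC (y - 1)) (beta (S (S k)) (Cplus (RtoC x) (RtoC 1))))).
    + rewrite Cmult_assoc, Cinv_l by auto. ring.
    + rewrite h. unfold Cdiv. ring.
  - rewrite hu.
    assert (h := beta_shift (S k) (RtoC (x - 1))). change (Re (RtoC (x - 1))) with (x - 1) in h.
    specialize (h ltac:(unfold x in *; lra)).
    rewrite <- RtoC_minus, <- RtoC_plus in h. replace (INR (S k) - (x - 1)) with y in h by (rewrite hSk; unfold x, y; lra).
    replace (x - 1 + 1) with x in h by ring.
    assert (hx : RtoC (x - 1) <> RtoC 0) by (apply RtoC_neq_0; lra).
    rewrite RtoC_div by lra.
    transitivity (Cmult (Cinv (RtoC (x - 1))) (Cmult (RtoC (x - 1)) (beta (S (S k)) (RtoC (x - 1))))).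
    + rewrite Cmult_assoc, Cinv_l by auto. ring.
    + rewrite <- h. unfold Cdiv. ring.
  - rewrite hui.
    assert (hyx : y - 1 = INR (S k) - x) by (rewrite hSk; unfold x, y; lra).
    replace (x / (y - 1) / 1 + 1 * (y / (x - 1)) - 2) with
      ((x - y + 1) / (y - 1) + (y - x + 1) / (x - 1)) by (field; lra).
    assert (hM1 : 0 < M - 1) by lra.
    assert (b1 : (x - y + 1) / (y - 1) <= L / (M - 1)).
    { apply Rle_trans with (L / (y - 1)).
      - apply Rmult_le_compat_r; [apply Rlt_le, Rinv_0_lt_compat; lra|].
        unfold L, x, y. generalize (Rle_abs (Re z - (INR n - Re z))). lra.
      - apply Rmult_le_compat_l; [lra|]. apply Rinv_le_contravar; unfold y; lra. }
    assert (b2 : (y - x + 1) / (x - 1) <= L / (M - 1)).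
    { apply Rle_trans with (L / (x - 1)).
      - apply Rmult_le_compat_r; [apply Rlt_le, Rinv_0_lt_compat; lra|].
        unfold L, x, y. generalize (Rle_abs (- (Re z - (INR n - Re z)))). rewrite Rabs_Ropp. lra.
      - apply Rmult_le_compat_l; [lra|]. apply Rinv_le_contravar; unfold x; lra. }
    apply Rle_lt_trans with (2 * Im z ^ 2 * (2 * (L / (M - 1)))).
    + apply Rmult_le_compat_l; [generalize (pow2_ge_0 (Im z)); lra|lra].
    + replace (2 * Im z ^ 2 * (2 * (L / (M - 1)))) with ((4 * Im z ^ 2 * L) / (M - 1)) by (field; lra).
      apply Rlt_div_l; lra.
Qed.

Definition exp_neg (t : R) : R := exp (- t).

Lemma exp_neg_bound (k : nat) : exists C, 0 <= C /\ forall t, 0 < t ->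
  Rabs (exp_neg t) <= C * Rpower (1 + t) (- INR k).
Proof.
  exists (INR (S k) ^ k). split; [apply pow_le, pos_INR|]. intros t ht.
  unfold exp_neg. rewrite Rabs_pos_eq by apply Rlt_le, exp_pos.
  assert (hk : 1 <= INR (S k)) by (rewrite S_INR; generalize (pos_INR k); lra).
  rewrite Rpower_Ropp, Rpower_pow, exp_Ropp by lra.
  assert (h : ((1 + t) / INR (S k)) ^ k <= exp t).
  { replace t with (INR (S k) * (t / INR (S k))) at 2 by (field; lra).
    assert (h1 : (1 + t) / INR (S k) <= exp (t / INR (S k))).
    { eapply Rle_trans; [|apply exp_ineq1_le]. apply Rle_div_l; [lra|].
      replace ((1 + t / INR (S k)) * INR (S k)) with (INR (S k) + t) by (field; lra). lra. }
    assert (h2 : 0 <= (1 + t) / INR (S k)) by (apply Rdiv_le_0_compat; lra).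
    assert (h3 : 1 <= exp (t / INR (S k))).
    { rewrite <- exp_0. left. apply exp_increasing. apply Rdiv_lt_0_compat; lra. }
    rewrite <- Rpower_pow by (apply exp_pos || apply Rdiv_lt_0_compat; lra).
    apply Rle_trans with (Rpower (exp (t / INR (S k))) (INR k)).
    - apply Rle_Rpower_l; [apply pos_INR|]. split; [apply Rdiv_lt_0_compat; lra|auto].
    - unfold Rpower. rewrite ln_exp. 
      assert (0 <= t / INR (S k)) by (apply Rdiv_le_0_compat; lra).
      assert (hle : INR k * (t / INR (S k)) <= INR (S k) * (t / INR (S k))).
      { apply Rmult_le_compat_r; auto. rewrite S_INR; lra. }
      destruct hle as [hle|hle]; [left; now apply exp_increasing|rewrite hle; lra]. }
  unfold Rdiv in h. rewrite Rpow_mult_distr, pow_inv in h.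
  assert (hp : 0 < INR (S k) ^ k) by (apply pow_lt; lra).
  assert (hp2 : 0 < (1 + t) ^ k) by (apply pow_lt; lra).
  replace (INR (S k) ^ k * / (1 + t) ^ k) with (/ ((1 + t) ^ k * / INR (S k) ^ k)).
  - apply Rinv_le_contravar; auto. apply Rmult_lt_0_compat; auto. now apply Rinv_0_lt_compat.
  - field. lra.
Qed.

Lemma is_derive_exp_neg t : is_derive exp_neg t (- exp_neg t).
Proof. unfold exp_neg. auto_derive; auto. ring. Qed.

Lemma continuous_exp_neg t : continuous exp_neg t.
Proof.
  apply (ex_derive_continuous (K := R_AbsRing) (V := R_NormedModule)).
  eexists; apply is_derive_exp_neg.
Qed.

Lemma CGamma_spec z : 0 < Re z ->
  intC (mker exp_neg z) (CGamma z).
Proof.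
  intros hz. destruct (nfloor_ex (Re z) (Rlt_le _ _ hz)) as [k [_ hk]]. rewrite <- S_INR in hk.
  destruct (exp_neg_bound (S k)) as [K [hK hb]].
  destruct (mellin_ex exp_neg z K (INR (S k))) as [v hv]; auto; try lra.
  - intros; apply continuous_exp_neg.
  - change (CGamma z) with (@RInt_gen CR (mker exp_neg z) (at_right 0) (Rbar_locally p_infty)).
    now rewrite (is_RInt_gen_unique (V := CR) _ _ hv).
Qed.

Lemma CGamma_plus_1 z : 0 < Re z -> CGamma (Cplus z (RtoC 1)) = Cmult z (CGamma z).
Proof.
  intros hz. destruct (nfloor_ex (Re z) (Rlt_le _ _ hz)) as [k [_ hk]]. rewrite <- S_INR in hk.
  destruct (exp_neg_bound (S k)) as [K [hK hb]].
  assert (h : Cplus (Cmult z (CGamma z)) (Cmult (Copp (RtoC 1)) (CGamma (Cplus z (RtoC 1)))) = RtoC 0).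
  { apply (mellin_ibp exp_neg (fun t => - exp_neg t) z K (INR (S k))); auto; try lra.
    - intros; apply is_derive_exp_neg.
    - intros t _. apply (continuous_opp (K := R_AbsRing) (V := R_NormedModule) exp_neg), continuous_exp_neg.
    - now apply CGamma_spec.
    - apply (int0oo_ext CR (fun t => Cmult (Copp (RtoC 1)) (mker exp_neg (Cplus z (RtoC 1)) t))).
      + intros t ht. unfold mker. match goal with |- ?a = ?c => change (@eq C a c) end. rewrite RtoC_opp. ring.
      + apply (is_RInt_gen_linear CR CR (fun y : CR => Cmult (Copp (RtoC 1)) y : CR)); try apply _.
        * apply linear_Cmult.
        * apply CGamma_spec. change (Re (Cplus z (RtoC 1))) with (Re z + 1). lra. }
  transitivity (Cminus (Cmult z (CGamma z)) (Cplus (Cmult z (CGamma z)) (Cmult (Copp (RtoC 1)) (CGamma (Cplus z (RtoC 1)))))).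
  - ring.
  - rewrite h. ring.
Qed.

Lemma CGamma_climb z : 0 < Re z -> CGamma z = RtoC 0 -> forall N : nat,
  CGamma (Cplus z (RtoC (INR N))) = RtoC 0.
Proof.
  intros hz h0 N. induction N as [|N IH].
  - replace (Cplus z (RtoC (INR 0))) with z by (simpl; ring). exact h0.
  - replace (Cplus z (RtoC (INR (S N)))) with (Cplus (Cplus z (RtoC (INR N))) (RtoC 1)).
    2:{ rewrite S_INR, RtoC_plus. ring. }
    rewrite CGamma_plus_1, IH; [ring|].
    change (Re (Cplus z (RtoC (INR N)))) with (Re z + INR N). generalize (pos_INR N). lra.
Qed.

(** As for [beta_neq_0]: a zero at [z] gives zeros at all [z + N], whereas the
    Gamma weight at [z + N] is concentrated near [m = Re z + N]. *)
Lemma CGamma_neq_0 z : 0 < Re z -> CGamma z <> RtoC 0.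
Proof.
  intros hz h0.
  assert (hq : 0 <= 2 * Im z ^ 2) by (generalize (pow2_ge_0 (Im z)); intros; lra).
  destruct (nfloor_ex (2 * Im z ^ 2 + 2)) as [N [_ hN]]; [lra|].
  rewrite <- S_INR in hN. assert (h := CGamma_climb z hz h0 (S N)). revert h.
  set (M := INR (S N)) in *. set (u := Cplus z (RtoC M)).
  assert (hu : Re u = Re z + M) by reflexivity.
  assert (hui : Im u = Im z) by (unfold u, Im; simpl; ring).
  set (x := Re z + M) in *.
  assert (hx : 1 < x) by (unfold x; lra).
  apply (mellin_neq_0 exp_neg u x x (/ (x - 1)) _
    (CGamma (RtoC (Re u))) (CGamma (RtoC (Re u + 1))) (CGamma (RtoC (Re u - 1)))); try lra.
  - intros; apply continuous_exp_neg.
  - intros; apply exp_pos.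
  - apply CGamma_spec. lra.
  - apply CGamma_spec. change (Re (RtoC (Re u))) with (Re u). lra.
  - apply CGamma_spec. change (Re (RtoC (Re u + 1))) with (Re u + 1). lra.
  - apply CGamma_spec. change (Re (RtoC (Re u - 1))) with (Re u - 1). lra.
  - rewrite hu, RtoC_plus. apply CGamma_plus_1. change (Re (RtoC x)) with x. lra.
  - rewrite hu. assert (hc : RtoC (x - 1) <> RtoC 0) by (apply RtoC_neq_0; lra).
    assert (h := CGamma_plus_1 (RtoC (x - 1))). change (Re (RtoC (x - 1))) with (x - 1) in h.
    specialize (h ltac:(lra)). rewrite <- RtoC_plus in h. replace (x - 1 + 1) with x in h by ring.
    rewrite h, RtoC_inv by lra. rewrite Cmult_assoc, Cinv_l by auto. ring.
  - rewrite hui. replace (x / x + x * / (x - 1) - 2) with (/ (x - 1)) by (field; lra).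
    apply Rlt_div_l; [lra|]. unfold x. lra.
Qed.

(** * Complex Banach spaces over the reals *)

Section RealStructure.

Variable X : CompleteNormedModule C_AbsRing.
Notation XR := (real_CompleteNormedModule X).

(** Reduces calculus with complex factors to two real ones and the fixed
    continuous map [v -> i v]. *)
Lemma xscal_split (z : C) (v : X) :
  scal z v = plus (scal (RtoC (Re z)) v) (scal (RtoC (Im z)) (scal Ci v)).
Proof.
  rewrite scal_assoc.
  rewrite <- (@scal_distr_r C_Ring X). f_equal.
  destruct z as [x y]. unfold plus, mult; simpl. unfold Ci, Cplus, Cmult, RtoC; simpl.
  f_equal; ring.
Qed.

Lemma xnorm_scal (z : C) (v : X) : norm (scal z v) = Cmod z * norm v.
Proof.
  apply Rle_antisym; [apply (@norm_scal C_AbsRing X)|].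
  destruct (Ceq_dec z (RtoC 0)) as [h|h].
  - rewrite h, Cmod_0, Rmult_0_l. apply norm_ge_0.
  - replace v with (scal (Cinv z) (scal z v)) at 1.
    + apply Rle_trans with (Cmod z * (Cmod (Cinv z) * norm (scal z v))).
      * apply Rmult_le_compat_l; [apply Cmod_ge_0|]. apply (@norm_scal C_AbsRing X (Cinv z)).
      * rewrite Cmod_inv by auto. assert (h1 := proj1 (Cmod_gt_0 z) h).
        right. field. lra.
    + rewrite scal_assoc. unfold mult; simpl. rewrite Cinv_l by auto. apply (@scal_one C_Ring X).
Qed.

Lemma xscal_real_linear (z : C) : is_linear (U := XR) (V := XR) (fun v => scal z (v : X) : XR).
Proof.
  apply Build_is_linear.
  - intros x y. apply (@scal_distr_l C_Ring X).
  - intros k x. change (scal z (scal (RtoC k) (x : X)) = scal (RtoC k) (scal z (x : X))).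
    rewrite !scal_assoc. f_equal. apply Cmult_comm.
  - exists (Cmod z + 1). split; [generalize (Cmod_ge_0 z); lra|]. intros v.
    change (norm (scal z (v : X)) <= (Cmod z + 1) * norm (v : X)).
    rewrite xnorm_scal. generalize (norm_ge_0 (v : X)). intros; nra.
Qed.

Lemma continuous_cscal (g : R -> C) (F : R -> X) (t : R) :
  continuous (fun t => Re (g t)) t -> continuous (fun t => Im (g t)) t ->
  continuous (F : R -> XR) t -> continuous (fun t => scal (g t) (F t) : XR) t.
Proof.
  intros h1 h2 hF.
  apply (continuous_ext (fun t => plus (scal (Re (g t)) (F t : XR))
            (scal (Im (g t)) (scal Ci (F t) : XR)))).
  { intros u. symmetry. apply xscal_split. }
  apply (continuous_plus (K := R_AbsRing) (V := XR)).
  - now apply (continuous_scal (K := R_AbsRing) (V := XR)).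
  - apply (continuous_scal (K := R_AbsRing) (V := XR)); auto.
    apply (continuous_comp (V := XR) (W := XR) F (fun v => scal Ci (v : X))); auto.
    apply (linear_cont (K := R_AbsRing) (U := XR) (V := XR)). apply xscal_real_linear.
Qed.

Lemma is_derive_rscal (g : R -> R) (F : R -> XR) (t g' : R) (F' : XR) :
  is_derive g t g' -> is_derive F t F' ->
  is_derive (fun t => scal (g t) (F t)) t (plus (scal g' (F t)) (scal (g t) F')).
Proof.
  intros hg hF. unfold is_derive.
  eapply (filterdiff_ext_lin (K := R_AbsRing) (V := XR)).
  - apply (filterdiff_scal_fct (K := R_AbsRing) (U := AbsRing_NormedModule R_AbsRing) (V := XR) t g F).
    + intros n m. apply Rmult_comm.
    + exact hg.
    + exact hF.
  - intros y. simpl. rewrite (@scal_distr_l R_Ring XR). f_equal.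
    + symmetry. apply (@scal_assoc R_Ring XR).
    + rewrite !(@scal_assoc R_Ring XR). f_equal. apply Rmult_comm.
Qed.

Lemma is_derive_cscal (g : R -> C) (F : R -> X) (t : R) (g' : C) (F' : X) :
  is_derive (fun t => Re (g t)) t (Re g') -> is_derive (fun t => Im (g t)) t (Im g') ->
  is_derive (F : R -> XR) t F' ->
  is_derive (fun t => scal (g t) (F t) : XR) t (plus (scal g' (F t)) (scal (g t) F') : XR).
Proof.
  intros h1 h2 hF.
  apply (is_derive_ext (V := XR) (fun t => plus (scal (Re (g t)) (F t : XR))
            (scal (Im (g t)) (scal Ci (F t) : XR)))).
  { intros u. symmetry. apply xscal_split. }
  evar_last.
  - apply (is_derive_plus (K := R_AbsRing) (V := XR)).
    + apply is_derive_rscal; [exact h1|exact hF].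
    + apply is_derive_rscal; [exact h2|].
      unfold is_derive.
      eapply (filterdiff_ext_lin (K := R_AbsRing) (V := XR)).
      * apply (filterdiff_comp (K := R_AbsRing) (V := XR) (W := XR) F (fun v => scal Ci (v : X) : XR) _ (fun v => scal Ci (v : X) : XR) hF).
        apply filterdiff_linear, xscal_real_linear.
      * intros y. simpl. exact (linear_scal (K := R_AbsRing) (U := XR) (V := XR) (fun v => scal Ci (v : X) : XR) (xscal_real_linear Ci) y F').
  - rewrite (xscal_split g'), (xscal_split (g t) F').
    set (p := scal (RtoC (Re g')) (F t)). set (q := scal (RtoC (Im g')) (scal Ci (F t))).
    set (u := scal (RtoC (Re (g t))) F'). set (w := scal (RtoC (Im (g t))) (scal Ci F')).
    change (plus (plus p u) (plus q w) = plus (plus p q) (plus u w)).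
    rewrite <- !plus_assoc. f_equal. rewrite !plus_assoc. f_equal. apply plus_comm.
Qed.

End RealStructure.

(** * The commutative ring of operators *)

Definition linear_map {X : CompleteNormedModule C_AbsRing} (T : X -> X) : Prop :=
  (forall x y, T (plus x y) = plus (T x) (T y)) /\
  (forall (z : C) x, T (scal z x) = scal z (T x)).

Definition bnd {X : CompleteNormedModule C_AbsRing} (T : X -> X) (M : R) : Prop :=
  0 <= M /\ forall x, norm (T x) <= M * norm x.

(** A positive operator enters the analysis through [rb = A^(-1)] and
    [rs t = (t + A)^(-1)], which are everywhere defined and bounded, rather than
    through the unbounded [A]. The fields [rs_right] and [rs_left] say that [rs t]
    is a two-sided inverse of [t + A], both sides being multiplied by
    [A^(-1)]. *)
Record resolvents (X : CompleteNormedModule C_AbsRing) := {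
  rb : X -> X;
  rs : R -> X -> X;
  rb_lin : linear_map rb;
  rb_bdd : exists M, bnd rb M;
  rb_inj : forall x, rb x = zero -> x = zero;
  rs_lin : forall t, 0 <= t -> linear_map (rs t);
  rs_bdd : forall t, 0 <= t -> exists M, bnd (rs t) M;
  rs_right : forall t x, 0 <= t ->
    plus (rs t x) (scal (RtoC t) (rb (rs t x))) = rb x;
  rs_left : forall t x, 0 <= t -> rs t (plus x (scal (RtoC t) (rb x))) = rb x;
  rs_sec : exists M, forall t x, 0 < t -> norm (scal (RtoC t) (rs t x)) <= M * norm x }.

Arguments rb {X} _ _.
Arguments rs {X} _ _ _.

Section OperatorRing.

Variable X : CompleteNormedModule C_AbsRing.
Variable D : resolvents X.

(** The bounded operators that commute with the commutant of [A^(-1)]. The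
    bicommutant is a commutative ring, closed under limits and integrals, and
    contains every function of [A] that is used. *)
Record Op := mkOp {
  fn :> X -> X;
  op_lin : linear_map fn;
  op_bdd : exists M, bnd fn M;
  op_comm : forall S : X -> X, linear_map S -> (exists M, bnd S M) ->
    (forall x, S (rb D x) = rb D (S x)) -> forall x, S (fn x) = fn (S x) }.

(** Equality of operators is Leibniz equality, so that [ring] and rewriting
    apply. *)
Lemma op_eq (S T : Op) : (forall x, S x = T x) -> S = T.
Proof.
  destruct S as [f h1 h2 h3], T as [g k1 k2 k3]; simpl. intros h.
  assert (f = g) by (apply functional_extensionality; auto). subst g.
  f_equal; apply proof_irrelevance.
Qed.

Lemma xplus_opp_r (x : X) : plus x (opp x) = zero.
Proof. exact (@plus_opp_r (CompleteNormedModule.AbelianGroup C_AbsRing X) x). Qed.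

Lemma xopp_plus (x y : X) : opp (plus x y) = plus (opp x) (opp y).
Proof. exact (@opp_plus (CompleteNormedModule.AbelianGroup C_AbsRing X) x y). Qed.

Lemma xscal_plus (z : C) (x y : X) : scal z (plus x y) = plus (scal z x) (scal z y).
Proof. apply (@scal_distr_l C_Ring X). Qed.

Lemma xscal_opp (z : C) (x : X) : scal z (opp x) = opp (scal z x).
Proof. apply (@scal_opp_r C_Ring X). Qed.

Lemma xscal_mult (z w : C) (x : X) : scal z (scal w x) = scal (Cmult z w) x.
Proof. apply (@scal_assoc C_Ring X). Qed.

Lemma xscal_0_l (x : X) : scal (RtoC 0) x = zero.
Proof. apply (@scal_zero_l C_Ring X). Qed.

Lemma xscal_1_l (x : X) : scal (RtoC 1) x = x.
Proof. apply (@scal_one C_Ring X). Qed.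

Lemma xplus_swap (a b c d : X) : plus (plus a b) (plus c d) = plus (plus a c) (plus b d).
Proof. rewrite <- !plus_assoc. f_equal. rewrite !plus_assoc. f_equal. apply plus_comm. Qed.

Lemma xnorm_zero : norm (zero : X) = 0.
Proof. exact (@norm_zero C_AbsRing X). Qed.

Lemma xnorm_opp (x : X) : norm (opp x) = norm x.
Proof. exact (@norm_opp C_AbsRing X x). Qed.

Lemma xnorm_plus (x y : X) : norm (plus x y) <= norm x + norm y.
Proof. exact (@norm_triangle C_AbsRing X x y). Qed.

Lemma xnorm_ge_0 (x : X) : 0 <= norm x.
Proof. exact (@norm_ge_0 C_AbsRing X x). Qed.

Lemma xnorm_eq_0 (x : X) : norm x = 0 -> x = zero.
Proof. exact (@norm_eq_zero C_AbsRing X x). Qed.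

Lemma lin_zero (T : X -> X) : linear_map T -> T zero = zero.
Proof.
  intros [_ h]. rewrite <- (@scal_zero_l C_Ring X zero) at 1.
  rewrite (h zero). apply (@scal_zero_l C_Ring X).
Qed.

Lemma lin_opp (T : X -> X) (x : X) : linear_map T -> T (opp x) = opp (T x).
Proof.
  intros h. apply (plus_reg_l (T x)). rewrite xplus_opp_r, <- (proj1 h), xplus_opp_r.
  now apply lin_zero.
Qed.

Lemma op_lin_plus (T : Op) (x y : X) : T (plus x y) = plus (T x) (T y).
Proof. apply (op_lin T). Qed.

Lemma op_lin_scal (T : Op) (z : C) (x : X) : T (scal z x) = scal z (T x).
Proof. apply (op_lin T). Qed.

Lemma op_lin_opp (T : Op) (x : X) : T (opp x) = opp (T x).
Proof. apply lin_opp, op_lin. Qed.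

Lemma op_lin_zero (T : Op) : T zero = zero.
Proof. apply lin_zero, op_lin. Qed.

Lemma bnd_zero : bnd (fun _ : X => zero) 0.
Proof. split; [lra|]. intros x. rewrite xnorm_zero. lra. Qed.

Lemma bnd_plus (S T : X -> X) M N : bnd S M -> bnd T N -> bnd (fun x => plus (S x) (T x)) (M + N).
Proof.
  intros [h1 h2] [k1 k2]. split; [lra|]. intros x.
  eapply Rle_trans; [apply xnorm_plus|].
  generalize (h2 x) (k2 x). lra.
Qed.

Lemma bnd_opp (S : X -> X) M : bnd S M -> bnd (fun x => opp (S x)) M.
Proof.
  intros [h1 h2]. split; [lra|]. intros x. rewrite xnorm_opp. auto.
Qed.

Lemma bnd_comp (S T : X -> X) M N : bnd S M -> bnd T N -> bnd (fun x => S (T x)) (M * N).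
Proof.
  intros [h1 h2] [k1 k2]. split; [nra|]. intros x.
  eapply Rle_trans; [apply h2|]. rewrite Rmult_assoc. apply Rmult_le_compat_l; auto.
Qed.

Lemma bnd_scal (z : C) : bnd (fun x : X => scal z x) (Cmod z).
Proof. split; [apply Cmod_ge_0|]. intros x. rewrite xnorm_scal. lra. Qed.

Lemma bnd_le (S : X -> X) M N : bnd S M -> M <= N -> bnd S N.
Proof.
  intros [h1 h2] h. split; [lra|]. intros x. eapply Rle_trans; [apply h2|].
  apply Rmult_le_compat_r; auto. apply xnorm_ge_0.
Qed.

Definition Ozero : Op.
Proof.
  refine (mkOp (fun _ => zero) _ _ _).
  - split; intros; [now rewrite plus_zero_l|]. symmetry. apply (@scal_zero_r C_Ring X).
  - exists 0. apply bnd_zero.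
  - intros S hS _ _ x. now apply lin_zero.
Defined.

Definition Osc (z : C) : Op.
Proof.
  refine (mkOp (fun x => scal z x) _ _ _).
  - split; intros; [apply xscal_plus|]. rewrite !xscal_mult. f_equal. apply Cmult_comm.
  - exists (Cmod z). apply bnd_scal.
  - intros S hS _ _ x. apply hS.
Defined.

Definition Oone : Op := Osc (RtoC 1).

Definition Oadd (S T : Op) : Op.
Proof.
  refine (mkOp (fun x => plus (S x) (T x)) _ _ _).
  - split; intros.
    + rewrite !op_lin_plus. apply xplus_swap.
    + rewrite !op_lin_scal. symmetry. apply xscal_plus.
  - destruct (op_bdd S) as [M hM], (op_bdd T) as [N hN]. exists (M + N). now apply bnd_plus.
  - intros U h1 h2 h3 x. rewrite (proj1 h1), (op_comm S U), (op_comm T U); auto.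
Defined.

Definition Oopp (S : Op) : Op.
Proof.
  refine (mkOp (fun x => opp (S x)) _ _ _).
  - split; intros.
    + rewrite op_lin_plus. apply xopp_plus.
    + rewrite op_lin_scal. symmetry. apply xscal_opp.
  - destruct (op_bdd S) as [M hM]. exists M. now apply bnd_opp.
  - intros U h1 h2 h3 x. rewrite (lin_opp U), (op_comm S U); auto.
Defined.

Definition Omul (S T : Op) : Op.
Proof.
  refine (mkOp (fun x => S (T x)) _ _ _).
  - split; intros.
    + now rewrite !op_lin_plus.
    + now rewrite !op_lin_scal.
  - destruct (op_bdd S) as [M hM], (op_bdd T) as [N hN]. exists (M * N). now apply bnd_comp.
  - intros U h1 h2 h3 x. rewrite (op_comm S U), (op_comm T U); auto.
Defined.

Definition Osub (S T : Op) : Op := Oadd S (Oopp T).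

Lemma Omul_comm S T : Omul S T = Omul T S.
Proof.
  apply op_eq. intros x. simpl. apply (op_comm T S).
  - apply op_lin.
  - apply op_bdd.
  - intros y. symmetry. apply (op_comm S (rb D)); auto.
    + apply rb_lin.
    + apply rb_bdd.
Qed.

Lemma Op_ring_theory : ring_theory Ozero Oone Oadd Omul Osub Oopp (@eq Op).
Proof.
  constructor; intros; try (apply op_eq; intros t; simpl).
  - apply plus_zero_l.
  - apply plus_comm.
  - apply plus_assoc.
  - apply (@scal_one C_Ring X).
  - exact (f_equal (fun U : Op => U t) (Omul_comm x y)).
  - reflexivity.
  - reflexivity.
  - reflexivity.
  - apply xplus_opp_r.
Qed.

Definition Ob : Op.
Proof.
  refine (mkOp (rb D) (rb_lin _ D) (rb_bdd _ D) _).
  intros S _ _ h. exact h.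
Defined.

(** [Rmax 0 t] makes the resolvent a total function of [t]. *)
Definition Or (t : R) : Op.
Proof.
  refine (mkOp (rs D (Rmax 0 t)) (rs_lin _ D _ (Rmax_l 0 t)) (rs_bdd _ D _ (Rmax_l 0 t)) _).
  intros S hS hS' h x. set (u := Rmax 0 t). assert (hu : 0 <= u) by apply Rmax_l.
  assert (hinj : forall y, plus y (scal (RtoC u) (rb D y)) = zero -> y = zero).
  { intros y hy. apply (rb_inj _ D). rewrite <- (rs_left _ D u y hu), hy.
    apply lin_zero. now apply rs_lin. }
  assert (h0 : minus (S (rs D u x)) (rs D u (S x)) = zero).
  { apply hinj. unfold minus. rewrite (proj1 (rb_lin _ D)), (lin_opp (rb D)) by apply rb_lin.
    rewrite xscal_plus, xscal_opp.
    transitivity (minus (plus (S (rs D u x)) (scal (RtoC u) (rb D (S (rs D u x)))))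
      (plus (rs D u (S x)) (scal (RtoC u) (rb D (rs D u (S x)))))).
    - unfold minus. rewrite xopp_plus. apply xplus_swap.
    - rewrite rs_right by auto. rewrite <- h, <- (proj2 hS), <- (proj1 hS), rs_right by auto.
      rewrite h. apply xplus_opp_r. }
  apply (plus_reg_r (opp (rs D u (S x)))). rewrite xplus_opp_r. exact h0.
Defined.

End OperatorRing.

Arguments fn {X D} _ _.
Arguments mkOp {X D} _ _ _ _.
Arguments Ozero {X D}.
Arguments Oone {X D}.
Arguments Osc {X D} _.
Arguments Oadd {X D} _ _.
Arguments Omul {X D} _ _.
Arguments Osub {X D} _ _.
Arguments Oopp {X D} _.
Arguments Ob {X D}.
Arguments Or {X D} _.

Declare Scope op_scope.
Delimit Scope op_scope with op.
Notation "0" := Ozero : op_scope.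
Notation "1" := Oone : op_scope.
Notation "S + T" := (Oadd S T) : op_scope.
Notation "S - T" := (Osub S T) : op_scope.
Notation "S * T" := (Omul S T) : op_scope.
Notation "- T" := (Oopp T) : op_scope.
Bind Scope op_scope with Op.

Fixpoint Opow {X} {D : resolvents X} (T : Op X D) (n : nat) : Op X D :=
  match n with O => Oone | S m => Omul T (Opow T m) end.
Notation "T ^ n" := (Opow T n) : op_scope.

Section OperatorFacts.

Variable X : CompleteNormedModule C_AbsRing.
Variable D : resolvents X.
Notation Op := (Op X D).
Open Scope op_scope.
Notation r := (@Or X D).
Notation b := (@Ob X D).
Notation sc := (@Osc X D).
Implicit Types S T U : Op.

Add Ring OpRing : (Op_ring_theory X D).

Lemma Osc_plus (z w : C) : sc (Cplus z w) = sc z + sc w :> Op.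
Proof. apply op_eq. intros x. apply (@scal_distr_r C_Ring X). Qed.

Lemma Osc_mult (z w : C) : sc (Cmult z w) = sc z * sc w :> Op.
Proof. apply op_eq. intros x. simpl. symmetry. apply (@scal_assoc C_Ring X). Qed.

Lemma Osc_opp (z : C) : sc (Copp z) = - sc z :> Op.
Proof. apply op_eq. intros x. apply (@scal_opp_l C_Ring X). Qed.

Lemma Osc_minus (z w : C) : sc (Cminus z w) = sc z - sc w :> Op.
Proof. unfold Cminus. rewrite Osc_plus, Osc_opp. ring. Qed.

Lemma Osc_0 : sc (RtoC 0) = 0 :> Op.
Proof. apply op_eq. intros x. apply (@scal_zero_l C_Ring X). Qed.

Lemma Osc_inv_l (z : C) : z <> RtoC 0 -> sc (Cinv z) * sc z = 1 :> Op.
Proof. intros h. rewrite <- Osc_mult, Cinv_l; auto. Qed.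

Lemma Opow_add T n m : T ^ (n + m) = T ^ n * T ^ m.
Proof. induction n; simpl; [ring|]. rewrite IHn. ring. Qed.

Lemma Opow_mul S T n : (S * T) ^ n = S ^ n * T ^ n.
Proof. induction n; simpl; [ring|]. rewrite IHn. ring. Qed.

Lemma Or_spec (t : R) : (0 <= t)%R -> r t + sc (RtoC t) * b * r t = b :> Op.
Proof.
  intros h. apply op_eq. intros x. simpl. rewrite Rmax_right by auto. now apply rs_right.
Qed.

Lemma Or_0 : r 0%R = b :> Op.
Proof.
  transitivity (r 0%R + sc (RtoC 0) * b * r 0%R : Op); [rewrite Osc_0; ring|].
  apply Or_spec. lra.
Qed.

Lemma Ob_cancel T : b * T = 0 -> T = 0.
Proof.
  intros h. apply op_eq. intros x. apply (rb_inj _ D).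
  exact (f_equal (fun U : Op => U x) h).
Qed.

Lemma Osub_eq S T : S - T = 0 -> S = T.
Proof. intros h. replace S with (S - T + T) by ring. rewrite h. ring. Qed.

Lemma Ob_reg S T : b * S = b * T -> S = T.
Proof.
  intros h. apply Osub_eq, Ob_cancel. replace (b * (S - T)) with (b * S - b * T) by ring.
  rewrite h. ring.
Qed.

Lemma Or_alt (t : R) : (0 <= t)%R -> r t = (1 - sc (RtoC t) * r t) * b :> Op.
Proof.
  intros h. apply Osub_eq.
  transitivity (r t + sc (RtoC t) * b * r t - b); [ring|].
  rewrite (Or_spec t h). ring.
Qed.

(** [R_t] is injective on the ring, because [B = (1 + t B) R_t] is. *)
Lemma Or_reg (t : R) S T : (0 <= t)%R -> r t * S = r t * T -> S = T.
Proof.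
  intros ht h. apply Ob_reg.
  transitivity ((1 + sc (RtoC t) * b) * (r t * S)).
  - transitivity ((r t + sc (RtoC t) * b * r t) * S); [now rewrite Or_spec|ring].
  - rewrite h. transitivity ((r t + sc (RtoC t) * b * r t) * T); [ring|now rewrite Or_spec].
Qed.

Lemma Or_pow_reg (t : R) n S T : (0 <= t)%R -> r t ^ n * S = r t ^ n * T -> S = T.
Proof.
  intros ht. induction n; simpl; intros h.
  - replace S with (1 * S) by ring. rewrite h. ring.
  - apply IHn. apply (Or_reg t); auto.
    replace (r t * (r t ^ n * S)) with (r t * r t ^ n * S) by ring. rewrite h. ring.
Qed.

Lemma Or_resolvent (t u : R) : (0 <= t)%R -> (0 <= u)%R ->
  r t - r u = sc (RtoC (u - t)) * r t * r u :> Op.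
Proof.
  intros ht hu. apply Ob_reg.
  rewrite RtoC_minus, Osc_minus.
  transitivity (r t * (r u + sc (RtoC u) * b * r u) -
    r u * (r t + sc (RtoC t) * b * r t)); [|ring].
  rewrite !Or_spec by auto. ring.
Qed.

(** ** Operator bounds *)

Lemma obnd_add S T M N : bnd S M -> bnd T N -> bnd (S + T) (M + N)%R.
Proof. apply bnd_plus. Qed.

Lemma obnd_opp S M : bnd S M -> bnd (- S) M.
Proof. apply bnd_opp. Qed.

Lemma obnd_sub S T M N : bnd S M -> bnd T N -> bnd (S - T) (M + N)%R.
Proof. intros h k. apply obnd_add; auto. now apply obnd_opp. Qed.

Lemma obnd_mul S T M N : bnd S M -> bnd T N -> bnd (S * T) (M * N)%R.
Proof. apply bnd_comp. Qed.

Lemma obnd_sc (z : C) : bnd (sc z : Op) (Cmod z).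
Proof. apply bnd_scal. Qed.

Lemma obnd_scr (r : R) : (0 <= r)%R -> bnd (sc (RtoC r) : Op) r.
Proof. intros h. apply bnd_le with (Cmod (RtoC r)); [apply bnd_scal|]. rewrite Cmod_R, Rabs_pos_eq; lra. Qed.

Lemma obnd_1 : bnd (1 : Op) 1%R.
Proof. apply obnd_scr. lra. Qed.

Lemma obnd_pow T M n : bnd T M -> bnd (T ^ n) (M ^ n)%R.
Proof. intros h. induction n; simpl; [apply obnd_1|]. now apply obnd_mul. Qed.

Lemma obnd_0_eq T : (forall e : R, (0 < e)%R -> bnd T e) -> T = 0.
Proof.
  intros h. apply op_eq. intros x. simpl. apply xnorm_eq_0.
  apply Rle_antisym; [|apply xnorm_ge_0].
  apply le_epsilon. intros e he. rewrite Rplus_0_l.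
  assert (hx := xnorm_ge_0 X x).
  assert (h1 : (0 < e / (norm x + 1))%R) by (apply Rdiv_lt_0_compat; lra).
  eapply Rle_trans; [apply (h _ h1)|].
  apply (Rmult_le_reg_r (norm x + 1)); [lra|].
  replace (e / (norm x + 1) * norm x * (norm x + 1))%R with (e * norm x)%R by (field; lra). nra.
Qed.

(** Since [0] is in the resolvent set, the resolvent decays like [1 / (1 + t)];
    this makes the Balakrishnan integrals converge at [t = 0] too. *)
Lemma Or_bound : exists M : R, (1 <= M)%R /\
  (forall t, (0 <= t)%R -> bnd (r t : Op) (M / (1 + t))%R) /\
  (forall t, (0 < t)%R -> bnd (r t : Op) (M / t)%R).
Proof.
  destruct (rs_sec _ D) as [M0 hM0]. destruct (op_bdd _ _ b) as [N [hN hN']].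
  set (M1 := Rmax M0 0). assert (h0 : (0 <= M1)%R) by apply Rmax_r.
  assert (h1 : (M0 <= M1)%R) by apply Rmax_l.
  assert (ht : forall t, (0 < t)%R -> bnd (r t : Op) (M1 / t)%R).
  { intros t ht. split; [apply Rdiv_le_0_compat; lra|]. intros x.
    assert (h := hM0 t x ht). rewrite xnorm_scal, Cmod_R, Rabs_pos_eq in h by lra.
    simpl. rewrite Rmax_right by lra. apply (Rmult_le_reg_l t); auto.
    eapply Rle_trans; [exact h|]. replace (t * (M1 / t * norm x))%R with (M1 * norm x)%R by (field; lra).
    apply Rmult_le_compat_r; auto. apply xnorm_ge_0. }
  assert (hs : forall t, (0 <= t)%R -> bnd (r t : Op) ((1 + M1) * N)%R).
  { intros t h. replace (r t : Op) with ((1 - sc (RtoC t) * r t) * b).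
    - apply obnd_mul; [|split; auto]. apply obnd_sub; [apply obnd_1|].
      destruct (Req_dec t 0) as [h2|h2].
      + subst t. rewrite Osc_0. replace (0 * r 0%R : Op) with (0 : Op) by ring.
        eapply bnd_le; [apply bnd_zero|auto].
      + apply bnd_le with (t * (M1 / t))%R; [|right; field; auto].
        apply obnd_mul; [now apply obnd_scr|]. apply ht. lra.
    - symmetry. now apply Or_alt. }
  assert (hM : (0 <= (1 + M1) * N)%R) by (apply Rmult_le_pos; lra).
  (* the bound for [t <= 1] and the bound for [1 < t], each weakened by [2] *)
  exists (1 + 2 * ((1 + M1) * N + M1))%R. split; [lra|]. split; intros t h.
  - destruct (Rle_dec t 1) as [h2|h2].
    + apply bnd_le with (1 := hs t h). apply (Rmult_le_reg_r (1 + t)); [lra|].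
      replace ((1 + 2 * ((1 + M1) * N + M1)) / (1 + t) * (1 + t))%R with
       (1 + 2 * ((1 + M1) * N + M1))%R by (field; lra). nra.
    + apply bnd_le with (1 := ht t ltac:(lra)).
      apply (Rmult_le_reg_r (t * (1 + t))); [nra|].
      replace (M1 / t * (t * (1 + t)))%R with (M1 * (1 + t))%R by (field; lra).
      replace ((1 + 2 * ((1 + M1) * N + M1)) / (1 + t) * (t * (1 + t)))%R with
       ((1 + 2 * ((1 + M1) * N + M1)) * t)%R by (field; lra). nra.
  - apply bnd_le with (1 := ht t h).
    unfold Rdiv. apply Rmult_le_compat_r; [apply Rlt_le, Rinv_0_lt_compat; auto|lra].
Qed.

End OperatorFacts.

(** * Operator-valued integrals *)

Section OperatorIntegrals.

Variable X : CompleteNormedModule C_AbsRing.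
Variable D : resolvents X.
Notation XR := (real_CompleteNormedModule X).
Notation Op := (Op X D).
Notation r := (@Or X D).
Notation b := (@Ob X D).
Notation sc := (@Osc X D).
Implicit Types S T U : Op.

Add Ring OpRing4 : (Op_ring_theory X D).

Definition pcont (F : R -> Op) (u : R) : Prop :=
  forall x, continuous (fun v => F v x : XR) u.

Definition ocont (F : R -> Op) (u : R) : Prop :=
  forall e, 0 < e -> exists d, 0 < d /\
    forall v, Rabs (v - u) < d -> bnd (F v - F u)%op e.

(** The integral in the strong sense, with a value in the ring. *)
Definition oint (F : R -> Op) (K : Op) : Prop :=
  forall x, int0oo (fun z => F z x : XR) (K x : XR).

Lemma xball (x y : X) (e : posreal) : norm (minus y x) < e -> @ball XR x e y.
Proof. apply (@norm_compat1 C_AbsRing X). Qed.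

Lemma ocont_pcont F u : ocont F u -> pcont F u.
Proof.
  intros h x. apply filterlim_locally. intros eps.
  assert (hx := xnorm_ge_0 X x).
  destruct (h (eps / (norm x + 1))) as [d [hd hF]].
  { apply Rdiv_lt_0_compat; [apply cond_pos|lra]. }
  exists (mkposreal d hd). intros v hv. apply xball.
  assert (h1 := hF v hv). destruct h1 as [_ h1].
  eapply Rle_lt_trans; [apply (h1 x)|].
  apply (Rmult_lt_reg_r (norm x + 1)); [lra|].
  replace (eps / (norm x + 1) * norm x * (norm x + 1)) with (eps * norm x) by (field; lra).
  generalize (cond_pos eps). nra.
Qed.

Lemma ocont_mul F G u : ocont F u -> ocont G u -> ocont (fun v => F v * G v)%op u.
Proof.
  intros hF hG e he.
  destruct (op_bdd _ _ (F u)) as [MF bF]. destruct (op_bdd _ _ (G u)) as [MG bG].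
  assert (0 <= MF) by apply bF. assert (0 <= MG) by apply bG.
  set (w := Rmin 1 (e / (MF + MG + 1))).
  assert (hw0 : 0 < w).
  { apply Rmin_glb_lt; [lra|]. apply Rdiv_lt_0_compat; lra. }
  assert (hw1 : w <= 1) by apply Rmin_l.
  assert (hw2 : w * (MF + MG + 1) <= e).
  { apply Rle_trans with (e / (MF + MG + 1) * (MF + MG + 1)).
    - apply Rmult_le_compat_r; [lra|apply Rmin_r].
    - right; field; lra. }
  destruct (hF w hw0) as [d1 [hd1 k1]]. destruct (hG w hw0) as [d2 [hd2 k2]].
  exists (Rmin d1 d2). split; [now apply Rmin_glb_lt|]. intros v hv.
  assert (h1 := k1 v (Rlt_le_trans _ _ _ hv (Rmin_l _ _))).
  assert (h2 := k2 v (Rlt_le_trans _ _ _ hv (Rmin_r _ _))).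
  replace (F v * G v - F u * G u)%op with
    ((F v - F u) * (G v - G u) + (F v - F u) * G u + F u * (G v - G u))%op by ring.
  eapply bnd_le; [apply obnd_add; [apply obnd_add|]; apply obnd_mul; eassumption|]. nra.
Qed.

Lemma ocont_pow F u n : ocont F u -> ocont (fun v => F v ^ n)%op u.
Proof.
  intros hF. induction n; simpl.
  - intros e he. exists 1. split; [lra|]. intros v _.
    replace (1 - 1)%op with (0 : Op)%op by ring. eapply bnd_le; [apply bnd_zero|lra].
  - now apply ocont_mul.
Qed.

Lemma ocont_const T u : ocont (fun _ => T) u.
Proof.
  intros e he. exists 1. split; [lra|]. intros v _.
  replace (T - T)%op with (0 : Op)%op by ring. eapply bnd_le; [apply bnd_zero|lra].
Qed.

Lemma Or_lipschitz : exists L, 0 <= L /\ forall u v, 0 <= u -> 0 <= v ->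
  bnd (r v - r u)%op (L * Rabs (v - u)).
Proof.
  destruct (Or_bound X D) as [M [hM [h1 _]]]. exists (M * M). split; [nra|].
  intros u v hu hv. rewrite Or_resolvent by auto.
  assert (hb : forall t, 0 <= t -> bnd (r t) M).
  { intros t ht. apply bnd_le with (1 := h1 t ht). apply Rle_div_l; nra. }
  eapply bnd_le; [apply obnd_mul; [apply obnd_mul; [apply obnd_sc|]|]; apply hb; auto|].
  rewrite Cmod_R, Rabs_minus_sym. right; ring.
Qed.

Lemma ocont_Or t u : 0 <= t -> 0 < u -> ocont (fun v => r (t + v)) u.
Proof.
  intros ht hu e he. destruct Or_lipschitz as [L [hL h]].
  exists (Rmin u (e / (L + 1))). split.
  - apply Rmin_glb_lt; auto. apply Rdiv_lt_0_compat; lra.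
  - intros v hv. assert (h1 := Rlt_le_trans _ _ _ hv (Rmin_l _ _)).
    assert (h2 := Rlt_le_trans _ _ _ hv (Rmin_r _ _)).
    apply Rabs_def2 in h1. eapply bnd_le; [apply h; lra|].
    replace (t + v - (t + u)) with (v - u) by ring.
    apply Rle_trans with ((L + 1) * (e / (L + 1))); [|right; field; lra].
    assert (0 <= Rabs (v - u)) by apply Rabs_pos. nra.
Qed.

Lemma pcont_scal (g : R -> C) F u :
  continuous (fun t => Re (g t)) u -> continuous (fun t => Im (g t)) u ->
  pcont F u -> pcont (fun v => sc (g v) * F v)%op u.
Proof.
  intros h1 h2 hF x. apply (continuous_cscal X g (fun v => F v x)); auto.
Qed.

Lemma oint_unique F K K' : oint F K -> oint F K' -> K = K'.
Proof.
  intros h h'. apply op_eq. intros x. apply (int0oo_unique XR _ _ _ (h x) (h' x)).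
Qed.

Lemma oint_ext F G K : (forall z, 0 < z -> F z = G z) -> oint F K -> oint G K.
Proof.
  intros h hF x. apply (int0oo_ext XR (fun z => F z x)); auto.
  intros z hz. now rewrite h.
Qed.

Lemma oint_add F G K L : oint F K -> oint G L -> oint (fun z => F z + G z)%op (K + L)%op.
Proof.
  intros hF hG x. apply (is_RInt_gen_plus (V := XR) (fun z => F z x) (fun z => G z x)); auto.
Qed.

Lemma bounded_linear (T : X -> X) : linear_map T -> (exists M, bnd T M) ->
  is_linear (U := XR) (V := XR) T.
Proof.
  intros hT [M [h0 hM]]. apply Build_is_linear.
  - apply hT.
  - intros k x. apply hT.
  - exists (M + 1). split; [lra|]. intros x. eapply Rle_trans; [apply hM|].
    apply Rmult_le_compat_r; [apply (xnorm_ge_0 X)|lra].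
Qed.

Lemma oint_mul T F K : oint F K -> oint (fun z => T * F z)%op (T * K)%op.
Proof.
  intros hF x.
  apply (is_RInt_gen_linear XR XR T (fun z => F z x)); try apply _; auto.
  apply bounded_linear; [apply op_lin|apply op_bdd].
Qed.

Lemma oint_sub F G K L : oint F K -> oint G L -> oint (fun z => F z - G z)%op (K - L)%op.
Proof.
  intros hF hG. apply (oint_add _ _ _ _ hF).
  replace (- L)%op with (- (1) * L)%op by ring.
  apply oint_ext with (fun z => - (1) * G z)%op; [intros; ring|]. now apply oint_mul.
Qed.

(** The pointwise integrals depend linearly on the vector, with a uniform bound,
    and commute with the commutant of [A^(-1)] because bounded operators pass
    through the integral; so they form an element of the ring. *)
Lemma oint_power F C t x m :
  0 < t -> 0 < x < m -> 0 <= C ->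
  (forall z, 0 < z -> pcont F z) ->
  (forall z, 0 < z -> bnd (F z) (C * (Rpower z (x - 1) * Rpower (t + z) (- m)))) ->
  exists K, oint F K /\ bnd K (C * (Kpow x m * Rpower t (x - m))).
Proof.
  intros ht hx hC hF hb.
  assert (hex : forall y : X, exists v : X, int0oo (fun z => F z y : XR) (v : XR) /\
    norm v <= C * (Kpow x m * Rpower t (x - m)) * norm y).
  { intros y.
    destruct (int0oo_power XR (fun z => F z y : XR) (C * norm y) t x m) as [v [h1 h2]]; auto.
    - apply Rmult_le_pos; auto. apply xnorm_ge_0.
    - intros z hz. now apply hF.
    - intros z hz. eapply Rle_trans; [apply (hb z hz)|]. right; ring.
    - exists v. split; auto. eapply Rle_trans; [exact h2|]. right; ring. }
  set (K := fun y => proj1_sig (constructive_indefinite_description _ (hex y))).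
  assert (hK : forall y : X, int0oo (fun z => F z y : XR) (K y : XR) /\
    norm (K y) <= C * (Kpow x m * Rpower t (x - m)) * norm y).
  { intros y. apply (proj2_sig (constructive_indefinite_description _ (hex y))). }
  clearbody K.
  assert (hpos : 0 <= C * (Kpow x m * Rpower t (x - m))).
  { apply Rmult_le_pos; auto. apply Rmult_le_pos; apply Rlt_le; [now apply Kpow_pos|apply Rpower_pos]. }
  assert (hlin : linear_map K).
  { split.
    - intros y y'. apply (int0oo_unique XR (fun z => F z (plus y y'))); [apply hK|].
      apply (int0oo_ext XR (fun z => plus (F z y : XR) (F z y' : XR))).
      { intros z _. symmetry. apply op_lin_plus. }
      apply (is_RInt_gen_plus (V := XR)); apply hK.
    - intros z y. apply (int0oo_unique XR (fun u => F u (scal z y))); [apply hK|].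
      apply (int0oo_ext XR (fun u => scal z (F u y))).
      { intros u _. symmetry. apply op_lin_scal. }
      apply (is_RInt_gen_linear XR XR (fun v => scal z (v : X) : XR) (fun u => F u y)); try apply _.
      + apply xscal_real_linear.
      + apply hK. }
  assert (hbd : bnd K (C * (Kpow x m * Rpower t (x - m)))).
  { split; auto. apply hK. }
  assert (hcm : forall S : X -> X, linear_map S -> (exists M, bnd S M) ->
    (forall x, S (rb D x) = rb D (S x)) -> forall x, S (K x) = K (S x)).
  { intros S h1 h2 h3 y. apply (int0oo_unique XR (fun u => F u (S y))); [|apply hK].
    apply (int0oo_ext XR (fun u => S (F u y))).
    { intros u _. now apply op_comm. }
    apply (is_RInt_gen_linear XR XR S (fun u => F u y)); try apply _.
    - now apply bounded_linear.
    - apply hK. }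
  exists (mkOp K hlin (ex_intro _ _ hbd) hcm). split; auto.
  intros y. apply hK.
Qed.

Lemma oint_bound F K C t x m :
  oint F K -> 0 < t -> 0 < x < m -> 0 <= C ->
  (forall z, 0 < z -> pcont F z) ->
  (forall z, 0 < z -> bnd (F z) (C * (Rpower z (x - 1) * Rpower (t + z) (- m)))) ->
  bnd K (C * (Kpow x m * Rpower t (x - m))).
Proof.
  intros hK ht hx hC hF hb. destruct (oint_power F C t x m) as [K' [h1 h2]]; auto.
  now rewrite (oint_unique F K K').
Qed.

(** ** The Balakrishnan integral of [(t + A)^(-a)] *)

Definition kexp (n : nat) (a : C) : C := Cminus (Cminus (RtoC (INR n)) a) (RtoC 1).

Definition kern (n : nat) (a : C) (t z : R) : Op := (sc (rcpow z (kexp n a)) * r (t + z) ^ n)%op.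

Lemma kern_eq n a t z : kern n a t z = (sc (rcpow z (kexp n a)) * r (t + z) ^ n)%op.
Proof. reflexivity. Qed.

(** The choice is meaningful for [0 < Re a < n] ([Kfam_spec]). The value is
    [kconst n a] times [(t + A)^(-a)] ([Kfam_J]). *)
Definition Kfam (n : nat) (a : C) (t : R) : Op := epsilon (inhabits Ozero) (oint (kern n a t)).

Lemma Re_kexp n a : Re (kexp n a) = INR n - Re a - 1.
Proof. unfold kexp, Cminus, Cplus, Copp, RtoC, Re; simpl. ring. Qed.

Lemma pow_div_Rpower (M u : R) n : 0 < u -> (M / u) ^ n = M ^ n * Rpower u (- INR n).
Proof.
  intros h. rewrite Rpower_Ropp, Rpower_pow by auto. unfold Rdiv.
  rewrite Rpow_mult_distr. f_equal. rewrite pow_inv; auto.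
Qed.

Lemma pcont_kern n a t z : 0 <= t -> 0 < z -> pcont (kern n a t) z.
Proof.
  intros ht hz. apply pcont_scal.
  - now apply continuous_rcpow_re.
  - now apply continuous_rcpow_im.
  - apply ocont_pcont, ocont_pow, ocont_Or; auto.
Qed.

(** The first bound makes the integral over [z] converge uniformly down to
    [t = 0]; the second gives its decay in [t]. *)
Lemma Or_pow_bound : exists M, 1 <= M /\ forall n t z, 0 <= t -> 0 < z ->
  bnd (r (t + z) ^ n)%op (M ^ n * Rpower (1 + z) (- INR n)) /\
  bnd (r (t + z) ^ n)%op (M ^ n * Rpower (t + z) (- INR n)).
Proof.
  destruct (Or_bound X D) as [M [hM [h1 h2]]]. exists M. split; auto.
  intros n t z ht hz. split; rewrite <- pow_div_Rpower by lra; apply obnd_pow.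
  - apply bnd_le with (1 := h1 (t + z) ltac:(lra)). apply Rmult_le_compat_l; [lra|].
    apply Rinv_le_contravar; lra.
  - apply h2. lra.
Qed.

Lemma obnd_rcpow z a T M : bnd T M -> bnd (sc (rcpow z a) * T)%op (Rpower z (Re a) * M).
Proof.
  intros h. apply obnd_mul; auto. apply bnd_le with (1 := obnd_sc X D _).
  rewrite Cmod_rcpow. lra.
Qed.

Lemma Kfam_spec n a : 0 < Re a < INR n -> exists C, 0 <= C /\
  forall t, 0 <= t -> oint (kern n a t) (Kfam n a t) /\ bnd (Kfam n a t) C /\
    (0 < t -> bnd (Kfam n a t) (C * Rpower t (- Re a))).
Proof.
  intros ha. destruct Or_pow_bound as [M [hM hb]].
  assert (hMn : 0 <= M ^ n) by (apply pow_le; lra).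
  assert (hx : 0 < INR n - Re a < INR n) by lra.
  exists (M ^ n * Kpow (INR n - Re a) (INR n)).
  assert (hC : 0 <= M ^ n * Kpow (INR n - Re a) (INR n)).
  { apply Rmult_le_pos; auto. apply Rlt_le, Kpow_pos; auto. }
  split; auto. intros t ht.
  destruct (oint_power (kern n a t) (M ^ n) 1 (INR n - Re a) (INR n)) as [K [h1 h2]]; auto; try lra.
  { intros z hz. now apply pcont_kern. }
  { intros z hz. eapply bnd_le; [apply obnd_rcpow, (proj1 (hb n t z ht hz))|]. rewrite Re_kexp.
    right; ring. }
  assert (hs : oint (kern n a t) (Kfam n a t)).
  { unfold Kfam. apply epsilon_spec. now exists K. }
  split; auto. rewrite (oint_unique _ _ _ hs h1). split.
  - apply bnd_le with (1 := h2). unfold Rpower. rewrite ln_1, Rmult_0_r, exp_0. right; ring.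
  - intros ht'. apply bnd_le with (M ^ n * (Kpow (INR n - Re a) (INR n) * Rpower t (INR n - Re a - INR n))).
    + apply (oint_bound (kern n a t) K); auto.
      * intros z hz. now apply pcont_kern.
      * intros z hz. eapply bnd_le; [apply obnd_rcpow, (proj2 (hb n t z ht hz))|]. rewrite Re_kexp. right; ring.
    + replace (INR n - Re a - INR n) with (- Re a) by ring. right; ring.
Qed.

End OperatorIntegrals.

Lemma linear_scal_vector (X : CompleteNormedModule C_AbsRing) (x : X) :
  is_linear (U := CR) (V := real_CompleteNormedModule X)
    (fun z : CR => scal (z : C) x : real_CompleteNormedModule X).
Proof.
  apply Build_is_linear.
  - intros y z. apply (@scal_distr_r C_Ring X).
  - intros k z. change (scal (@scal R_Ring CR k z : C) x = scal (RtoC k) (scal (z : C) x)).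
    rewrite xscal_mult. f_equal. destruct z as [p q].
    unfold scal, mult; simpl. unfold prod_scal, Cmult, RtoC; simpl.
    unfold scal, mult; simpl. unfold mult; simpl. f_equal; ring.
  - exists (norm x + 1). assert (h := xnorm_ge_0 X x). split; [lra|]. intros z.
    rewrite CR_norm. change (norm (scal (z : C) x) <= (norm x + 1) * Cmod z).
    rewrite xnorm_scal. generalize (Cmod_ge_0 z). nra.
Qed.

(** The Beta value [B(n - a, a)], the integral of [z^(n-a-1) (1+z)^(-n)]: the
    value of the Balakrishnan integral for the operator [0] in place of [A], at
    [t = 1]. *)
Definition kconst (n : nat) (a : C) : C := beta n (Cminus (RtoC (INR n)) a).

Lemma kconst_neq_0 n a : 0 < Re a < INR n -> kconst n a <> RtoC 0.
Proof.
  intros ha. apply beta_neq_0.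
  change (Re (Cminus (RtoC (INR n)) a)) with (INR n - Re a). lra.
Qed.

(** * The Balakrishnan integral for large shifts *)

Section PowerFamilies.

Variable X : CompleteNormedModule C_AbsRing.
Variable D : resolvents X.
Notation XR := (real_CompleteNormedModule X).
Notation Op := (Op X D).
Notation r := (@Or X D).
Notation b := (@Ob X D).
Notation sc := (@Osc X D).
Notation oint := (@oint X D).
Notation Kfam := (Kfam X D).
Notation kern := (kern X D).
Implicit Types S T U : Op.

Add Ring OpRing5 : (Op_ring_theory X D).

Lemma kconst_scaled n a t : 0 < Re a < INR n -> 0 < t ->
  oint (fun z => sc (Cmult (rcpow z (kexp n a)) (RtoC (Rpower (t + z) (- INR n)))))
    (sc (Cmult (rcpow t (Copp a)) (kconst n a))).
Proof.
  intros ha ht x.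
  assert (h := beta_spec n (Cminus (RtoC (INR n)) a)
    ltac:(change (Re (Cminus (RtoC (INR n)) a)) with (INR n - Re a); lra)).
  fold (kconst n a) in h.
  assert (hti : 0 < / t) by (apply Rinv_0_lt_compat; auto).
  apply (int0oo_scale CR _ _ (/ t) hti) in h; [|intros; apply continuous_mker, continuous_beta_weight; auto].
  apply (is_RInt_gen_linear CR XR (fun z : CR => scal (Cmult (rcpow t (Copp a)) (z : C)) x : XR)) in h; try apply _.
  - revert h. apply (int0oo_ext XR). intros z hz. simpl. f_equal.
    set (w := mker (beta_weight n) (Cminus (RtoC (INR n)) a) (/ t * z)).
    assert (e1 : @scal R_Ring CR (/ t) w = Cmult (RtoC (/ t)) w).
    { destruct w as [p q]. unfold scal, mult; simpl.
      unfold prod_scal, Cmult, RtoC; simpl. unfold scal; simpl. unfold mult; simpl. f_equal; ring. }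
    rewrite e1. unfold w, mker, beta_weight. fold (kexp n a). rewrite rcpow_mult, rcpow_inv by auto.
    replace (1 + / t * z) with ((t + z) * / t) by (field; lra).
    rewrite <- Rpower_mult_distr by lra.
    replace (Rpower (/ t) (- INR n)) with (Rpower t (INR n)).
    2:{ unfold Rpower. rewrite ln_Rinv by auto. f_equal. ring. }
    rewrite RtoC_mult, <- (rcpow_real t (INR n)).
    replace (RtoC (/ t)) with (rcpow t (Copp (RtoC 1))).
    2:{ rewrite <- rcpow_inv, rcpow_real, Rpower_1; auto. }
    transitivity (Cmult (rcpow t (Cplus (Cplus (Copp a) (Copp (RtoC 1))) (Cplus (Copp (kexp n a)) (RtoC (INR n)))))
      (Cmult (rcpow z (kexp n a)) (RtoC (Rpower (t + z) (- INR n))))).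
    + rewrite !rcpow_plus. ring.
    + replace (Cplus (Cplus (Copp a) (Copp (RtoC 1))) (Cplus (Copp (kexp n a)) (RtoC (INR n)))) with (RtoC 0).
      * rewrite rcpow_real, Rpower_O by auto. ring.
      * unfold kexp. ring.
  - apply (is_linear_ext (K := R_AbsRing) (U := CR) (V := XR)
      (fun z : CR => scal (rcpow t (Copp a)) (scal (z : C) x) : XR)).
    + intros z. apply xscal_mult.
    + apply (is_linear_comp (K := R_AbsRing) (U := CR) (V := XR) (W := XR)
        (fun z : CR => scal (z : C) x : XR) (fun v => scal (rcpow t (Copp a)) (v : X) : XR)).
      * apply linear_scal_vector.
      * apply xscal_real_linear.
Qed.

(** On the range of [A^(-1)] the resolvent [R_s] is [1/s] up to [O(1/s^2)], as
    [R_s B = (B - R_s) / s]. *)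
Lemma Or_pow_scalar_bound : exists M, 1 <= M /\ forall n s, 0 < s ->
  bnd ((r s ^ n - sc (RtoC (Rpower s (- INR n)))) * b)%op
    (INR n * M ^ n * Rpower s (- (INR n + 1))).
Proof.
  destruct (Or_bound X D) as [M [hM [_ h2]]]. exists M. split; auto.
  intros n s hs. assert (hr := h2 s hs).
  induction n as [|n IH].
  - change (INR 0) with 0. rewrite Ropp_0, Rpower_O by auto.
    change (sc (RtoC 1)) with (1 : Op)%op. change (r s ^ 0)%op with (1 : Op)%op.
    replace ((1 - 1) * b)%op with (0 : Op)%op by ring.
    eapply bnd_le; [apply bnd_zero|]. rewrite Rmult_0_l, Rmult_0_l. lra.
  - set (p := Rpower s (- INR n)) in *.
    assert (hp0 : 0 < p) by apply Rpower_pos.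
    assert (hp : forall k, Rpower s (- (INR n + k)) = p * Rpower s (- k)).
    { intros k. unfold p. rewrite <- Rpower_plus. f_equal. ring. }
    assert (hm1 : Rpower s (Ropp 1) = / s) by (rewrite Rpower_Ropp, Rpower_1; auto).
    assert (hm2 : Rpower s (Ropp 2) = / s * / s).
    { replace (Ropp 2) with (Ropp 1 + Ropp 1) by ring. now rewrite Rpower_plus, hm1. }
    rewrite hp, hm1 in IH. rewrite S_INR.
    replace (- (INR n + 1 + 1)) with (- (INR n + 2)) by ring. rewrite !hp, hm1, hm2.
    replace ((r s ^ S n - sc (RtoC (p * / s))) * b)%op with
      (r s * ((r s ^ n - sc (RtoC p)) * b) - sc (RtoC (p * / s)) * r s)%op.
    + eapply bnd_le.
      * apply obnd_sub; apply obnd_mul; [exact hr|exact IH|apply obnd_scr|exact hr].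
        apply Rmult_le_pos; [lra|]. apply Rlt_le, Rinv_0_lt_compat; auto.
      * assert (hs2 : 0 < / s) by (apply Rinv_0_lt_compat; auto).
        assert (hMn : 1 <= M ^ n) by (apply pow_R1_Rle; auto).
        unfold Rdiv. simpl.
        replace (M * / s * (INR n * M ^ n * (p * / s)) + p * / s * (M * / s)) with
         ((INR n * M ^ n + 1) * (M * (p * (/ s * / s)))) by ring.
        replace ((INR n + 1) * (M * M ^ n) * (p * (/ s * / s))) with
         ((INR n * M ^ n + M ^ n) * (M * (p * (/ s * / s)))) by ring.
        apply Rmult_le_compat_r; [|lra]. repeat (apply Rmult_le_pos; try lra).
    + assert (h3 : sc (RtoC p) = (sc (RtoC (p * / s)) * sc (RtoC s))%op).
      { rewrite <- Osc_mult, <- RtoC_mult. do 2 f_equal. field. lra. }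
      simpl. apply Osub_eq. rewrite h3.
      transitivity (sc (RtoC (p * / s)) * (b - (r s + sc (RtoC s) * b * r s)))%op; [ring|].
      rewrite Or_spec by lra. ring.
Qed.

(** For large [t] the operator [A] is negligible against [t] on the range of
    [A^(-1)], and the Balakrishnan integral becomes the scalar one. This
    initial condition at infinity fixes the constant factor of [J]. *)
Lemma Kfam_limit n a : 0 < Re a < INR n -> exists C, 0 <= C /\ forall t, 1 <= t ->
  bnd (sc (rcpow t a) * Kfam n a t * b - sc (kconst n a) * b)%op (C / t).
Proof.
  intros ha. destruct Or_pow_scalar_bound as [M [hM hb]].
  destruct (Kfam_spec X D n a ha) as [C1 [_ hK]].
  set (C0 := INR n * M ^ n). assert (hC0 : 0 <= C0).
  { apply Rmult_le_pos; [apply pos_INR|]. apply pow_le; lra. }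
  exists (C0 * Kpow (INR n - Re a) (INR n + 1)). split.
  { apply Rmult_le_pos; auto. apply Rlt_le, Kpow_pos; lra. }
  intros t ht. destruct (hK t ltac:(lra)) as [h1 _].
  assert (h2 := kconst_scaled n a t ha ltac:(lra)).
  assert (h3 := oint_mul X D b _ _ (oint_sub X D _ _ _ _ h1 h2)).
  assert (h4 : bnd (b * (Kfam n a t - sc (Cmult (rcpow t (Copp a)) (kconst n a))))%op
     (C0 * (Kpow (INR n - Re a) (INR n + 1) * Rpower t (INR n - Re a - (INR n + 1))))).
  { apply (oint_bound X D _ _ _ _ _ _ h3); auto; try lra.
    - intros z hz x.
      apply (continuous_ext (fun v => (sc (rcpow v (kexp n a)) *
         ((r (t + v) ^ n - sc (RtoC (Rpower (t + v) (- INR n)))) * b))%op x : XR)).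
      { intros v. rewrite !kern_eq. rewrite Osc_mult.
        apply (f_equal (fun U : Op => U x)). ring. }
      apply pcont_scal; [now apply continuous_rcpow_re|now apply continuous_rcpow_im|].
      intros y.
      apply (continuous_ext (fun v => minus ((r (t + v) ^ n)%op (b y) : XR)
         (scal (RtoC (Rpower (t + v) (- INR n))) (b y) : XR))); [reflexivity|].
      apply (continuous_minus (K := R_AbsRing) (V := XR)).
      + apply (ocont_pcont X D (fun v => r (t + v) ^ n)%op), ocont_pow, ocont_Or; lra.
      + apply (continuous_scal_l (K := R_AbsRing) (V := XR)).
        apply (continuous_comp (fun v => t + v) (fun v => Rpower v (- INR n))).
        * apply (continuous_plus (K := R_AbsRing) (V := R_NormedModule) (fun _ => t));
           [apply continuous_const|apply continuous_id].
        * apply continuous_Rpower. lra.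
    - intros z hz.
      replace (b * (kern n a t z - sc (Cmult (rcpow z (kexp n a)) (RtoC (Rpower (t + z) (- INR n))))))%op
       with (sc (rcpow z (kexp n a)) * ((r (t + z) ^ n - sc (RtoC (Rpower (t + z) (- INR n)))) * b))%op.
      + eapply bnd_le; [apply obnd_rcpow, hb; lra|]. rewrite Re_kexp. unfold C0. right; ring.
      + rewrite !kern_eq. rewrite Osc_mult. ring. }
  replace (sc (rcpow t a) * Kfam n a t * b - sc (kconst n a) * b)%op with
   (sc (rcpow t a) * (b * (Kfam n a t - sc (Cmult (rcpow t (Copp a)) (kconst n a)))))%op.
  - eapply bnd_le; [apply obnd_rcpow, h4|].
    replace (INR n - Re a - (INR n + 1)) with (- Re a + Ropp 1) by ring.
    rewrite Rpower_plus, !Rpower_Ropp, (Rpower_1 t) by lra. right. field.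
    split; [lra|apply Rgt_not_eq, Rpower_pos].
  - rewrite Osc_mult.
    transitivity (sc (rcpow t a) * Kfam n a t * b - (sc (rcpow t a) * sc (rcpow t (Copp a))) * sc (kconst n a) * b)%op; [ring|].
    rewrite <- Osc_mult, <- rcpow_plus. replace (Cplus a (Copp a)) with (RtoC 0) by ring.
    rewrite rcpow_real, Rpower_O by lra. fold (@Oone X D). ring.
Qed.

End PowerFamilies.

(** * The differential equation of the Balakrishnan integral *)

Section Semigroup.

Variable X : CompleteNormedModule C_AbsRing.
Variable D : resolvents X.
Notation XR := (real_CompleteNormedModule X).
Notation Op := (Op X D).
Notation r := (@Or X D).
Notation b := (@Ob X D).
Notation sc := (@Osc X D).
Notation oint := (@oint X D).
Notation Kfam := (Kfam X D).
Notation kern := (kern X D).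
Implicit Types S T U : Op.

Add Ring OpRing6 : (Op_ring_theory X D).

(** The hypothesis is the resolvent identity [q - p = d p q], with [q = R_u],
    [p = R_v] and [d = v - u]; it is the only property of resolvents that
    differentiation needs. *)
Lemma Or_pow_taylor (p q : Op) (d w : R) n :
  (q - p = sc (RtoC d) * p * q)%op -> bnd p w -> bnd q w ->
  bnd (p ^ n - q ^ n + sc (RtoC (d * INR n)) * q ^ (S n))%op
    (INR n * INR n * d ^ 2 * w ^ (n + 2)).
Proof.
  intros hpq hp hq. assert (hw : 0 <= w) by apply hp.
  induction n as [|n IH].
  - replace (d * INR 0) with 0 by (simpl; ring). rewrite Osc_0.
    replace (p ^ 0 - q ^ 0 + 0 * q ^ 1)%op with (0 : Op)%op by (cbn [Opow]; ring).
    eapply bnd_le; [apply bnd_zero|]. simpl; lra.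
  - replace (p ^ S n - q ^ S n + sc (RtoC (d * INR (S n))) * q ^ S (S n))%op with
     (p * (p ^ n - q ^ n + sc (RtoC (d * INR n)) * q ^ S n)
      + sc (RtoC (INR (S n) * d ^ 2)) * (q ^ (S n) * q * p))%op.
    + eapply bnd_le; [apply obnd_add; [apply obnd_mul; [exact hp|exact IH]|]|].
      * apply obnd_mul; [apply obnd_scr|].
        -- apply Rmult_le_pos; [apply pos_INR|apply pow2_ge_0].
        -- apply obnd_mul; [apply obnd_mul; [apply obnd_pow, hq|exact hq]|exact hp].
      * rewrite S_INR. replace (S n + 2)%nat with (S (n + 2)) by lia.
        replace (w ^ S n * w * w) with (w ^ (S (n + 2))).
        2:{ replace (S (n + 2)) with (S n + 2)%nat by lia. rewrite pow_add. simpl. ring. }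
        assert (0 <= w ^ S (n + 2)) by (apply pow_le; auto).
        assert (h1 : 0 <= d ^ 2) by apply pow2_ge_0.
        assert (h2 := pos_INR n).
        replace (w * (INR n * INR n * d ^ 2 * w ^ (n + 2))) with
         (INR n * INR n * (d ^ 2 * w ^ S (n + 2))) by (change (w ^ S (n + 2)) with (w * w ^ (n + 2)); ring).
        assert (h3 : 0 <= d ^ 2 * w ^ S (n + 2)) by (apply Rmult_le_pos; auto).
        apply Rle_trans with ((INR n * INR n + (INR n + 1)) * (d ^ 2 * w ^ S (n + 2))); [right; ring|].
        rewrite (Rmult_assoc _ (d ^ 2)). apply Rmult_le_compat_r; auto. nra.
    + apply Osub_eq. cbn [Opow]. rewrite S_INR.
      replace (sc (RtoC (d * (INR n + 1)))%R) with (sc (RtoC d) * sc (RtoC (INR n)) + sc (RtoC d))%op.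
      2:{ rewrite <- Osc_mult, <- Osc_plus, <- RtoC_mult, <- RtoC_plus. do 2 f_equal. ring. }
      replace (sc (RtoC ((INR n + 1) * d ^ 2))) with
        (sc (RtoC (INR n)) * sc (RtoC d) * sc (RtoC d) + sc (RtoC d) * sc (RtoC d))%op.
      2:{ rewrite <- !Osc_mult, <- Osc_plus, <- !RtoC_mult, <- RtoC_plus. do 2 f_equal. ring. }
      replace (sc (RtoC (d * INR n))) with (sc (RtoC d) * sc (RtoC (INR n)))%op.
      2:{ now rewrite <- Osc_mult, <- RtoC_mult. }
      transitivity ((q ^ n - (1 + sc (RtoC (INR n))) * sc (RtoC d) * q ^ n * q)
          * (q - p - sc (RtoC d) * p * q))%op; [ring|].
      rewrite hpq. ring.
Qed.

Lemma kexp_S n a : kexp (S n) (Cplus a (RtoC 1)) = kexp n a.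
Proof. unfold kexp. rewrite S_INR, RtoC_plus. ring. Qed.

(** Integrating [Or_pow_taylor] gives the derivative of [Kfam n a] in [t], in
    operator norm and with a quadratic remainder, uniformly down to [t = 0]. *)
Lemma Kfam_taylor n a : 0 < Re a < INR n -> exists C, 0 <= C /\ forall u v, 0 <= u -> 0 <= v ->
  bnd (Kfam n a v - Kfam n a u + sc (RtoC ((v - u) * INR n)) * Kfam (S n) (Cplus a (RtoC 1)) u)%op
    (C * (v - u) ^ 2).
Proof.
  intros ha. destruct (Or_bound X D) as [M [hM [hb _]]].
  set (C0 := INR n * INR n * M ^ (n + 2)).
  assert (hC0 : 0 <= C0).
  { apply Rmult_le_pos; [|apply pow_le; lra]. generalize (pos_INR n). nra. }
  destruct (Kfam_spec X D n a ha) as [C1 [_ hK]].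
  destruct (Kfam_spec X D (S n) (Cplus a (RtoC 1))) as [C2 [_ hK']].
  { rewrite S_INR. unfold Cplus, RtoC, Re; simpl. unfold Re in ha. lra. }
  exists (C0 * Kpow (INR n - Re a) (INR n + 2)).
  split. { apply Rmult_le_pos; auto. apply Rlt_le, Kpow_pos; lra. }
  intros u v hu hv.
  assert (h := oint_add X D _ _ _ _ (oint_sub X D _ _ _ _ (proj1 (hK v hv)) (proj1 (hK u hu)))
    (oint_mul X D (sc (RtoC ((v - u) * INR n))) _ _ (proj1 (hK' u hu)))).
  assert (he : forall z, (kern n a v z - kern n a u z + sc (RtoC ((v - u) * INR n)) *
     kern (S n) (Cplus a (RtoC 1)) u z)%op = (sc (rcpow z (kexp n a)) *
     (r (v + z) ^ n - r (u + z) ^ n + sc (RtoC ((v - u) * INR n)) * r (u + z) ^ (S n)))%op).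
  { intros z. rewrite !kern_eq. rewrite kexp_S. ring. }
  apply (oint_ext X D _ (fun z => sc (rcpow z (kexp n a)) *
     (r (v + z) ^ n - r (u + z) ^ n + sc (RtoC ((v - u) * INR n)) * r (u + z) ^ (S n)))%op) in h;
    [|intros z _; apply he].
  eapply bnd_le.
  - apply (oint_bound X D _ _ (C0 * (v - u) ^ 2) 1 (INR n - Re a) (INR n + 2) h); try lra.
    + apply Rmult_le_pos; auto. apply pow2_ge_0.
    + intros z hz x.
      apply (continuous_ext (fun z => plus (minus (kern n a v z x : XR) (kern n a u z x : XR))
         (scal ((v - u) * INR n) (kern (S n) (Cplus a (RtoC 1)) u z x : XR)))).
      { intros y. exact (f_equal (fun U : Op => U x) (he y)). }
      apply (continuous_plus (K := R_AbsRing) (V := XR)).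
      * apply (continuous_minus (K := R_AbsRing) (V := XR)); now apply pcont_kern.
      * apply (continuous_scal_r (K := R_AbsRing) (V := XR)). now apply pcont_kern.
    + intros z hz.
      assert (hw : forall t, 0 <= t -> bnd (r (t + z)) (M / (1 + z))).
      { intros t ht. eapply bnd_le; [apply hb; lra|].
        apply Rmult_le_compat_l; [lra|]. apply Rinv_le_contravar; lra. }
      eapply bnd_le.
      * apply obnd_rcpow, (Or_pow_taylor _ _ (v - u) (M / (1 + z)) n); auto.
        rewrite Or_resolvent by lra. replace (v + z - (u + z)) with (v - u) by ring. ring.
      * rewrite Re_kexp, pow_div_Rpower by lra. unfold C0.
        rewrite plus_INR. change (INR 2) with 2. right; ring.
  - unfold Rpower. rewrite ln_1, Rmult_0_r, exp_0. right; ring.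
Qed.

Lemma is_derive_quadratic (F : R -> X) (u : R) (l : X) (C d : R) : 0 < d ->
  (forall v, Rabs (v - u) < d ->
     norm (minus (minus (F v) (F u)) (scal (RtoC (v - u)) l)) <= C * (v - u) ^ 2) ->
  is_derive (F : R -> XR) u (l : XR).
Proof.
  intros hd h. split; [apply (is_linear_scal_l (K := R_AbsRing) (V := XR))|].
  intros x hx. assert (hxu : x = u).
  { symmetry. apply (is_filter_lim_locally_unique (K := R_AbsRing) (V := R_NormedModule)). exact hx. }
  subst x. intros eps.
  set (C' := Rabs C + 1). assert (hC' : 0 < C') by (unfold C'; generalize (Rabs_pos C); lra).
  assert (he : 0 < Rmin d (eps / C')).
  { apply Rmin_glb_lt; auto. apply Rdiv_lt_0_compat; auto. apply cond_pos. }
  exists (mkposreal _ he). intros v hv.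
  assert (h1 : Rabs (v - u) < d) by (eapply Rlt_le_trans; [exact hv|apply Rmin_l]).
  assert (h2 : Rabs (v - u) < eps / C') by (eapply Rlt_le_trans; [exact hv|apply Rmin_r]).
  eapply Rle_trans; [exact (h v h1)|].
  change (C * (v - u) ^ 2 <= eps * Rabs (v - u)).
  replace ((v - u) ^ 2) with (Rabs (v - u) * Rabs (v - u)).
  2:{ rewrite <- Rabs_mult. rewrite Rabs_pos_eq; [ring|]. generalize (pow2_ge_0 (v - u)). intros; nra. }
  assert (h3 := Rabs_pos (v - u)).
  apply Rmult_lt_compat_l with (r := C') in h2; auto.
  replace (C' * (eps / C')) with (pos eps) in h2 by (field; lra).
  assert (C <= C') by (unfold C'; generalize (Rle_abs C); lra).
  rewrite <- Rmult_assoc. apply Rmult_le_compat_r; auto. nra.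
Qed.

Lemma is_derive_Or_pow t z n x : 0 <= t -> 0 < z ->
  is_derive (fun z => (r (t + z) ^ n)%op x : XR) z
    ((- (sc (RtoC (INR n)) * r (t + z) ^ (S n)))%op x : XR).
Proof.
  intros ht hz. destruct (Or_bound X D) as [M [hM [hb _]]].
  apply (is_derive_quadratic (fun z => (r (t + z) ^ n)%op x) z _ (INR n * INR n * M ^ (n + 2) * norm x) z); auto.
  intros v hv. apply Rabs_def2 in hv.
  assert (hw : forall u, 0 <= u -> bnd (r u) M).
  { intros u hu. eapply bnd_le; [apply hb; lra|]. apply Rle_div_l; nra. }
  assert (h : (r (t + z) - r (t + v) = sc (RtoC (v - z)) * r (t + v) * r (t + z))%op).
  { rewrite Or_resolvent by lra. replace (t + v - (t + z)) with (v - z) by ring. ring. }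
  assert (h1 := Or_pow_taylor _ _ _ M n h (hw (t + v) ltac:(lra)) (hw (t + z) ltac:(lra))).
  rewrite RtoC_mult, Osc_mult in h1.
  replace (r (t + v) ^ n - r (t + z) ^ n + sc (RtoC (v - z)) * sc (RtoC (INR n)) * r (t + z) ^ S n)%op
   with (r (t + v) ^ n - r (t + z) ^ n - sc (RtoC (v - z)) * (- (sc (RtoC (INR n)) * r (t + z) ^ S n)))%op in h1 by ring.
  eapply Rle_trans; [apply (proj2 h1)|]. right; ring.
Qed.

Lemma filterlim_xzero (F : R -> X) (g : R -> R) (Fl : (R -> Prop) -> Prop) {FF : Filter Fl} :
  Fl (fun z => norm (F z) <= g z) -> filterlim g Fl (locally 0) ->
  filterlim (F : R -> XR) Fl (locally (zero : XR)).
Proof.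
  intros h hg P [eps hP].
  assert (h1 := hg _ (locally_ball 0 eps)). unfold filtermap in *.
  generalize (filter_and _ _ h h1). apply filter_imp. intros z [k1 k2].
  apply hP. apply xball.
  match goal with |- norm ?m < _ => replace m with (F z) end.
  - eapply Rle_lt_trans; [exact k1|]. eapply Rle_lt_trans; [apply Rle_abs|].
    unfold ball in k2; simpl in k2; unfold AbsRing_ball, abs, minus, plus, opp in k2; simpl in k2.
    now rewrite Ropp_0, Rplus_0_r in k2.
  - symmetry. exact (@minus_zero_r (CompleteNormedModule.AbelianGroup C_AbsRing X) (F z)).
Qed.

(** Integration by parts with the primitive [z^(n-a) R_(u+z)^n R_u x]; the
    resolvent identity [R_u - R_(u+z) = z R_u R_(u+z)] absorbs the factor [z].
    With [Kfam_taylor] it turns the derivative into [- a R_u] times the family. *)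
Lemma Kfam_raise n a u : 0 < Re a < INR n -> 0 <= u ->
  (sc a * (r u * Kfam n a u) = sc (RtoC (INR n)) * Kfam (S n) (Cplus a (RtoC 1)) u)%op.
Proof.
  intros ha hu.
  destruct (Or_pow_bound X D) as [M [hM hb]].
  destruct (Kfam_spec X D n a ha) as [C1 [_ hK]].
  destruct (Kfam_spec X D (S n) (Cplus a (RtoC 1))) as [C2 [_ hK']].
  { rewrite S_INR. unfold Cplus, RtoC, Re; simpl. unfold Re in ha. lra. }
  destruct (hK u hu) as [i1 _]. destruct (hK' u hu) as [i2 _].
  assert (h := oint_sub X D _ _ _ _ (oint_mul X D (sc (RtoC (INR n))) _ _ i2)
                 (oint_mul X D (sc a * r u)%op _ _ i1)).
  assert (h0 : (sc (RtoC (INR n)) * Kfam (S n) (Cplus a (RtoC 1)) u - sc a * r u * Kfam n a u)%op = (0 : Op)%op).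
  { apply op_eq. intros x. refine (int0oo_unique XR _ _ _ (h x) _).
    set (e := Cminus (RtoC (INR n)) a).
    assert (hRe : Re e = INR n - Re a).
    { unfold e, Cminus, Cplus, Copp, RtoC, Re; simpl. ring. }
    set (F := fun z => scal (rcpow z e) ((r (u + z) ^ n)%op (r u x)) : XR).
    match goal with |- is_RInt_gen _ _ _ ?v => replace v with (minus (zero : XR) (zero : XR)) end.
    2:{ exact (@minus_zero_r XR (zero : XR)). }
    apply (int0oo_derive XR F).
    - intros z hz.
      assert (hd := is_derive_cscal X (fun z => rcpow z e) (fun z => (r (u + z) ^ n)%op (r u x)) z
        (Cmult e (rcpow z (Cminus e (RtoC 1)))) _ (is_derive_rcpow_re z e hz) (is_derive_rcpow_im z e hz)
        (is_derive_Or_pow u z n (r u x) hu hz)).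
      match type of hd with is_derive _ _ ?l => match goal with |- is_derive _ _ ?l' =>
        replace l' with l; [exact hd|] end end.
      rewrite !kern_eq. rewrite kexp_S.
      assert (hz0 : rcpow z e = Cmult (RtoC z) (rcpow z (kexp n a))).
      { unfold kexp. fold e. rewrite rcpow_minus_1 by auto. field.
        intros h1. apply RtoC_inj in h1. lra. }
      rewrite hz0. fold e. change (Cminus e (RtoC 1)) with (kexp n a).
      set (g := rcpow z (kexp n a)).
      transitivity (((sc (Cmult e g) * r (u + z) ^ n + sc (Cmult (RtoC z) g) * (- (sc (RtoC (INR n)) * r (u + z) ^ S n))) * r u)%op x).
      { reflexivity. }
      apply (f_equal (fun U : Op => U x)).
      unfold e. rewrite !Osc_mult, Osc_minus.
      assert (hr := Or_resolvent X D u (u + z) hu ltac:(lra)).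
      replace (u + z - u) with z in hr by ring.
      cbn [Opow]. apply Osub_eq.
      transitivity (sc g * sc (RtoC (INR n)) * r (u + z) ^ n *
        (r u - r (u + z) - sc (RtoC z) * r u * r (u + z)))%op; [ring|].
      rewrite hr. ring.
    - intros z hz.
      apply (continuous_minus (K := R_AbsRing) (V := XR)).
      + apply (continuous_comp (V := XR) (W := XR) (fun z => kern (S n) (Cplus a (RtoC 1)) u z x)
          (fun v => scal (RtoC (INR n)) (v : X) : XR)).
        * now apply pcont_kern.
        * apply (linear_cont (K := R_AbsRing) (U := XR) (V := XR)), xscal_real_linear.
      + apply (continuous_comp (V := XR) (W := XR) (fun z => kern n a u z x)
          (fun v => (sc a * r u)%op (v : X) : XR)).
        * now apply pcont_kern.
        * apply (linear_cont (K := R_AbsRing) (U := XR) (V := XR)), bounded_linear;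
          [apply op_lin|apply op_bdd].
    - apply (filterlim_xzero F (fun z => Rpower z (Re e) * (M ^ n * norm (r u x))) (at_right 0)).
      + exists (mkposreal 1 Rlt_0_1). intros z _ hz. unfold F.
        change (norm (scal (rcpow z e) ((r (u + z) ^ n)%op (r u x))) <= Rpower z (Re e) * (M ^ n * norm (r u x))).
        rewrite xnorm_scal, Cmod_rcpow. apply Rmult_le_compat_l; [apply Rlt_le, Rpower_pos|].
        assert (h1 := proj1 (hb n u z hu hz)).
        eapply Rle_trans; [apply (proj2 h1)|]. apply Rmult_le_compat_r; [apply xnorm_ge_0|].
        rewrite <- (Rmult_1_r (M ^ n)) at 2. apply Rmult_le_compat_l; [apply pow_le; lra|].
        apply Rle_trans with (Rpower (1 + z) 0); [|rewrite Rpower_O; lra].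
        apply Rle_Rpower; [lra|]. generalize (pos_INR n); lra.
      + replace (locally 0) with (locally (0 * (M ^ n * norm (r u x)))) by (f_equal; ring).
        apply (filterlim_comp _ _ _ (fun z => Rpower z (Re e)) (fun y => y * (M ^ n * norm (r u x))) _ (locally 0)).
        * apply Rpower_lim_0. lra.
        * apply (continuous_mult (K := R_AbsRing) (fun y => y) (fun _ => M ^ n * norm (r u x)));
          [apply continuous_id|apply continuous_const].
    - apply (filterlim_xzero F (fun z => Rpower z (- Re a) * (M ^ n * norm (r u x))) (Rbar_locally p_infty)).
      + exists 0. intros z hz. unfold F.
        change (norm (scal (rcpow z e) ((r (u + z) ^ n)%op (r u x))) <= Rpower z (- Re a) * (M ^ n * norm (r u x))).
        rewrite xnorm_scal, Cmod_rcpow, hRe.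
        unfold Rminus. rewrite Rplus_comm, Rpower_plus, Rmult_assoc.
        apply Rmult_le_compat_l; [apply Rlt_le, Rpower_pos|].
        assert (h1 := proj2 (hb n u z hu hz)).
        eapply Rle_trans; [apply Rmult_le_compat_l; [apply Rlt_le, Rpower_pos|apply (proj2 h1)]|].
        rewrite <- !Rmult_assoc. apply Rmult_le_compat_r; [apply xnorm_ge_0|].
        rewrite (Rmult_comm _ (M ^ n)), Rmult_assoc.
        rewrite <- (Rmult_1_r (M ^ n)) at 2. apply Rmult_le_compat_l; [apply pow_le; lra|].
        apply Rle_trans with (Rpower z (INR n) * Rpower z (- INR n)).
        * apply Rmult_le_compat_l; [apply Rlt_le, Rpower_pos|]. apply Rle_Rpower_neg; [|lra].
          generalize (pos_INR n); lra.
        * rewrite <- Rpower_plus, Rplus_opp_r, Rpower_O by auto. lra.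
      + replace (locally 0) with (locally (0 * (M ^ n * norm (r u x)))) by (f_equal; ring).
        apply (filterlim_comp _ _ _ (fun z => Rpower z (- Re a)) (fun y => y * (M ^ n * norm (r u x))) _ (locally 0)).
        * apply Rpower_lim_oo. lra.
        * apply (continuous_mult (K := R_AbsRing) (fun y => y) (fun _ => M ^ n * norm (r u x)));
          [apply continuous_id|apply continuous_const]. }
  symmetry. apply Osub_eq. rewrite <- h0. ring.
Qed.

End Semigroup.

(** * The semigroup of the powers [(t + A)^(-a)] *)

Section Powers.

Variable X : CompleteNormedModule C_AbsRing.
Variable D : resolvents X.
Notation Op := (Op X D).
Notation r := (@Or X D).
Notation b := (@Ob X D).
Notation sc := (@Osc X D).
Notation Kfam := (Kfam X D).

Add Ring OpRing7 : (Op_ring_theory X D).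

(** The equation [F' = - c R_t F] on [[0, T]], stated with a quadratic remainder
    in operator norm: in this form it is stable under products and
    integrates to bounds on increments. *)
Definition solves (c : C) (F : R -> Op) (T : R) : Prop :=
  exists K, 0 <= K /\ (forall t, 0 <= t <= T -> bnd (F t) K) /\
  forall u v, 0 <= u <= T -> 0 <= v <= T ->
    bnd (F v - F u + sc (RtoC (v - u)) * sc c * (r u * F u))%op (K * (v - u) ^ 2).

(** The characterization of [t -> (t + A)^(-c)]: the equation determines it up to
    a constant factor, and the behaviour at infinity determines the factor. *)
Definition powfam (c : C) (F : R -> Op) : Prop :=
  (forall T, solves c F T) /\
  exists j K, 0 <= K /\ forall t, 1 <= t ->
    bnd (sc (rcpow t c) * F t * b ^ j - b ^ j)%op (K / t).

Lemma Or_bnd_1 : exists M, 1 <= M /\ forall t, 0 <= t -> bnd (r t) M.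
Proof.
  destruct (Or_bound X D) as [M [hM [h _]]]. exists M. split; auto. intros t ht.
  eapply bnd_le; [apply h; auto|]. apply Rle_div_l; nra.
Qed.

Lemma obnd_scr_abs (x : R) : bnd (sc (RtoC x)) (Rabs x).
Proof. rewrite <- Cmod_R. apply obnd_sc. Qed.

Lemma pow2_Rabs x : Rabs x * Rabs x = x ^ 2.
Proof. rewrite <- Rabs_mult, Rabs_pos_eq; [ring|]. generalize (pow2_ge_0 x). simpl. lra. Qed.

Lemma solves_lipschitz c F T : solves c F T -> exists L, 0 <= L /\
  forall u v, 0 <= u <= T -> 0 <= v <= T -> bnd (F v - F u)%op (L * Rabs (v - u)).
Proof.
  intros [K [hK [h1 h2]]]. destruct Or_bnd_1 as [M [hM hr]].
  exists (K * Rabs T + Cmod c * (M * K)).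
  assert (hc := Cmod_ge_0 c). assert (hT := Rabs_pos T).
  split. { apply Rplus_le_le_0_compat; repeat apply Rmult_le_pos; lra. }
  intros u v hu hv.
  replace (F v - F u)%op with (F v - F u + sc (RtoC (v - u)) * sc c * (r u * F u)
    - sc (RtoC (v - u)) * sc c * (r u * F u))%op by ring.
  eapply bnd_le.
  - apply obnd_sub; [apply h2; auto|].
    apply obnd_mul; [apply obnd_mul; [apply obnd_scr_abs|apply obnd_sc]|].
    apply obnd_mul; [apply hr|apply h1]; lra.
  - rewrite <- pow2_Rabs. assert (h3 := Rabs_pos (v - u)).
    assert (h4 : Rabs (v - u) <= Rabs T).
    { rewrite (Rabs_pos_eq T) by lra. apply Rabs_le. lra. }
    rewrite Rmult_plus_distr_r. apply Rplus_le_compat; [|right; ring].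
    rewrite <- Rmult_assoc. apply Rmult_le_compat_r; auto. apply Rmult_le_compat_l; auto.
Qed.

Lemma solves_mul c d F G T : solves c F T -> solves d G T ->
  solves (Cplus c d) (fun t => F t * G t)%op T.
Proof.
  intros hF hG. destruct (solves_lipschitz _ _ _ hF) as [L [hL hl]].
  destruct hF as [K [hK [h1 h2]]], hG as [N [hN [k1 k2]]].
  destruct Or_bnd_1 as [M [hM hr]].
  assert (hd := Cmod_ge_0 d).
  assert (h0 : 0 <= Cmod d * (M * N * L)) by (repeat apply Rmult_le_pos; lra).
  exists (K * N + K * N + N * K + Cmod d * (M * N * L)). split; [nra|]. split.
  - intros t ht. eapply bnd_le; [apply obnd_mul; auto|]. nra.
  - intros u v hu hv.
    replace (F v * G v - F u * G u + sc (RtoC (v - u)) * sc (Cplus c d) * (r u * (F u * G u)))%op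
     with (F v * (G v - G u + sc (RtoC (v - u)) * sc d * (r u * G u))
       + G u * (F v - F u + sc (RtoC (v - u)) * sc c * (r u * F u))
       - (sc (RtoC (v - u)) * sc d * (r u * G u * (F v - F u))))%op.
    + eapply bnd_le.
      * apply obnd_sub; [apply obnd_add; apply obnd_mul; auto|].
        apply obnd_mul; [apply obnd_mul; [apply obnd_scr_abs|apply obnd_sc]|].
        apply obnd_mul; [apply obnd_mul; [apply hr; lra|apply k1; auto]|apply hl; auto].
      * rewrite <- pow2_Rabs. assert (h3 := Rabs_pos (v - u)). 
        assert (h4 : 0 <= Rabs (v - u) * Rabs (v - u)) by nra. 
        replace (Rabs (v - u) * Cmod d * (M * N * (L * Rabs (v - u)))) with
          (Cmod d * (M * N * L) * (Rabs (v - u) * Rabs (v - u))) by ring.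
        assert (0 <= K * N) by nra. nra.
    + rewrite Osc_plus. ring.
Qed.

(** [(1 + t B) R_t = B], so that the factor [1 + t B] solves the equation for
    [c = -1]. *)
Lemma solves_shift c F T : solves c F T ->
  solves (Cminus c (RtoC 1)) (fun t => (1 + sc (RtoC t) * b) * F t)%op T.
Proof.
  intros hF. destruct (solves_lipschitz _ _ _ hF) as [L [hL hl]].
  destruct hF as [K [hK [h1 h2]]]. destruct (op_bdd _ _ b) as [N hN].
  assert (hN0 : 0 <= N) by apply hN.
  assert (hT := Rabs_pos T).
  assert (hb : forall t, 0 <= t <= T -> bnd (1 + sc (RtoC t) * b)%op (1 + Rabs T * N)).
  { intros t ht. apply obnd_add; [apply obnd_1|].
    apply obnd_mul; auto. eapply bnd_le; [apply obnd_scr; lra|].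
    rewrite Rabs_pos_eq; lra. }
  assert (h0 : 0 <= Rabs T * N) by nra.
  exists ((1 + Rabs T * N) * K + N * L). split; [nra|]. split.
  - intros t ht. eapply bnd_le; [apply obnd_mul; auto|]. nra.
  - intros u v hu hv.
    match goal with |- bnd (fn ?e) _ => replace e with
     ((1 + sc (RtoC u) * b) * (F v - F u + sc (RtoC (v - u)) * sc c * (r u * F u))
      + sc (RtoC (v - u)) * (b * (F v - F u)))%op end.
    + eapply bnd_le.
      * apply obnd_add; [apply obnd_mul; [apply hb; auto|apply h2; auto]|].
        apply obnd_mul; [apply obnd_scr_abs|]. apply obnd_mul; [exact hN|apply hl; auto].
      * rewrite <- pow2_Rabs. right; ring.
    + rewrite Osc_minus. fold (@Oone X D).
      assert (e : (sc (RtoC v) = sc (RtoC u) + sc (RtoC (v - u)))%op).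
      { rewrite <- Osc_plus, <- RtoC_plus. do 2 f_equal. ring. }
      rewrite e.
      assert (hs := Or_spec X D u ltac:(lra)).
      apply Osub_eq.
      transitivity (sc (RtoC (v - u)) * F u * (r u + sc (RtoC u) * b * r u - b))%op; [ring|].
      rewrite hs. ring.
Qed.

(** Quadratic increments: split [[0, T]] into many equal parts. *)
Lemma solves_0_const F T : 0 <= T -> solves (RtoC 0) F T -> F T = F 0.
Proof.
  intros hT [K [hK [_ h]]]. apply Osub_eq, obnd_0_eq. intros e he.
  assert (hstep : forall N m : nat, (m <= S N)%nat ->
    bnd (F (INR m * (T / INR (S N)))%R - F 0%R)%op (INR m * (K * (T / INR (S N)) ^ 2))).
  { intros N m. assert (hN : 0 < INR (S N)) by (apply lt_0_INR; lia).
    assert (hTN : 0 <= T / INR (S N)) by (apply Rdiv_le_0_compat; auto).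
    assert (hmax : forall k, (k <= S N)%nat -> 0 <= INR k * (T / INR (S N)) <= T).
    { intros k hk. split; [apply Rmult_le_pos; [apply pos_INR|auto]|].
      replace T with (INR (S N) * (T / INR (S N))) at 2 by (field; lra).
      apply Rmult_le_compat_r; auto. now apply le_INR. }
    induction m as [|m IH]; intros hm.
    - simpl INR. rewrite !Rmult_0_l. replace (F 0%R - F 0%R)%op with (0 : Op)%op by ring. apply bnd_zero.
    - replace (F (INR (S m) * (T / INR (S N)))%R - F 0%R)%op with
        ((F (INR (S m) * (T / INR (S N)))%R - F (INR m * (T / INR (S N)))%R) +
         (F (INR m * (T / INR (S N)))%R - F 0%R))%op by ring.
      assert (h1 := h _ _ (hmax m ltac:(lia)) (hmax (S m) ltac:(lia))).
      rewrite Osc_0 in h1.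
      match type of h1 with bnd (fn (?p + _)%op) _ =>
       match type of h1 with bnd (fn ?w) _ => replace w with p in h1 by ring end end.
      eapply bnd_le; [apply obnd_add; [exact h1|apply IH; lia]|].
      rewrite S_INR. right. ring. }
  destruct (nfloor_ex ((K * T ^ 2) / e)) as [N [_ hN]].
  { apply Rdiv_le_0_compat; auto. apply Rmult_le_pos; auto. apply pow2_ge_0. }
  assert (hp : 0 < INR (S N)) by (apply lt_0_INR; lia).
  assert (h1 := hstep N (S N) (le_n _)).
  replace (INR (S N) * (T / INR (S N))) with T in h1 by (field; lra).
  eapply bnd_le; [exact h1|].
  replace (INR (S N) * (K * (T / INR (S N)) ^ 2)) with (K * T ^ 2 / INR (S N)) by (field; lra).
  apply Rle_div_l; auto. rewrite <- S_INR in hN. left.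
  apply (Rmult_lt_compat_l e) in hN; auto.
  replace (e * (K * T ^ 2 / e)) with (K * T ^ 2) in hN by (field; lra). lra.
Qed.

Lemma solves_nat n F T : 0 <= T -> solves (RtoC (INR n)) F T ->
  (b ^ n * F T = r T ^ n * F 0%R)%op.
Proof.
  intros hT. revert F. induction n as [|n IH]; intros F hF.
  - cbn [Opow]. rewrite (solves_0_const F T hT hF). ring.
  - apply solves_shift in hF. replace (Cminus (RtoC (INR (S n))) (RtoC 1)) with (RtoC (INR n)) in hF.
    + specialize (IH _ hF). cbv beta in IH. rewrite Osc_0 in IH.
      cbn [Opow]. transitivity (r T * (b ^ n * ((1 + sc (RtoC T) * b) * F T)))%op.
      * transitivity (b ^ n * F T * (r T + sc (RtoC T) * b * r T))%op; [rewrite Or_spec by auto|]; ring.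
      * rewrite IH. ring.
    + rewrite S_INR, RtoC_plus. ring.
Qed.

Lemma Or_scaled_limit n : exists K, 0 <= K /\ forall t, 1 <= t ->
  bnd ((sc (RtoC t) * r t) ^ n * b - b)%op (K / t).
Proof.
  destruct (Or_bound X D) as [M [hM [_ hr]]].
  induction n as [|n [K [hK IH]]].
  - exists 0. split; [lra|]. intros t ht. cbn [Opow].
    replace (1 * b - b)%op with (0 : Op)%op by ring. eapply bnd_le; [apply bnd_zero|]. unfold Rdiv; lra.
  - exists (M * K + M). split; [nra|]. intros t ht.
    replace ((sc (RtoC t) * r t) ^ S n * b - b)%op with
     (sc (RtoC t) * r t * ((sc (RtoC t) * r t) ^ n * b - b) - r t)%op.
    + eapply bnd_le.
      * apply obnd_sub; [|apply hr; lra]. apply obnd_mul; [|apply IH; auto].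
        apply obnd_mul; [apply obnd_scr; lra|apply hr; lra].
      * right. field. lra.
    + cbn [Opow]. apply Osub_eq.
      transitivity (b - (r t + sc (RtoC t) * b * r t))%op; [ring|]. rewrite Or_spec by lra. ring.
Qed.

Lemma Opow_reg n (S T : Op) : (b ^ n * S = b ^ n * T -> S = T)%op.
Proof. rewrite <- Or_0. apply Or_pow_reg. lra. Qed.

Lemma Osc_pow (x : R) n : (sc (RtoC x) ^ n = sc (RtoC (x ^ n)%R))%op.
Proof.
  induction n; simpl; auto. rewrite IHn, RtoC_mult, Osc_mult. reflexivity.
Qed.

(** [(1 + t B)^n F(t)] is constant ([solves_nat]), equal to [F 0]; letting [t]
    tend to infinity gives [F 0 = B^n]. *)
Lemma powfam_nat n F t : 0 <= t -> powfam (RtoC (INR n)) F -> F t = (r t ^ n)%op.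
Proof.
  intros ht [hs [j [K [hK hlim]]]].
  assert (h0 : F 0 = (b ^ n)%op).
  { apply (Opow_reg (S j)). apply Osub_eq, obnd_0_eq. intros e he.
    destruct (Or_scaled_limit n) as [K' [hK' hlim']].
    destruct (op_bdd _ _ (F 0%R * b ^ j)%op) as [N hN]. assert (hN0 : 0 <= N) by apply hN.
    destruct (op_bdd _ _ (b ^ n * b)%op) as [N' hN']. assert (hN0' : 0 <= N') by apply hN'.
    set (T := 1 + (N * K' + N' * K) / e).
    assert (hq : 0 <= N * K' + N' * K) by nra.
    assert (hT : 1 <= T).
    { assert (0 <= (N * K' + N' * K) / e) by (apply Rdiv_le_0_compat; auto). unfold T; lra. }
    assert (h1 := hlim T hT). assert (h2 := hlim' T hT).
    rewrite rcpow_pow in h1 by lra.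
    assert (h3 := solves_nat n F T ltac:(lra) (hs T)).
    replace (b ^ S j * F 0%R - b ^ S j * b ^ n)%op with
      (b ^ n * b * (sc (RtoC (T ^ n)) * F T * b ^ j - b ^ j)
       - F 0%R * b ^ j * ((sc (RtoC T) * r T) ^ n * b - b))%op.
    - eapply bnd_le; [apply obnd_sub; apply obnd_mul; eassumption|].
      apply Rle_trans with ((N * K' + N' * K) / T); [right; field; lra|].
      apply Rle_div_l; [lra|]. unfold T. rewrite Rmult_plus_distr_l.
      replace (e * ((N * K' + N' * K) / e)) with (N * K' + N' * K) by (field; lra). lra.
    - rewrite Opow_mul, Osc_pow. cbn [Opow].
      transitivity (sc (RtoC (T ^ n)) * b * b ^ j * (b ^ n * F T - r T ^ n * F 0%R)
         + (b * b ^ j * F 0%R - b * b ^ j * b ^ n))%op; [ring|]. rewrite h3. ring. }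
  apply (Opow_reg n). rewrite (solves_nat n F t ht (hs t)), h0. ring.
Qed.

Lemma powfam_mul c d F G : powfam c F -> powfam d G -> powfam (Cplus c d) (fun t => F t * G t)%op.
Proof.
  intros [h1 [i [K [hK h2]]]] [k1 [j [N [hN k2]]]]. split.
  - intros T. now apply solves_mul.
  - destruct (op_bdd _ _ (b ^ i)%op) as [P hP]. assert (hP0 : 0 <= P) by apply hP.
    destruct (op_bdd _ _ (b ^ j)%op) as [Q hQ]. assert (hQ0 : 0 <= Q) by apply hQ.
    exists (i + j)%nat, (K * (Q + N) + P * N).
    assert (h0 : 0 <= K * (Q + N)) by nra. split; [nra|].
    intros t ht.
    assert (hd : bnd (sc (rcpow t d) * G t * b ^ j)%op (Q + N)).
    { replace (sc (rcpow t d) * G t * b ^ j)%op with (b ^ j + (sc (rcpow t d) * G t * b ^ j - b ^ j))%op by ring.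
      apply obnd_add; auto. eapply bnd_le; [apply k2; auto|].
      apply (Rle_div_l N N t); [lra|]. nra. }
    replace (sc (rcpow t (Cplus c d)) * (F t * G t) * b ^ (i + j) - b ^ (i + j))%op with
      ((sc (rcpow t c) * F t * b ^ i - b ^ i) * (sc (rcpow t d) * G t * b ^ j)
       + b ^ i * (sc (rcpow t d) * G t * b ^ j - b ^ j))%op.
    + eapply bnd_le; [apply obnd_add; apply obnd_mul; [apply h2; auto|exact hd|exact hP|apply k2; auto]|].
      right. field. lra.
    + rewrite rcpow_plus, Osc_mult, Opow_add. ring.
Qed.

Lemma powfam_Kfam n a : 0 < Re a < INR n ->
  powfam a (fun t => sc (Cinv (kconst n a)) * Kfam n a t)%op.
Proof.
  intros ha. assert (hk := kconst_neq_0 n a ha). split.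
  - intros T.
    destruct (Kfam_spec X D n a ha) as [K [hK h]].
    destruct (Kfam_taylor X D n a ha) as [N [hN h']].
    set (m := Cmod (Cinv (kconst n a))). assert (hm : 0 <= m) by apply Cmod_ge_0.
    exists (m * K + m * N). split; [nra|]. split.
    + intros t ht. eapply bnd_le; [apply obnd_mul; [apply obnd_sc|apply (proj1 (proj2 (h t (proj1 ht))))]|]. fold m. nra.
    + intros u v hu hv.
      match goal with |- bnd (fn ?e) _ => replace e with
        (sc (Cinv (kconst n a)) * (Kfam n a v - Kfam n a u
        + sc (RtoC ((v - u) * INR n)) * Kfam (S n) (Cplus a (RtoC 1)) u))%op end.
      * eapply bnd_le; [apply obnd_mul; [apply obnd_sc|apply h'; lra]|]. fold m.
        generalize (pow2_ge_0 (v - u)). intros. assert (0 <= m * K) by nra. nra.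
      * rewrite RtoC_mult, Osc_mult.
        transitivity (sc (Cinv (kconst n a)) * (Kfam n a v - Kfam n a u
        + sc (RtoC (v - u)) * (sc (RtoC (INR n)) * Kfam (S n) (Cplus a (RtoC 1)) u)))%op; [ring|].
        rewrite <- (Kfam_raise X D n a u ha) by lra. ring.
  - destruct (Kfam_limit X D n a ha) as [K [hK h]].
    exists 1%nat, (Cmod (Cinv (kconst n a)) * K).
    split; [apply Rmult_le_pos; auto; apply Cmod_ge_0|]. intros t ht.
    replace (sc (rcpow t a) * (sc (Cinv (kconst n a)) * Kfam n a t) * b ^ 1 - b ^ 1)%op with
      (sc (Cinv (kconst n a)) * (sc (rcpow t a) * Kfam n a t * b - sc (kconst n a) * b))%op.
    + eapply bnd_le; [apply obnd_mul; [apply obnd_sc|apply h; auto]|]. right. unfold Rdiv. ring.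
    + cbn [Opow].
      transitivity (sc (rcpow t a) * (sc (Cinv (kconst n a)) * Kfam n a t) * b
        - (sc (Cinv (kconst n a)) * sc (kconst n a)) * b)%op; [ring|].
      rewrite Osc_inv_l by auto. ring.
Qed.

(** Multiply by a solution [H] for the complementary exponent [n - c]: by the
    integer case both products are [R_t^n], and [R_t^n] is injective. *)
Lemma powfam_unique c F G t : 0 < Re c -> 0 <= t -> powfam c F -> powfam c G -> F t = G t.
Proof.
  intros hc ht hF hG.
  destruct (nfloor_ex (Re c) (Rlt_le _ _ hc)) as [n [_ hn]]. rewrite <- S_INR in hn.
  set (d := Cminus (RtoC (INR (S n))) c).
  assert (hd : 0 < Re d < INR (S n)).
  { assert (e : Re d = INR (S n) - Re c) by reflexivity. rewrite e. lra. }
  assert (hH := powfam_Kfam (S n) d hd).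
  set (H := fun t => (sc (Cinv (kconst (S n) d)) * Kfam (S n) d t)%op) in *.
  assert (hcd : Cplus c d = RtoC (INR (S n))) by (unfold d; ring).
  assert (e1 := powfam_mul _ _ _ _ hF hH). assert (e2 := powfam_mul _ _ _ _ hG hH).
  rewrite hcd in e1, e2.
  apply powfam_nat with (t := t) in e1, e2; auto. cbv beta in e1, e2.
  apply (Or_pow_reg X D t (S n)); auto.
  transitivity (F t * (G t * H t))%op; [rewrite e2; ring|].
  transitivity (G t * (F t * H t))%op; [ring|rewrite e1; ring].
Qed.

(** The integer in the definition of the fractional powers of bounded
    operators. *)
Definition pexp (a : C) : nat := Z.to_nat (up (Re a)).

Lemma pexp_spec a : 0 < Re a -> Re a < INR (pexp a) <= Re a + 1.
Proof.
  intros h. destruct (archimed (Re a)) as [h1 h2]. unfold pexp.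
  rewrite INR_IZR_INZ, Z2Nat.id; [lra|]. apply le_IZR. lra.
Qed.

(** The power [(t + A)^(-a)], for [0 < Re a]. *)
Definition J (a : C) (t : R) : Op := (sc (Cinv (kconst (pexp a) a)) * Kfam (pexp a) a t)%op.

Lemma powfam_J a : 0 < Re a -> powfam a (J a).
Proof. intros h. apply powfam_Kfam. generalize (pexp_spec a h). lra. Qed.

Lemma Re_plus (a c : C) : Re (Cplus a c) = Re a + Re c.
Proof. reflexivity. Qed.

Lemma Re_minus (a c : C) : Re (Cminus a c) = Re a - Re c.
Proof. reflexivity. Qed.

Lemma Re_R (x : R) : Re (RtoC x) = x.
Proof. reflexivity. Qed.

Lemma J_plus a c t : 0 < Re a -> 0 < Re c -> 0 <= t -> J (Cplus a c) t = (J a t * J c t)%op.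
Proof.
  intros ha hc ht. apply (powfam_unique (Cplus a c) _ (fun t => J a t * J c t)%op); auto.
  - rewrite Re_plus. lra.
  - apply powfam_J. rewrite Re_plus. lra.
  - apply powfam_mul; now apply powfam_J.
Qed.

Lemma J_nat n t : 0 <= t -> (0 < n)%nat -> J (RtoC (INR n)) t = (r t ^ n)%op.
Proof.
  intros ht hn. apply powfam_nat; auto. apply powfam_J. rewrite Re_R. apply lt_0_INR; auto.
Qed.

(** The normalized Balakrishnan integral does not depend on [n], by
    uniqueness. *)
Lemma Kfam_J n a t : 0 < Re a < INR n -> 0 <= t -> Kfam n a t = (sc (kconst n a) * J a t)%op.
Proof.
  intros ha ht.
  rewrite (powfam_unique a (J a) (fun t => sc (Cinv (kconst n a)) * Kfam n a t)%op t); try lra; auto.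
  - transitivity ((sc (Cinv (kconst n a)) * sc (kconst n a)) * Kfam n a t)%op; [|ring].
    rewrite Osc_inv_l; [ring|]. now apply kconst_neq_0.
  - now apply powfam_J.
  - now apply powfam_Kfam.
Qed.

(** A product of [J a t] with another power is an integer power of [R_t]. *)
Lemma J_reg a t (S T : Op) : 0 < Re a -> 0 <= t -> (J a t * S = J a t * T -> S = T)%op.
Proof.
  intros ha ht h.
  set (n := pexp a). assert (hn := pexp_spec a ha). fold n in hn.
  assert (hn0 : (0 < n)%nat) by (apply INR_lt; simpl; lra).
  assert (hd : 0 < Re (Cminus (RtoC (INR n + 1)) a)) by (rewrite Re_minus, Re_R; lra).
  apply (Or_pow_reg X D t (n + 1)); auto.
  rewrite <- J_nat by (auto; lia).
  replace (RtoC (INR (n + 1))) with (Cplus (Cminus (RtoC (INR n + 1)) a) a).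
  - rewrite J_plus by auto.
    transitivity (J (Cminus (RtoC (INR n + 1)) a) t * (J a t * S))%op; [ring|]. rewrite h. ring.
  - rewrite plus_INR. change (INR 1) with 1. ring.
Qed.

Lemma r_inj t y : 0 <= t -> r t y = zero -> y = zero.
Proof.
  intros ht hy. apply (rb_inj _ D).
  change (b y = zero). rewrite <- (Or_spec X D t) by auto.
  replace (r t + sc (RtoC t) * b * r t)%op with ((1 + sc (RtoC t) * b) * r t)%op by ring.
  change ((1 + sc (RtoC t) * b)%op (r t y) = zero). rewrite hy. apply (op_lin_zero X D).
Qed.

Lemma r_pow_inj t n y : 0 <= t -> (r t ^ n)%op y = zero -> y = zero.
Proof.
  intros ht. induction n as [|n IH]; intros hy.
  - rewrite <- hy. symmetry. apply xscal_1_l.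
  - apply IH. now apply (r_inj t).
Qed.

Lemma J_zero_inj a t y : 0 < Re a -> 0 <= t -> J a t y = zero -> y = zero.
Proof.
  intros ha ht hy. set (n := pexp a). assert (hn := pexp_spec a ha). fold n in hn.
  set (d := Cminus (RtoC (INR (S n))) a).
  assert (hd : 0 < Re d) by (unfold d; rewrite Re_minus, Re_R, S_INR; lra).
  apply (r_pow_inj t (S n)); auto.
  rewrite <- J_nat by (lia || lra). replace (RtoC (INR (S n))) with (Cplus d a) by (unfold d; ring).
  rewrite J_plus by auto. change (J d t (J a t y) = zero). rewrite hy. apply (op_lin_zero X D).
Qed.

Lemma J_bound a : 0 < Re a -> exists K, 0 <= K /\ forall t, 0 <= t ->
  bnd (J a t) K /\ (0 < t -> bnd (J a t) (K * Rpower t (- Re a))).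
Proof.
  intros ha. destruct (Kfam_spec X D (pexp a) a) as [K [hK h]].
  { generalize (pexp_spec a ha). lra. }
  assert (hm := Cmod_ge_0 (Cinv (kconst (pexp a) a))).
  exists (Cmod (Cinv (kconst (pexp a) a)) * K). split; [nra|]. intros t ht.
  destruct (h t ht) as [_ [h1 h2]]. split.
  - apply obnd_mul; auto. apply obnd_sc.
  - intros ht'. rewrite Rmult_assoc. apply obnd_mul; auto. apply obnd_sc.
Qed.

End Powers.

(** * Comparison of powers at different shifts *)

Section Comparison.

Variable X : CompleteNormedModule C_AbsRing.
Variable D : resolvents X.
Notation XR := (real_CompleteNormedModule X).
Notation Op := (Op X D).
Notation r := (@Or X D).
Notation b := (@Ob X D).
Notation sc := (@Osc X D).
Notation Kfam := (Kfam X D).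
Notation J := (J X D).

Add Ring OpRing8 : (Op_ring_theory X D).

Lemma J_plus_1 d e t : 0 < Re d -> 0 < Re e -> Cplus d e = RtoC 1 -> 0 <= t ->
  (J d t * J e t)%op = r t.
Proof.
  intros hd he hde ht. rewrite <- J_plus, hde by auto.
  change (RtoC 1) with (RtoC (INR 1)). rewrite J_nat by (auto; lia). cbn [Opow]. ring.
Qed.

(** With [e = 1 - d], the difference of the Balakrishnan integrals for [t + h] and
    for [t], after a correction that vanishes with [h], has the factor [R_t]
    by the resolvent identities. The quotient [T] is a multiple of the integral
    of [h z^d R_(t+z) R_(t+h+z)], which is bounded by a multiple of
    [h^(Re d)]. *)
Lemma comparison_integral d : 0 < Re d < 1 -> exists C, 0 <= C /\
  forall t h, 0 <= t -> 0 < h -> exists T : Op,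
    bnd T (C * Rpower h (Re d)) /\
    (r t * T = J (Cminus (RtoC 1) d) (t + h) - J (Cminus (RtoC 1) d) t
       + sc (RtoC h) * r t * J (Cminus (RtoC 1) d) (t + h))%op.
Proof.
  intros hd. set (e := Cminus (RtoC 1) d).
  assert (he : 0 < Re e < INR 1) by (unfold e; change (INR 1) with 1; rewrite Re_minus, Re_R; lra).
  destruct (Or_bound X D) as [M [hM [_ hr]]].
  destruct (Kfam_spec X D 1 e he) as [K0 [_ hK]].
  assert (hk := kconst_neq_0 1 e he).
  set (k := kconst 1 e) in *.
  exists (Cmod (Cinv k) * (M * M * Kpow (Re d) 1)).
  assert (hC0 : 0 <= M * M * Kpow (Re d) 1).
  { apply Rmult_le_pos; [nra|]. apply Rlt_le, Kpow_pos; lra. }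
  split; [apply Rmult_le_pos; auto; apply Cmod_ge_0|].
  intros t h ht hh.
  set (F := fun z => (sc (rcpow z d) * (sc (RtoC h) * (r (t + z) * r (t + h + z))))%op).
  assert (hc : forall z, 0 < z -> pcont X D F z).
  { intros z hz. apply pcont_scal; [now apply continuous_rcpow_re|now apply continuous_rcpow_im|].
    apply ocont_pcont. apply (ocont_mul X D (fun _ => sc (RtoC h))); [apply ocont_const|].
    apply ocont_mul; apply ocont_Or; lra. }
  assert (hb : forall z, 0 < z -> bnd (F z) (h * (M * M) * (Rpower z (Re d - 1) * Rpower (h + z) (- (1))))).
  { intros z hz.
    assert (hb1 : bnd (r (t + z)) (M / z)).
    { eapply bnd_le; [apply hr; lra|].
      apply Rmult_le_compat_l; [lra|]. apply Rinv_le_contravar; lra. }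
    assert (hb2 : bnd (r (t + h + z)) (M / (h + z))).
    { eapply bnd_le; [apply hr; lra|].
      apply Rmult_le_compat_l; [lra|]. apply Rinv_le_contravar; lra. }
    eapply bnd_le.
    - apply obnd_rcpow. apply obnd_mul; [apply obnd_scr; lra|]. apply obnd_mul; [exact hb1|exact hb2].
    - unfold Rminus. rewrite Rpower_plus, !Rpower_Ropp, !Rpower_1 by lra. right. field. lra. }
  destruct (oint_power X D F (h * (M * M)) h (Re d) 1) as [T0 [h1 h2]]; auto; try lra.
  { apply Rmult_le_pos; [lra|nra]. }
  exists (sc (Cinv k) * T0)%op. split.
  - eapply bnd_le; [apply obnd_mul; [apply obnd_sc|exact h2]|].
    apply Rle_trans with (Cmod (Cinv k) * (M * M * Kpow (Re d) 1 * Rpower h (Re d))); [|right; ring].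
    apply Rmult_le_compat_l; [apply Cmod_ge_0|].
    unfold Rminus. rewrite Rpower_plus, Rpower_Ropp, Rpower_1 by lra. right. field. lra.
  - destruct (hK t ht) as [i1 _]. destruct (hK (t + h) ltac:(lra)) as [i2 _].
    assert (hi := oint_add X D _ _ _ _ (oint_sub X D _ _ _ _ i2 i1)
       (oint_mul X D (sc (RtoC h) * r t)%op _ _ i2)).
    assert (hT : (r t * T0 = Kfam 1 e (t + h) - Kfam 1 e t + sc (RtoC h) * r t * Kfam 1 e (t + h))%op).
    { refine (oint_unique X D _ _ _ (oint_mul X D (r t) _ _ h1) _).
      revert hi. apply oint_ext. intros z hz. unfold F, kern. cbn [Opow].
      replace (kexp 1 e) with (Cminus d (RtoC 1)).
      2:{ unfold kexp, e. change (INR 1) with 1. ring. }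
      assert (ez : rcpow z d = Cmult (RtoC z) (rcpow z (Cminus d (RtoC 1)))).
      { rewrite rcpow_minus_1 by auto. field. apply RtoC_neq_0. lra. }
      rewrite ez, Osc_mult. set (g := sc (rcpow z (Cminus d (RtoC 1)))).
      assert (e1 := Or_resolvent X D t (t + z) ht ltac:(lra)).
      assert (e2 := Or_resolvent X D t (t + h + z) ht ltac:(lra)).
      assert (e3 := Or_resolvent X D (t + z) (t + h + z) ltac:(lra) ltac:(lra)).
      replace (t + z - t) with z in e1 by ring.
      replace (t + h + z - t) with (h + z) in e2 by ring.
      replace (t + h + z - (t + z)) with h in e3 by ring.
      rewrite RtoC_plus, Osc_plus in e2.
      transitivity (g * (sc (RtoC z) * r t * (sc (RtoC h) * r (t + z) * r (t + h + z))))%op; [|ring].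
      rewrite <- e3.
      transitivity (g * (sc (RtoC z) * r t * r (t + z) - ((sc (RtoC h) + sc (RtoC z)) * r t * r (t + h + z))
         + sc (RtoC h) * r t * r (t + h + z)))%op; [|ring].
      rewrite <- e1, <- e2. ring. }
    rewrite !(Kfam_J X D 1 e) in hT by (auto; lra). fold k in hT.
    transitivity (sc (Cinv k) * (r t * T0))%op; [ring|]. rewrite hT.
    transitivity ((sc (Cinv k) * sc k) * (J e (t + h) - J e t + sc (RtoC h) * r t * J e (t + h)))%op; [ring|].
    rewrite Osc_inv_l by auto. ring.
Qed.

Definition is_ratio (d : C) (t u : R) (Y : Op) : Prop := (J d t * Y = J d u)%op.

(** For [0 < Re d < 1] the ratio is [1 - T J_d(u)] or [1 + T J_d(u)], according to
    the order of [t] and [u], with [T] from [comparison_integral]. The bound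
    [|u - t|^(Re d) u^(-Re d)] is at most [1] for [t <= u] and at most
    [(t/u)^(Re d)] for [u <= t]. *)
Lemma ratio_small d : 0 < Re d < 1 -> exists C, 1 <= C /\
  forall t u, 0 <= t -> 0 <= u -> exists Y, is_ratio d t u Y /\
    (t <= u -> bnd Y C) /\ (0 < u <= t -> bnd Y (C * Rpower (t / u) (Re d))).
Proof.
  intros hd. destruct (comparison_integral d hd) as [C [hC hT]].
  set (e := Cminus (RtoC 1) d) in *.
  assert (he : 0 < Re e) by (unfold e; rewrite Re_minus, Re_R; lra).
  assert (hde : Cplus d e = RtoC 1) by (unfold e; ring).
  destruct (J_bound X D d ltac:(lra)) as [K [hK hJ]].
  exists (1 + C * K). split; [nra|]. intros t u ht hu.
  destruct (Rtotal_order t u) as [htu|[htu|htu]].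
  - destruct (hT t (u - t) ht ltac:(lra)) as [T [hb hE]].
    replace (t + (u - t)) with u in hE by ring.
    exists (1 - T * J d u)%op. split; [|split; [|intros; lra]].
    + unfold is_ratio. apply (J_reg X D e t); auto.
      transitivity (J d t * J e t * (1 - T * J d u))%op; [ring|].
      rewrite (J_plus_1 d e t) by (auto; lra).
      transitivity (r t - r t * T * J d u)%op; [ring|]. rewrite hE.
      transitivity (r t - J d u * J e u - sc (RtoC (u - t)) * r t * (J d u * J e u) + J e t * J d u)%op; [ring|].
      rewrite (J_plus_1 d e u) by (auto; lra).
      rewrite <- (Or_resolvent X D t u) by auto. ring.
    + intros _. eapply bnd_le; [apply obnd_sub; [apply obnd_1|apply obnd_mul; [exact hb|apply hJ; lra]]|].
      apply Rplus_le_compat_l.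
      apply Rle_trans with (C * K * (Rpower (u - t) (Re d) * Rpower u (- Re d))); [right; ring|].
      rewrite <- (Rmult_1_r (C * K)) at 2. apply Rmult_le_compat_l; [nra|].
      rewrite Rpower_Ropp. apply Rle_div_l; [apply Rpower_pos|]. rewrite Rmult_1_l.
      apply Rle_Rpower_l; lra.
  - subst u. exists 1%op. split; [unfold is_ratio; ring|]. split.
    + intros _. eapply bnd_le; [apply obnd_1|]. nra.
    + intros h. eapply bnd_le; [apply obnd_1|]. unfold Rdiv. rewrite Rinv_r by lra.
      unfold Rpower. rewrite ln_1, Rmult_0_r, exp_0. nra.
  - destruct (hT u (t - u) hu ltac:(lra)) as [T [hb hE]].
    replace (u + (t - u)) with t in hE by ring.
    exists (1 + T * J d u)%op. split; [|split; [intros; lra|]].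
    + unfold is_ratio. apply (J_reg X D e t); auto.
      transitivity (J d t * J e t * (1 + T * J d u))%op; [ring|].
      rewrite (J_plus_1 d e t) by (auto; lra).
      assert (e1 := Or_resolvent X D u t hu ht).
      transitivity ((r u - sc (RtoC (t - u)) * r u * r t) * (1 + T * J d u))%op.
      { rewrite <- e1. ring. }
      transitivity ((1 - sc (RtoC (t - u)) * r t) * (r u + (r u * T) * J d u))%op; [ring|].
      rewrite hE.
      transitivity ((1 - sc (RtoC (t - u)) * r t) * (r u - J d u * J e u + (1 + sc (RtoC (t - u)) * r u) * J e t * J d u))%op; [ring|].
      rewrite (J_plus_1 d e u) by (auto; lra).
      transitivity ((1 + sc (RtoC (t - u)) * (r u - r t) - sc (RtoC (t - u)) * (sc (RtoC (t - u)) * r u * r t)) * J e t * J d u)%op; [ring|].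
      rewrite <- e1. ring.
    + intros h. eapply bnd_le; [apply obnd_add; [apply obnd_1|apply obnd_mul; [exact hb|apply hJ; lra]]|].
      assert (h1 : 1 <= Rpower (t / u) (Re d)).
      { rewrite <- (Rpower_O (t / u)) by (apply Rdiv_lt_0_compat; lra).
        apply Rle_Rpower; [|lra]. apply Rle_div_r; lra. }
      assert (h2 : Rpower (t - u) (Re d) * Rpower u (- Re d) <= Rpower (t / u) (Re d)).
      { rewrite Rpower_Ropp. replace (/ Rpower u (Re d)) with (Rpower (/ u) (Re d)).
        - unfold Rdiv. rewrite <- Rpower_mult_distr by (try apply Rinv_0_lt_compat; lra).
          apply Rmult_le_compat_r; [apply Rlt_le, Rpower_pos|]. apply Rle_Rpower_l; lra.
        - unfold Rpower. rewrite ln_Rinv, <- exp_Ropp by lra. f_equal. ring. }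
      apply Rle_trans with (1 + C * K * (Rpower (t - u) (Re d) * Rpower u (- Re d))); [right; ring|].
      assert (0 <= C * K) by nra.
      apply Rle_trans with (1 + C * K * Rpower (t / u) (Re d)); [|nra].
      apply Rplus_le_compat_l, Rmult_le_compat_l; auto.
Qed.

Lemma Re_scal_real (x : R) (c : C) : Re (Cmult (RtoC x) c) = x * Re c.
Proof. unfold Re, Cmult, RtoC; simpl. ring. Qed.

Lemma J_mult_nat c n t : 0 < Re c -> 0 <= t ->
  J (Cmult (RtoC (INR (S n))) c) t = (J c t ^ S n)%op.
Proof.
  intros hc ht. induction n as [|n IH].
  - change (INR 1) with 1. rewrite Cmult_1_l. cbn [Opow]. ring.
  - replace (Cmult (RtoC (INR (S (S n)))) c) with (Cplus c (Cmult (RtoC (INR (S n))) c)).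
    + rewrite J_plus, IH; auto.
      rewrite Re_scal_real. apply Rmult_lt_0_compat; auto. apply lt_0_INR; lia.
    + rewrite (S_INR (S n)), RtoC_plus. ring.
Qed.

Lemma Rpower_nat_pow x y n : (Rpower x y) ^ n = Rpower x (INR n * y).
Proof. rewrite <- Rpower_pow by apply Rpower_pos. rewrite Rpower_mult. f_equal. ring. Qed.

(** The general case is an integer power of the case [0 < Re d < 1]. *)
Lemma ratio_exists d : 0 < Re d -> exists C, 1 <= C /\
  forall t u, 0 <= t -> 0 <= u -> exists Y, is_ratio d t u Y /\
    (t <= u -> bnd Y C) /\ (0 < u <= t -> bnd Y (C * Rpower (t / u) (Re d))).
Proof.
  intros hd. destruct (nfloor_ex (Re d) (Rlt_le _ _ hd)) as [n [_ hn]]. rewrite <- S_INR in hn.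
  assert (hS : 0 < INR (S n)) by (apply lt_0_INR; lia).
  set (c := Cmult (RtoC (/ INR (S n))) d).
  assert (hc : Re c = Re d / INR (S n)).
  { unfold c. rewrite Re_scal_real. unfold Rdiv. ring. }
  assert (hc' : 0 < Re c < 1).
  { rewrite hc. split; [apply Rdiv_lt_0_compat; auto|]. apply Rlt_div_l; lra. }
  assert (hcd : d = Cmult (RtoC (INR (S n))) c).
  { unfold c. rewrite Cmult_assoc, <- RtoC_mult, Rinv_r by lra. ring. }
  destruct (ratio_small c hc') as [C [hC hY]].
  exists (C ^ S n). split; [apply pow_R1_Rle; auto|]. intros t u ht hu.
  destruct (hY t u ht hu) as [Y [h1 [h2 h3]]].
  exists (Y ^ S n)%op. split; [|split].
  - unfold is_ratio in *. rewrite hcd, !J_mult_nat by (auto; lra). now rewrite <- Opow_mul, h1.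
  - intros h. apply obnd_pow; auto.
  - intros h. eapply bnd_le; [apply obnd_pow, h3; auto|].
    rewrite Rpow_mult_distr, Rpower_nat_pow, hc. right. f_equal. f_equal. field. lra.
Qed.

(** The bounded operator [(t + A)^d (u + A)^(-d)], for [0 < Re d]. *)
Definition Y (d : C) (t u : R) : Op := epsilon (inhabits Ozero) (is_ratio d t u).

Lemma Y_spec d t u : 0 < Re d -> 0 <= t -> 0 <= u -> (J d t * Y d t u = J d u)%op.
Proof.
  intros hd ht hu. destruct (ratio_exists d hd) as [C [_ h]].
  destruct (h t u ht hu) as [y [hy _]]. unfold Y.
  apply (epsilon_spec (inhabits Ozero) (is_ratio d t u)). now exists y.
Qed.

Lemma Y_unique d t u y : 0 < Re d -> 0 <= t -> 0 <= u -> (J d t * y = J d u)%op -> y = Y d t u.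
Proof. intros hd ht hu hy. apply (J_reg X D d t); auto. now rewrite hy, Y_spec. Qed.

Lemma Y_bound d : 0 < Re d -> exists C, 1 <= C /\ forall t u, 0 <= t -> 0 <= u ->
  (t <= u -> bnd (Y d t u) C) /\ (0 < u <= t -> bnd (Y d t u) (C * Rpower (t / u) (Re d))).
Proof.
  intros hd. destruct (ratio_exists d hd) as [C [hC h]]. exists C. split; auto.
  intros t u ht hu. destruct (h t u ht hu) as [y [hy hb]].
  now rewrite <- (Y_unique d t u y).
Qed.

Lemma Y_trans d t u v : 0 < Re d -> 0 <= t -> 0 <= u -> 0 <= v ->
  (Y d t u * Y d u v)%op = Y d t v.
Proof.
  intros hd ht hu hv. apply Y_unique; auto.
  transitivity (J d t * Y d t u * Y d u v)%op; [ring|]. now rewrite !Y_spec.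
Qed.

Lemma Y_refl d t : 0 < Re d -> 0 <= t -> Y d t t = 1%op.
Proof. intros hd ht. symmetry. apply Y_unique; auto. ring. Qed.

Lemma Y_plus c d t u : 0 < Re c -> 0 < Re d -> 0 <= t -> 0 <= u ->
  Y (Cplus c d) t u = (Y c t u * Y d t u)%op.
Proof.
  intros hc hd ht hu. symmetry. apply Y_unique; auto.
  - rewrite Re_plus. lra.
  - rewrite !J_plus by auto.
    transitivity (J c t * Y c t u * (J d t * Y d t u))%op; [ring|]. now rewrite !Y_spec.
Qed.

Lemma Y_1 t u : 0 <= t -> 0 <= u -> Y (RtoC 1) t u = (1 - sc (RtoC (u - t)) * r u)%op.
Proof.
  intros ht hu. symmetry. apply Y_unique; auto.
  - rewrite Re_R. lra.
  - change (RtoC 1) with (RtoC (INR 1)). rewrite !J_nat by (auto; lia). cbn [Opow].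
    transitivity (r t - sc (RtoC (u - t)) * r t * r u)%op; [ring|].
    rewrite <- Or_resolvent by auto. ring.
Qed.

Lemma Or_Y1 t u : 0 <= t -> 0 <= u -> (r t * Y (RtoC 1) t u = r u)%op.
Proof.
  intros ht hu. rewrite Y_1 by auto. apply Osub_eq.
  transitivity (r t - r u - sc (RtoC (u - t)) * r t * r u)%op; [ring|].
  rewrite Or_resolvent by auto. ring.
Qed.

Lemma Y1_double u : 0 <= u -> (1 - Y (RtoC 1) u (2 * u)%R = sc (RtoC u) * r u * Y (RtoC 1) u (2 * u)%R)%op.
Proof.
  intros hu. transitivity (sc (RtoC u) * (r u * Y (RtoC 1) u (2 * u)%R))%op; [|ring].
  rewrite Or_Y1, Y_1 by lra. replace (2 * u - u) with u by ring. ring.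
Qed.

(** [2 (u + A) R_(2u) - 1 = A (2u + A)^(-1) = A R_u * (u + A) R_(2u)]. *)
Lemma Y1_double_scaled u : 0 <= u ->
  (sc (RtoC 2) * Y (RtoC 1) u (2 * u)%R - 1 = (1 - sc (RtoC u) * r u) * Y (RtoC 1) u (2 * u)%R)%op.
Proof.
  intros hu. replace (sc (RtoC 2)) with (1 + 1 : Op)%op.
  - apply Osub_eq. set (y := Y (RtoC 1) u (2 * u)).
    transitivity (sc (RtoC u) * r u * y - (1 - y))%op; [ring|].
    unfold y. rewrite <- Y1_double by auto. ring.
  - replace 2 with (1 + 1) by ring. rewrite RtoC_plus. symmetry. apply Osc_plus.
Qed.

End Comparison.

(** * Sequence quasi-norms *)

Lemma nnpow_0 q : nnpow 0 q = 0.
Proof. unfold nnpow. destruct (Req_EM_T 0 0); lra. Qed.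

Lemma nnpow_pos t q : 0 < t -> nnpow t q = Rpower t q.
Proof. intros h. unfold nnpow. destruct (Req_EM_T t 0); lra. Qed.

Lemma nnpow_ge_0 t q : 0 <= nnpow t q.
Proof. unfold nnpow. destruct (Req_EM_T t 0); [lra|apply Rlt_le, Rpower_pos]. Qed.

Lemma nnpow_le a c q : 0 < q -> 0 <= a <= c -> nnpow a q <= nnpow c q.
Proof.
  intros hq [[ha|ha] hac].
  - rewrite !nnpow_pos by lra. apply Rle_Rpower_l; lra.
  - subst a. rewrite nnpow_0. apply nnpow_ge_0.
Qed.

Lemma nnpow_mult a c q : 0 <= a -> 0 <= c -> nnpow (a * c) q = nnpow a q * nnpow c q.
Proof.
  intros [ha|ha] [hc|hc]; subst; rewrite ?Rmult_0_l, ?Rmult_0_r, ?nnpow_0; try ring.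
  rewrite !nnpow_pos by nra. symmetry. now apply Rpower_mult_distr.
Qed.

Lemma nnpow_nnpow a p q : 0 <= a -> p * q = 1 -> nnpow (nnpow a p) q = a.
Proof.
  intros [ha|ha] hpq.
  - rewrite (nnpow_pos a) by auto. rewrite nnpow_pos by apply Rpower_pos.
    rewrite Rpower_mult, hpq. now apply Rpower_1.
  - subst a. now rewrite !nnpow_0.
Qed.

Lemma nnpow_root a q : 0 < q -> 0 <= a -> nnpow (nnpow a q) (/ q) = a.
Proof. intros hq ha. apply nnpow_nnpow; auto. field; lra. Qed.

Lemma nnpow_root' a q : 0 < q -> 0 <= a -> nnpow (nnpow a (/ q)) q = a.
Proof. intros hq ha. apply nnpow_nnpow; auto. field; lra. Qed.

Lemma nnpow_plus a c q : 0 < q -> 0 <= a -> 0 <= c ->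
  nnpow (a + c) q <= nnpow 2 q * (nnpow a q + nnpow c q).
Proof.
  intros hq ha hc.
  assert (h : nnpow (a + c) q <= nnpow 2 q * nnpow (Rmax a c) q).
  { rewrite <- nnpow_mult; [|lra|].
    - apply nnpow_le; auto. generalize (Rmax_l a c) (Rmax_r a c). lra.
    - generalize (Rmax_l a c). lra. }
  eapply Rle_trans; [exact h|]. apply Rmult_le_compat_l; [apply nnpow_ge_0|].
  generalize (nnpow_ge_0 a q) (nnpow_ge_0 c q).
  destruct (Rmax_case a c (fun m => m = a \/ m = c)) as [e|e]; auto; rewrite ?e; try lra.
Qed.

Lemma sum_n_nonneg (f : nat -> R) n : (forall j, 0 <= f j) -> 0 <= sum_n f n.
Proof.
  intros h. induction n.
  - now rewrite sum_O.
  - rewrite sum_Sn. apply Rplus_le_le_0_compat; auto.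
Qed.

Lemma sum_n_le_compat (f g : nat -> R) n : (forall j, f j <= g j) -> sum_n f n <= sum_n g n.
Proof.
  intros h. induction n.
  - now rewrite !sum_O.
  - rewrite !sum_Sn. apply Rplus_le_compat; auto.
Qed.

Lemma sum_n_le_upto (f g : nat -> R) n : (forall j, (j <= n)%nat -> f j <= g j) -> sum_n f n <= sum_n g n.
Proof.
  intros h. induction n.
  - rewrite !sum_O. auto.
  - rewrite !sum_Sn. apply Rplus_le_compat; auto.
Qed.

Lemma sum_n_term_le (f : nat -> R) n j : (forall j, 0 <= f j) -> (j <= n)%nat -> f j <= sum_n f n.
Proof.
  intros h hj. induction n.
  - rewrite sum_O. replace j with 0%nat by lia. lra.
  - rewrite sum_Sn. unfold plus; simpl. destruct (Nat.eq_dec j (S n)) as [e|e].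
    + subst j. generalize (sum_n_nonneg f n h). lra.
    + generalize (IHn ltac:(lia)) (h (S n)). lra.
Qed.

Lemma sum_n_mono (f : nat -> R) n m : (forall j, 0 <= f j) -> (n <= m)%nat -> sum_n f n <= sum_n f m.
Proof.
  intros h hnm. induction hnm; [lra|]. rewrite sum_Sn. unfold plus; simpl.
  generalize (h (S m)). lra.
Qed.

Lemma sum_n_scal_r (f : nat -> R) c n : sum_n (fun j => f j * c) n = sum_n f n * c.
Proof.
  induction n.
  - now rewrite !sum_O.
  - rewrite !sum_Sn, IHn. unfold plus; simpl. ring.
Qed.

Lemma sum_n_scal_l' (f : nat -> R) c n : sum_n (fun j => c * f j) n = c * sum_n f n.
Proof.
  induction n.
  - now rewrite !sum_O.
  - rewrite !sum_Sn, IHn. unfold plus; simpl. ring.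
Qed.

(** [lq_norm q a <= M], free of limits. *)
Definition lq_le (q : Rbar) (a : nat -> R) (M : R) : Prop :=
  match q with
  | Finite r => forall n, sum_n (fun j => nnpow (a j) r) n <= nnpow M r
  | _ => forall j, a j <= M
  end.

Section LqNorm.

Variable q : Rbar.
Hypothesis hq : Rbar_lt (Finite 0) q.

Lemma lq_norm_le (a : nat -> R) M : (forall j, 0 <= a j) -> 0 <= M -> lq_le q a M ->
  Rbar_lt (lq_norm q a) p_infty /\ 0 <= real (lq_norm q a) <= M.
Proof.
  intros ha hM h. destruct q as [r| |]; simpl in *.
  - set (S := sum_n (fun j => nnpow (a j) r)) in *.
    assert (h1 : Rbar_le (Lim_seq S) (nnpow M r)).
    { rewrite <- (Lim_seq_const (nnpow M r)). apply Lim_seq_le_loc. exists 0%nat. intros n _. apply h. }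
    assert (h0 : Rbar_le 0 (Lim_seq S)).
    { rewrite <- (Lim_seq_const 0). apply Lim_seq_le_loc. exists 0%nat. intros n _.
      apply sum_n_nonneg. intros; apply nnpow_ge_0. }
    destruct (Lim_seq S) as [v| |]; simpl in *; try tauto.
    split; auto. split; [apply nnpow_ge_0|].
    rewrite <- (nnpow_root M r) by auto. apply nnpow_le; [now apply Rinv_0_lt_compat|lra].
  - assert (h1 : Rbar_le (Sup_seq (fun j => a j)) M).
    { apply Rbar_not_lt_le. intros hlt. apply Sup_seq_minor_lt in hlt. destruct hlt as [n hn].
      simpl in hn. generalize (h n). lra. }
    assert (h0 : Rbar_le 0 (Sup_seq (fun j => a j))).
    { apply Rbar_le_trans with (a 0%nat); [apply (ha 0%nat)|]. apply (Sup_seq_minor_le (fun j => a j) (a 0%nat) 0%nat). apply Rbar_le_refl. }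
    destruct (Sup_seq (fun j => a j)); simpl in *; try tauto.
  - tauto.
Qed.

Lemma lq_norm_finite (a : nat -> R) : (forall j, 0 <= a j) -> Rbar_lt (lq_norm q a) p_infty ->
  0 <= real (lq_norm q a) /\ lq_le q a (real (lq_norm q a)).
Proof.
  intros ha h. destruct q as [r| |]; simpl in *.
  - set (S := sum_n (fun j => nnpow (a j) r)) in *.
    assert (hinc : forall n, S n <= S (Datatypes.S n)).
    { intros n. apply sum_n_mono; auto. intros; apply nnpow_ge_0. }
    assert (h0 : Rbar_le 0 (Lim_seq S)).
    { rewrite <- (Lim_seq_const 0). apply Lim_seq_le_loc. exists 0%nat. intros n _.
      apply sum_n_nonneg. intros; apply nnpow_ge_0. }
    assert (hl := Lim_seq_correct S (ex_lim_seq_incr S hinc)).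
    destruct (Lim_seq S) as [v| |]; simpl in *; try tauto.
    split; [apply nnpow_ge_0|]. intros n. rewrite nnpow_root' by auto.
    apply (is_lim_seq_incr_compare S v); auto.
  - assert (hub : forall j, Rbar_le (a j) (Sup_seq (fun j => a j))).
    { intros j. apply (Sup_seq_minor_le (fun j => a j) (a j) j). apply Rbar_le_refl. }
    destruct (Sup_seq (fun j => a j)) as [v| |]; simpl in *; try tauto.
    + split; [|exact hub]. eapply Rle_trans; [apply (ha 0%nat)|apply (hub 0%nat)].
    + exfalso; apply (hub 0%nat).
  - tauto.
Qed.

Lemma lq_le_term (a : nat -> R) M j : (forall j, 0 <= a j) -> 0 <= M -> lq_le q a M -> a j <= M.
Proof.
  intros ha hM h. destruct q as [r| |]; simpl in *; [|apply h|tauto].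
  rewrite <- (nnpow_root M r), <- (nnpow_root (a j) r) by auto.
  apply nnpow_le; [now apply Rinv_0_lt_compat|]. split; [apply nnpow_ge_0|].
  eapply Rle_trans; [|apply (h j)].
  apply (sum_n_term_le (fun j => nnpow (a j) r)); auto. intros; apply nnpow_ge_0.
Qed.

Lemma lq_le_scal (a a' : nat -> R) c M : 0 <= c -> 0 <= M -> (forall j, 0 <= a j <= c * a' j) ->
  (forall j, 0 <= a' j) -> lq_le q a' M -> lq_le q a (c * M).
Proof.
  intros hc hM h h' hl. destruct q as [r| |]; simpl in *; [| |tauto].
  - intros n. rewrite nnpow_mult by auto.
    apply Rle_trans with (sum_n (fun j => nnpow c r * nnpow (a' j) r) n).
    + apply sum_n_le_compat. intros j. rewrite <- nnpow_mult by auto. apply nnpow_le; auto.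
    + rewrite sum_n_scal_l'. apply Rmult_le_compat_l; [apply nnpow_ge_0|auto].
  - intros j. apply Rle_trans with (c * a' j); [apply h|]. apply Rmult_le_compat_l; auto.
Qed.

Lemma lq_le_plus : exists K, 0 <= K /\ forall (a a' : nat -> R) M M',
  (forall j, 0 <= a j) -> (forall j, 0 <= a' j) -> 0 <= M -> 0 <= M' ->
  lq_le q a M -> lq_le q a' M' -> lq_le q (fun j => a j + a' j) (K * (M + M')).
Proof.
  destruct q as [r| |]; simpl in *; [| |tauto].
  - exists (2 * nnpow 2 (/ r)). split; [generalize (nnpow_ge_0 2 (/ r)); lra|].
    intros a a' M M' ha ha' hM hM' h h' n.
    apply Rle_trans with (sum_n (fun j => nnpow 2 r * (nnpow (a j) r + nnpow (a' j) r)) n).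
    { apply sum_n_le_compat. intros j. now apply nnpow_plus. }
    rewrite sum_n_scal_l'.
    replace (sum_n (fun j => nnpow (a j) r + nnpow (a' j) r) n) with
      (sum_n (fun j => nnpow (a j) r) n + sum_n (fun j => nnpow (a' j) r) n).
    2:{ symmetry. apply (sum_n_plus (fun j => nnpow (a j) r) (fun j => nnpow (a' j) r)). }
    rewrite !nnpow_mult by (try apply nnpow_ge_0; try lra; generalize (nnpow_ge_0 2 (/ r)); lra).
    rewrite nnpow_root' by lra. rewrite Rmult_assoc. apply Rmult_le_compat_l; [apply nnpow_ge_0|].
    assert (nnpow M r <= nnpow (M + M') r) by (apply nnpow_le; lra).
    assert (nnpow M' r <= nnpow (M + M') r) by (apply nnpow_le; lra).
    generalize (h n) (h' n). lra.
  - exists 1. split; [lra|]. intros. rewrite Rmult_1_l. apply Rplus_le_compat; auto.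
Qed.

(** ** Discrete convolution with a geometric kernel *)

Definition ndist (i j : nat) : nat := (i - j + (j - i))%nat.

Lemma geometric_row (s : R) i n : 0 < s < 1 -> sum_n (fun j => s ^ ndist i j) n <= 2 / (1 - s).
Proof.
  intros hs.
  assert (h1 : forall n, (n <= i)%nat -> sum_n (fun j => s ^ ndist i j) n <= s ^ (i - n) / (1 - s)).
  { intros m. induction m as [|m IH]; intros hm.
    - rewrite sum_O. unfold ndist. rewrite Nat.sub_0_r. simpl. rewrite Nat.add_0_r.
      apply Rle_div_r; [lra|]. assert (0 < s ^ i) by (apply pow_lt; lra). nra.
    - rewrite sum_Sn. unfold plus; simpl. specialize (IH ltac:(lia)).
      unfold ndist at 2. replace (i - S m + (S m - i))%nat with (i - S m)%nat by lia.
      replace (i - m)%nat with (S (i - S m)) in IH by lia.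
      apply Rle_trans with (s ^ S (i - S m) / (1 - s) + s ^ (i - S m)); [lra|].
      right. simpl. field. lra. }
  assert (h2 : forall k, sum_n (fun j => s ^ ndist i j) (i + k) <= (2 - s ^ k) / (1 - s)).
  { intros k. induction k as [|k IH].
    - rewrite Nat.add_0_r. eapply Rle_trans; [apply h1; lia|]. rewrite Nat.sub_diag. simpl.
      right. field. lra.
    - rewrite Nat.add_succ_r, sum_Sn. unfold plus; simpl.
      unfold ndist at 2. replace (i - S (i + k) + (S (i + k) - i))%nat with (S k) by lia.
      apply Rle_trans with ((2 - s ^ k) / (1 - s) + s ^ S k); [apply Rplus_le_compat_r; exact IH|].
      apply Rle_div_r; [lra|]. 
      replace (((2 - s ^ k) / (1 - s) + s ^ S k) * (1 - s)) with (2 - s ^ k + s ^ S k * (1 - s)) by (field; lra).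
      assert (h0 : 0 < s ^ k) by (apply pow_lt; lra). simpl.
      assert (0 <= s ^ k * ((1 - s) * (1 - s))) by (apply Rmult_le_pos; nra). nra. }
  destruct (Nat.le_gt_cases n i) as [h|h].
  - eapply Rle_trans; [apply h1; auto|]. apply Rmult_le_compat_r; [apply Rlt_le, Rinv_0_lt_compat; lra|].
    assert (s ^ (i - n) <= 1 ^ (i - n)) by (apply pow_incr; lra). rewrite pow1 in H. lra.
  - replace n with (i + (n - i))%nat by lia. eapply Rle_trans; [apply h2|].
    apply Rmult_le_compat_r; [apply Rlt_le, Rinv_0_lt_compat; lra|].
    assert (0 < s ^ (n - i)) by (apply pow_lt; lra). lra.
Qed.

Lemma ndist_comm i j : ndist i j = ndist j i.
Proof. unfold ndist. lia. Qed.

(** [sum u v <= (sum u) (sup v)], and the supremum is at most the [l^r] quasi-norm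
    for every [r > 0]. *)
Lemma nnpow_sum_mult (u v : nat -> R) r n : 0 < r -> (forall j, 0 <= u j) -> (forall j, 0 <= v j) ->
  nnpow (sum_n (fun j => u j * v j) n) r <= nnpow (sum_n u n) r * sum_n (fun j => nnpow (v j) r) n.
Proof.
  intros hr hu hv. set (V := sum_n (fun j => nnpow (v j) r) n).
  assert (hV : 0 <= V) by (apply sum_n_nonneg; intros; apply nnpow_ge_0).
  rewrite <- (nnpow_root' V r) by auto.
  rewrite <- nnpow_mult; [|now apply sum_n_nonneg|apply nnpow_ge_0].
  apply nnpow_le; auto. split.
  - apply sum_n_nonneg. intros; now apply Rmult_le_pos.
  - rewrite <- sum_n_scal_r.
    assert (hj : forall j, (j <= n)%nat -> v j <= nnpow V (/ r)).
    { intros j hj. rewrite <- (nnpow_root (v j) r) by auto.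
      apply nnpow_le; [now apply Rinv_0_lt_compat|]. split; [apply nnpow_ge_0|].
      apply (sum_n_term_le (fun j => nnpow (v j) r)); auto. intros; apply nnpow_ge_0. }
    apply sum_n_le_upto. intros j hjn. apply Rmult_le_compat_l; auto.
Qed.

Lemma sum_n_const_R (c : R) n : sum_n (fun _ => c) n = INR (S n) * c.
Proof.
  induction n.
  - rewrite sum_O. simpl. ring.
  - rewrite sum_Sn, IHn, (S_INR (S n)). unfold plus; simpl. ring.
Qed.

Lemma common_index (P : nat -> nat -> Prop) n :
  (forall i, exists N, forall N', (N <= N')%nat -> P i N') ->
  exists N, forall i, (i <= n)%nat -> P i N.
Proof.
  intros h. assert (h' : exists N, forall N', (N <= N')%nat -> forall i, (i <= n)%nat -> P i N').
  { induction n as [|n [N IH]].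
    - destruct (h 0%nat) as [N hN]. exists N. intros N' hN' i hi. replace i with 0%nat by lia. auto.
    - destruct (h (S n)) as [N2 hN2]. exists (Nat.max N N2). intros N' hN' i hi.
      destruct (Nat.eq_dec i (S n)) as [e|e].
      + subst i. apply hN2. lia.
      + apply IH; lia. }
  destruct h' as [N hN]. exists N. auto.
Qed.

(** The kernel [rho^|i-j|] is the product of [s^|i-j|] with itself, [s = sqrt rho].
    One factor is summed, the other stays with [psi] under a supremum, which
    commutes with the power [q] ([nnpow_sum_mult]); this treats [q < 1] and
    [q >= 1] alike. *)
Lemma lq_conv (rho C : R) : 0 < rho < 1 -> 0 <= C -> exists C', 0 <= C' /\
  forall phi psi : nat -> R, (forall j, 0 <= phi j) -> (forall j, 0 <= psi j) ->
  (forall i e, 0 < e -> exists N, phi i <= C * sum_n (fun j => rho ^ ndist i j * psi j) N + e) ->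
  forall M, 0 <= M -> lq_le q psi M -> lq_le q phi (C' * M).
Proof.
  intros hrho hC.
  destruct q as [r| |]; simpl in *; [| |tauto].
  - set (s := sqrt rho). 
    assert (hs2 : s * s = rho) by (apply sqrt_def; lra).
    assert (hs0 : 0 < s) by (apply sqrt_lt_R0; lra).
    assert (hs : 0 < s < 1) by (split; auto; nra).
    set (t := nnpow s r).
    assert (ht : 0 < t < 1).
    { unfold t. rewrite nnpow_pos by auto. split; [apply Rpower_pos|].
      unfold Rpower. rewrite <- exp_0. apply exp_increasing.
      assert (ln s < 0) by (rewrite <- ln_1; apply ln_increasing; lra). nra. }
    set (G := 2 / (1 - s)). assert (hG : 0 < G) by (apply Rdiv_lt_0_compat; lra).
    set (H := 2 / (1 - t)). assert (hH : 0 < H) by (apply Rdiv_lt_0_compat; lra).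
    exists (2 * (C * G) * nnpow H (/ r)).
    assert (hCG : 0 <= C * G) by nra.
    split. { generalize (nnpow_ge_0 H (/ r)). nra. }
    intros phi psi hphi hpsi hle M hM hl n.
    rewrite !nnpow_mult; try lra; try (apply nnpow_ge_0); [|generalize (nnpow_ge_0 H (/ r)); nra].
    rewrite nnpow_root' by lra.
    apply le_epsilon. intros d hd.
    assert (h2 : 0 < nnpow 2 r) by (rewrite nnpow_pos by lra; apply Rpower_pos).
    assert (hn : 0 < INR (S n)) by (apply lt_0_INR; lia).
    (* the error allowed for each of the first [n + 1] terms, after the power [r] *)
    set (e0 := d / (nnpow 2 r * INR (S n))).
    assert (he0 : 0 < e0) by (apply Rdiv_lt_0_compat; auto; nra).
    set (e := nnpow e0 (/ r)).
    assert (he : 0 < e) by (unfold e; rewrite nnpow_pos by auto; apply Rpower_pos).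
    assert (hee : nnpow e r = e0) by (unfold e; apply nnpow_root'; lra).
    assert (hpos : forall i j, 0 <= rho ^ ndist i j * psi j).
    { intros. apply Rmult_le_pos; auto. apply pow_le; lra. }
    destruct (common_index (fun i N => phi i <= C * sum_n (fun j => rho ^ ndist i j * psi j) N + e) n) as [N hN].
    { intros i. destruct (hle i e he) as [N hN]. exists N. intros N' hN'.
      eapply Rle_trans; [exact hN|]. apply Rplus_le_compat_r, Rmult_le_compat_l; auto.
      apply sum_n_mono; auto. }
    assert (hi : forall i, (i <= n)%nat -> nnpow (phi i) r <=
       nnpow 2 r * (nnpow (C * G) r * sum_n (fun j => t ^ ndist i j * nnpow (psi j) r) N + e0)).
    { intros i hi. apply Rle_trans with (nnpow (C * sum_n (fun j => rho ^ ndist i j * psi j) N + e) r).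
      { apply nnpow_le; auto. }
      assert (hs1 : 0 <= sum_n (fun j => rho ^ ndist i j * psi j) N) by (apply sum_n_nonneg; auto).
      eapply Rle_trans; [apply nnpow_plus; auto; [nra|lra]|]. rewrite hee.
      apply Rmult_le_compat_l; [lra|]. apply Rplus_le_compat_r.
      rewrite (nnpow_mult C), (nnpow_mult C) by lra. rewrite Rmult_assoc.
      apply Rmult_le_compat_l; [apply nnpow_ge_0|].
      replace (sum_n (fun j => rho ^ ndist i j * psi j) N) with
        (sum_n (fun j => s ^ ndist i j * (s ^ ndist i j * psi j)) N).
      2:{ apply sum_n_ext. intros j. match goal with |- ?a = ?c => change (@eq R a c) end.
          rewrite <- hs2, Rpow_mult_distr. ring. }
      assert (hsp : forall j, 0 <= s ^ ndist i j) by (intros; apply pow_le; lra).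
      eapply Rle_trans.
      - apply (nnpow_sum_mult (fun j => s ^ ndist i j) (fun j => s ^ ndist i j * psi j)); auto.
        intros; apply Rmult_le_pos; auto.
      - apply Rmult_le_compat; [apply nnpow_ge_0|apply sum_n_nonneg; intros; apply nnpow_ge_0| |].
        + apply nnpow_le; auto. split; [now apply sum_n_nonneg|]. now apply geometric_row.
        + right. apply sum_n_ext. intros j. match goal with |- ?a = ?c => change (@eq R a c) end.
          rewrite nnpow_mult by auto. f_equal.
          unfold t. rewrite !nnpow_pos; auto; [|apply pow_lt; lra].
          rewrite <- Rpower_pow, Rpower_mult by lra.
          rewrite <- (Rpower_pow _ (Rpower s r)), Rpower_mult by apply Rpower_pos.
          f_equal. ring. }
    eapply Rle_trans; [apply sum_n_le_upto, hi|].
    rewrite sum_n_scal_l'.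
    replace (sum_n (fun j => nnpow (C * G) r * sum_n (fun j0 => t ^ ndist j j0 * nnpow (psi j0) r) N + e0) n)
     with (nnpow (C * G) r * sum_n (fun i => sum_n (fun j => t ^ ndist i j * nnpow (psi j) r) N) n + INR (S n) * e0).
    2:{ rewrite <- sum_n_scal_l', <- sum_n_const_R.
        symmetry. apply (sum_n_plus (fun i => nnpow (C * G) r * sum_n (fun j0 => t ^ ndist i j0 * nnpow (psi j0) r) N) (fun _ => e0)). }
    assert (hsw : sum_n (fun i => sum_n (fun j => t ^ ndist i j * nnpow (psi j) r) N) n <= H * nnpow M r).
    { rewrite sum_n_switch.
      apply Rle_trans with (sum_n (fun j => H * nnpow (psi j) r) N).
      - apply sum_n_le_compat. intros j. rewrite (sum_n_scal_r (fun i => t ^ ndist i j)).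
        apply Rmult_le_compat_r; [apply nnpow_ge_0|].
        rewrite (sum_n_ext _ (fun i => t ^ ndist j i)); [now apply geometric_row|].
        intros i. now rewrite ndist_comm.
      - rewrite sum_n_scal_l'. apply Rmult_le_compat_l; [lra|]. apply hl. }
    replace (nnpow C r * nnpow G r) with (nnpow (C * G) r) by (apply nnpow_mult; lra).
    assert (hcg := nnpow_ge_0 (C * G) r).
    assert (hd2 : nnpow 2 r * (INR (S n) * e0) = d).
    { unfold e0. field. lra. }
    rewrite Rmult_plus_distr_l, hd2. apply Rplus_le_compat_r.
    rewrite !Rmult_assoc. apply Rmult_le_compat_l; [lra|]. apply Rmult_le_compat_l; auto.
  - exists (C * (2 / (1 - rho))). 
    assert (hG : 0 < 2 / (1 - rho)) by (apply Rdiv_lt_0_compat; lra).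
    split; [nra|]. intros phi psi hphi hpsi hle M hM hl i.
    apply le_epsilon. intros e he. destruct (hle i e he) as [N hN].
    eapply Rle_trans; [exact hN|]. apply Rplus_le_compat_r. rewrite Rmult_assoc.
    apply Rmult_le_compat_l; auto.
    apply Rle_trans with (sum_n (fun j => rho ^ ndist i j * M) N).
    + apply sum_n_le_compat. intros j. apply Rmult_le_compat_l; auto. apply pow_le; lra.
    + rewrite (sum_n_scal_r (fun j => rho ^ ndist i j)). apply Rmult_le_compat_r; auto. now apply geometric_row.
Qed.

End LqNorm.

(** * The operators [A^c (t + A)^(-a-c)] *)

Lemma minus_plus_cancel (G : AbelianGroup) (x y : G) : plus (minus x y) y = x.
Proof. unfold minus. now rewrite <- plus_assoc, plus_opp_l, plus_zero_r. Qed.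

Section BesovOperators.

Variable X : CompleteNormedModule C_AbsRing.
Variable D : resolvents X.
Notation Op := (Op X D).
Notation r := (@Or X D).
Notation b := (@Ob X D).
Notation sc := (@Osc X D).
Notation J := (J X D).
Notation Y := (Y X D).

Add Ring OpRing10 : (Op_ring_theory X D).

Definition Jz (a : C) (t : R) : Op := if Ceq_dec a (RtoC 0) then Oone else J a t.

Lemma Jz_0 t : Jz (RtoC 0) t = 1%op.
Proof. unfold Jz. destruct (Ceq_dec (RtoC 0) (RtoC 0)); tauto. Qed.

Lemma Jz_pos a t : 0 < Re a -> Jz a t = J a t.
Proof.
  intros ha. unfold Jz. destruct (Ceq_dec a (RtoC 0)) as [e|e]; auto.
  exfalso. now apply (Re_gt_neq_0 a).
Qed.

Lemma star_plus a c : Cplus_star a -> Cplus_star c -> Cplus_star (Cplus a c).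
Proof.
  intros [ha|ha] [hc|hc]; subst.
  - left. rewrite Re_plus. lra.
  - left. rewrite Cplus_0_r. auto.
  - left. rewrite Cplus_0_l. auto.
  - right. ring.
Qed.

Lemma star_ge_0 a : Cplus_star a -> 0 <= Re a.
Proof. intros [h|h]; [lra|]. subst. rewrite Re_R. lra. Qed.

Lemma Jz_plus a c t : Cplus_star a -> Cplus_star c -> 0 <= t ->
  Jz (Cplus a c) t = (Jz a t * Jz c t)%op.
Proof.
  intros [ha|ha] [hc|hc] ht; subst.
  - rewrite !Jz_pos by (rewrite ?Re_plus; lra). now apply J_plus.
  - rewrite Cplus_0_r, Jz_0. ring.
  - rewrite Cplus_0_l, Jz_0. ring.
  - rewrite Cplus_0_l, Jz_0. ring.
Qed.

Lemma J_Jz c a t : 0 < Re c -> Cplus_star a -> 0 <= t ->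
  (J c t * Jz a t = J (Cplus c a) t)%op.
Proof.
  intros hc ha ht. rewrite <- (Jz_pos c), <- Jz_plus, Jz_pos; auto.
  - rewrite Re_plus. generalize (star_ge_0 a ha). lra.
  - now left.
Qed.

(** The operator [A^c (t + A)^(-c)]. *)
Definition W (c : C) (t : R) : Op := Y c 0 t.

Lemma W_eq c t : W c t = Y c 0 t.
Proof. reflexivity. Qed.

Lemma W_spec c t : 0 < Re c -> 0 <= t -> (J c 0 * W c t = J c t)%op.
Proof. intros hc ht. apply Y_spec; lra. Qed.

Lemma W_plus c d t : 0 < Re c -> 0 < Re d -> 0 <= t -> W (Cplus c d) t = (W c t * W d t)%op.
Proof. intros hc hd ht. unfold W. apply Y_plus; auto; lra. Qed.

Lemma W_1 t : 0 <= t -> W (RtoC 1) t = (1 - sc (RtoC t) * r t)%op.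
Proof. intros ht. unfold W. rewrite Y_1 by lra. now rewrite Rminus_0_r. Qed.

Lemma W_bound c : 0 < Re c -> exists K, 1 <= K /\ forall t, 0 <= t -> bnd (W c t) K.
Proof.
  intros hc. destruct (Y_bound X D c hc) as [K [hK h]]. exists K. split; auto.
  intros t ht. apply h; lra.
Qed.

(** The operator [A^c (t + A)^(-a-c)]. *)
Definition besov_op (a c : C) (t : R) : Op := (W c t * Jz a t)%op.

Lemma besov_op_eq a c t : besov_op a c t = (W c t * Jz a t)%op.
Proof. reflexivity. Qed.

Lemma besov_op_spec a c t : Cplus_star a -> 0 < Re c -> 0 <= t ->
  (J c 0 * besov_op a c t = J (Cplus c a) t)%op.
Proof.
  intros ha hc ht. unfold besov_op.
  transitivity (J c 0%R * W c t * Jz a t)%op; [ring|]. rewrite W_spec by auto. now apply J_Jz.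
Qed.

Lemma besov_op_up a c e d t : Cplus_star a -> 0 < Re c -> 0 < Re e -> 0 < Re d -> 0 <= t ->
  besov_op (Cplus a e) (Cplus c d) t = (W d t * J e t * besov_op a c t)%op.
Proof.
  intros ha hc he hd ht. unfold besov_op. rewrite W_plus, Jz_plus, (Jz_pos e); auto; [ring|now left].
Qed.

Lemma besov_op_succ_c a c t : 0 < Re c -> 0 <= t ->
  besov_op a (Cplus c (RtoC 1)) t = ((1 - sc (RtoC t) * r t) * besov_op a c t)%op.
Proof.
  intros hc ht. unfold besov_op. rewrite W_plus, W_1; auto; [ring|rewrite Re_R; lra].
Qed.

Lemma besov_op_succ_a a c t : Cplus_star a -> 0 <= t ->
  besov_op (Cplus a (RtoC 1)) c t = (r t * besov_op a c t)%op.
Proof.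
  intros ha ht. unfold besov_op. rewrite Jz_plus; auto; [|left; rewrite Re_R; lra].
  rewrite (Jz_pos (RtoC 1)) by (rewrite Re_R; lra).
  change (RtoC 1) with (RtoC (INR 1)). rewrite J_nat by (auto; lia). cbn [Opow]. ring.
Qed.

(** [1 + y + ... + y^(n-1)]. *)
Fixpoint Ogeom (y : Op) (n : nat) : Op :=
  match n with O => Ozero | S m => (1 + y * Ogeom y m)%op end.

Lemma Ogeom_spec y n : ((1 - y) * Ogeom y n = 1 - y ^ n)%op.
Proof.
  induction n as [|n IH]; cbn [Ogeom Opow]; [ring|].
  transitivity (1 - y + y * ((1 - y) * Ogeom y n))%op; [ring|]. rewrite IH. ring.
Qed.

Lemma Ogeom_bound M n : 0 <= M -> exists G, 0 <= G /\ forall y : Op, bnd y M -> bnd (Ogeom y n) G.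
Proof.
  intros hM. induction n as [|n [G [hG IH]]].
  - exists 0. split; [lra|]. intros y _. apply bnd_zero.
  - exists (1 + M * G). split; [nra|]. intros y hy. cbn [Ogeom].
    apply obnd_add; [apply obnd_1|]. apply obnd_mul; auto.
Qed.

(** The range of [b] is the domain of [A]. *)
Definition dom_closure (x : X) : Prop := forall e, 0 < e -> exists z, norm (minus x (b z)) < e.

Lemma norm_le_minus (x y : X) : norm x <= norm (minus x y) + norm y.
Proof.
  eapply Rle_trans; [|apply xnorm_plus]. right. f_equal. symmetry.
  exact (minus_plus_cancel (CompleteNormedModule.AbelianGroup C_AbsRing X) x y).
Qed.

Lemma op_norm_minus (T : Op) (x y : X) M : bnd T M -> norm (minus (T x) (T y)) <= M * norm (minus x y).
Proof.
  intros h. replace (minus (T x) (T y)) with (T (minus x y)); [apply h|].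
  unfold minus. now rewrite op_lin_plus, op_lin_opp.
Qed.

Lemma dom_closure_op (T : Op) x : dom_closure x -> dom_closure (T x).
Proof.
  intros hx e he. destruct (op_bdd _ _ T) as [M hM]. assert (hM0 : 0 <= M) by apply hM.
  destruct (hx (e / (M + 1))) as [z hz]; [apply Rdiv_lt_0_compat; lra|].
  exists (T z). 
  replace (b (T z)) with (T (b z)) by (exact (f_equal (fun U : Op => U z) (Omul_comm X D T b))).
  eapply Rle_lt_trans; [apply op_norm_minus; exact hM|].
  apply Rle_lt_trans with (M * (e / (M + 1))); [apply Rmult_le_compat_l; lra|].
  apply (Rmult_lt_reg_r (M + 1)); [lra|].
  replace (M * (e / (M + 1)) * (M + 1)) with (M * e) by (field; lra). nra.
Qed.

(** [(t + A) R_u] is bounded for [u >= t] and is [O(1/u)] on [D(A)], hence tends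
    to [0] on its closure. *)
Lemma Y1_vanishes x t e : dom_closure x -> 0 <= t -> 0 < e ->
  exists U, forall u, U <= u -> norm (Y (RtoC 1) t u x) < e.
Proof.
  intros hx ht he.
  destruct (Or_bound X D) as [M [hM [_ hr]]].
  destruct (op_bdd _ _ b) as [N hN]. assert (hN0 : 0 <= N) by apply hN.
  destruct (Y_bound X D (RtoC 1)) as [K [hK hY]]; [rewrite Re_R; lra|].
  destruct (hx (e / (2 * K))) as [z hz]; [apply Rdiv_lt_0_compat; lra|].
  set (P := M * (1 + t * N) * norm z).
  assert (hP : 0 <= P).
  { unfold P. assert (hz0 := xnorm_ge_0 X z). apply Rmult_le_pos; [|lra]. apply Rmult_le_pos; nra. }
  exists (Rmax (1 + t) (2 * P / e + 1)). intros u hu.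
  assert (hu1 : 1 + t <= u) by (eapply Rle_trans; [apply Rmax_l|exact hu]).
  assert (hu2 : 2 * P / e + 1 <= u) by (eapply Rle_trans; [apply Rmax_r|exact hu]).
  eapply Rle_lt_trans; [apply (norm_le_minus _ (Y (RtoC 1) t u (b z)))|].
  assert (h1 : norm (minus (Y (RtoC 1) t u x) (Y (RtoC 1) t u (b z))) < e / 2).
  { eapply Rle_lt_trans; [apply op_norm_minus, (proj1 (hY t u ht ltac:(lra))); lra|].
    apply Rlt_le_trans with (K * (e / (2 * K))); [apply Rmult_lt_compat_l; lra|]. right. field. lra. }
  assert (h2 : norm (Y (RtoC 1) t u (b z)) <= P / u).
  { change (norm ((Y (RtoC 1) t u * b)%op z) <= P / u).
    replace (Y (RtoC 1) t u * b)%op with (r u * (1 + sc (RtoC t) * b))%op.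
    - eapply Rle_trans; [apply (obnd_mul X D _ _ (M / u) (1 + t * N))|].
      + apply hr. lra.
      + apply obnd_add; [apply obnd_1|]. apply obnd_mul; auto. apply obnd_scr; auto.
      + right. unfold P. field. lra.
    - rewrite Y_1 by lra. apply Osub_eq. rewrite RtoC_minus, Osc_minus.
      transitivity (r u + sc (RtoC u) * b * r u - b)%op; [ring|]. rewrite Or_spec by lra. ring. }
  assert (h3 : P / u <= e / 2).
  { apply Rle_div_l; [lra|]. assert (2 * P / e <= u) by lra.
    apply Rle_div_l in H; lra. }
  lra.
Qed.

Lemma op_add_norm (S T : Op) (x : X) : norm ((S + T)%op x) <= norm (S x) + norm (T x).
Proof. apply xnorm_plus. Qed.

Section Scales.

Variable th : R.
Hypothesis hth : 0 < th.

Definition tscale (i : nat) : R := th * 2 ^ i.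

Lemma tscale_pos i : 0 < tscale i.
Proof. apply Rmult_lt_0_compat; auto. apply pow_lt; lra. Qed.

Lemma tscale_S i : tscale (S i) = 2 * tscale i.
Proof. unfold tscale. simpl. ring. Qed.

Lemma tscale_le i j : (i <= j)%nat -> tscale i <= tscale j.
Proof.
  intros h. unfold tscale. apply Rmult_le_compat_l; [lra|]. apply Rle_pow; [lra|auto].
Qed.

Lemma tscale_ge i : th <= tscale i.
Proof. replace th with (tscale 0) by (unfold tscale; simpl; ring). apply tscale_le. lia. Qed.

Lemma tscale_unbounded U : exists m, forall i, (m <= i)%nat -> U <= tscale i.
Proof.
  assert (h : forall k, INR k <= 2 ^ k).
  { intros k. induction k; [simpl; lra|]. rewrite S_INR. simpl.
    assert (1 <= 2 ^ k) by (apply pow_R1_Rle; lra). lra. }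
  destruct (nfloor_ex (Rmax 0 (U / th)) (Rmax_l _ _)) as [m [_ hm]]. exists (S m). intros i hi.
  apply Rle_trans with (tscale (S m)); [|now apply tscale_le].
  assert (h1 : U / th <= INR m + 1) by (eapply Rle_trans; [apply Rmax_r|left; exact hm]).
  assert (h2 := h (S m)). rewrite S_INR in h2. unfold tscale. apply Rle_div_l in h1; auto. nra.
Qed.

Lemma tscale_ratio i k y : Rpower (tscale i / tscale (i + k)) y = (Rpower 2 (- y)) ^ k.
Proof.
  rewrite Rpower_nat_pow. unfold tscale. rewrite pow_add.
  replace (th * 2 ^ i / (th * (2 ^ i * 2 ^ k))) with (/ 2 ^ k).
  - rewrite <- (Rpower_pow k 2), <- Rpower_Ropp, Rpower_mult by lra. f_equal. ring.
  - assert (0 < 2 ^ i) by (apply pow_lt; lra). assert (0 < 2 ^ k) by (apply pow_lt; lra).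
    field. repeat split; lra.
Qed.

(** With [P_u = (t + A) R_u], the difference [(P_u^n - P_(2u)^n) F_(a,c)(t)] has
    the factor [1 - (u + A) R_(2u) = u R_(2u)], which supplies the missing power
    [(u + A)^(-1)]. The integer [n > Re a + Re c] turns the remaining factor
    into the bounded ratio [(t + A)^d (u + A)^(-d)] with [d = n - a - c]. *)
Lemma lower_a_step a c : Cplus_star a -> 0 < Re c -> exists n C, (0 < n)%nat /\ 0 <= C /\
  forall t u x, 0 < t -> t <= u ->
  norm ((Y (RtoC 1) t u ^ n * besov_op a c t)%op x) <=
    C * (u * norm (besov_op (Cplus a (RtoC 1)) c u x)) + norm ((Y (RtoC 1) t (2 * u) ^ n * besov_op a c t)%op x).
Proof.
  intros ha hc.
  set (p := Cplus c a). assert (hp : 0 < Re p) by (unfold p; rewrite Re_plus; generalize (star_ge_0 a ha); lra).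
  destruct (nfloor_ex (Re p) (Rlt_le _ _ hp)) as [n0 [_ hn]]. rewrite <- S_INR in hn.
  set (n := S n0) in *. exists n.
  set (d := Cminus (RtoC (INR n)) p). assert (hd : 0 < Re d) by (unfold d; rewrite Re_minus, Re_R; lra).
  assert (hdp : RtoC (INR n) = Cplus d p) by (unfold d; ring).
  destruct (Y_bound X D d hd) as [K [hK hY]].
  destruct (Y_bound X D (RtoC 1)) as [K1 [hK1 hY1]]; [rewrite Re_R; lra|].
  destruct (Ogeom_bound K1 n ltac:(lra)) as [G [hG hg]].
  exists (K1 * G * K). split; [unfold n; lia|].
  assert (hKG : 0 <= K1 * G * K) by (repeat apply Rmult_le_pos; lra).
  split; auto. intros t u x ht hu.
  set (y := Y (RtoC 1) u (2 * u)).
  assert (hy : bnd y K1) by (apply hY1; lra).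
  assert (hyt : Y (RtoC 1) t (2 * u) = (Y (RtoC 1) t u * y)%op).
  { unfold y. rewrite Y_trans; auto; try lra. rewrite Re_R; lra. }
  assert (hyu : (1 - y = sc (RtoC u) * r u * y)%op) by (apply Y1_double; lra).
  assert (hpow : forall v, 0 <= v -> (r t ^ n * Y (RtoC 1) t v ^ n = r v ^ n)%op).
  { intros v hv. rewrite <- Opow_mul, Or_Y1; auto. lra. }
  assert (hn0 : (0 < n)%nat) by (unfold n; lia).
  assert (hE : (Y (RtoC 1) t u ^ n * besov_op a c t - Y (RtoC 1) t (2 * u)%R ^ n * besov_op a c t
     = sc (RtoC u) * (y * Ogeom y n * Y d t u * besov_op (Cplus a (RtoC 1)) c u))%op).
  { rewrite besov_op_succ_a by (auto; lra).
    apply (J_reg X D c 0); [auto|lra|]. apply (Or_pow_reg X D t n); [lra|].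
    transitivity (r t ^ n * Y (RtoC 1) t u ^ n * (1 - y ^ n) * (J c 0%R * besov_op a c t))%op.
    { rewrite hyt, Opow_mul. ring. }
    rewrite hpow, <- Ogeom_spec, hyu, besov_op_spec by (auto; lra). fold p.
    transitivity (sc (RtoC u) * y * Ogeom y n * r u * (r t ^ n * Y d t u * (J c 0%R * besov_op a c u)))%op; [|ring].
    rewrite besov_op_spec by (auto; lra). fold p.
    rewrite <- (J_nat X D n t), <- (J_nat X D n u), hdp, !J_plus by (auto; lra).
    transitivity (sc (RtoC u) * y * Ogeom y n * r u * (J d t * Y d t u * J p t * J p u))%op; [|ring].
    rewrite Y_spec by (auto; lra). ring. }
  replace (Y (RtoC 1) t u ^ n * besov_op a c t)%op with
   (sc (RtoC u) * (y * Ogeom y n * Y d t u * besov_op (Cplus a (RtoC 1)) c u) + Y (RtoC 1) t (2 * u)%R ^ n * besov_op a c t)%op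
   by (rewrite <- hE; ring).
  eapply Rle_trans; [apply op_add_norm|]. apply Rplus_le_compat_r.
  set (F1 := besov_op (Cplus a (RtoC 1)) c u).
  change (norm ((sc (RtoC u) * (y * Ogeom y n * Y d t u))%op (F1 x)) <= K1 * G * K * (u * norm (F1 x))).
  eapply Rle_trans.
  - apply (obnd_mul X D _ _ u (K1 * G * K)); [apply obnd_scr; lra|].
    apply obnd_mul; [apply obnd_mul; auto|]. apply hY; lra.
  - right. ring.
Qed.

(** Telescoping of [lower_a_step] over the scales above [t]. It starts from
    [P_t = 1], and the rest tends to [0] on the closure of the domain. *)
Lemma lower_a a c : Cplus_star a -> 0 < Re c -> exists C, 0 <= C /\
  forall x, dom_closure x -> forall i e, 0 < e -> exists m,
  norm (besov_op a c (tscale i) x) <=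
    C * sum_n (fun k => tscale (i + k) * norm (besov_op (Cplus a (RtoC 1)) c (tscale (i + k)) x)) m + e.
Proof.
  intros ha hc. destruct (lower_a_step a c ha hc) as [n [C [hn [hC hstep]]]].
  exists C. split; auto. intros x hx i e he.
  set (t := tscale i). assert (ht : 0 < t) by apply tscale_pos.
  assert (htel : forall m, norm (besov_op a c t x) <=
    C * sum_n (fun k => tscale (i + k) * norm (besov_op (Cplus a (RtoC 1)) c (tscale (i + k)) x)) m +
     norm ((Y (RtoC 1) t (tscale (i + S m)) ^ n * besov_op a c t)%op x)).
  { assert (hs : forall k, norm ((Y (RtoC 1) t (tscale (i + k)) ^ n * besov_op a c t)%op x) <=
      C * (tscale (i + k) * norm (besov_op (Cplus a (RtoC 1)) c (tscale (i + k)) x)) +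
      norm ((Y (RtoC 1) t (tscale (i + S k)) ^ n * besov_op a c t)%op x)).
    { intros k. rewrite Nat.add_succ_r, tscale_S. apply hstep; auto. apply tscale_le. lia. }
    intros m. induction m as [|m IH].
    - rewrite sum_O. eapply Rle_trans; [|apply (hs 0%nat)]. right.
      rewrite Nat.add_0_r. fold t. rewrite Y_refl by (rewrite ?Re_R; lra).
      replace ((1 ^ n * besov_op a c t)%op) with (besov_op a c t); auto.
      clear. induction n; cbn [Opow]; [ring|]. rewrite IHn at 1. ring.
    - rewrite sum_Sn. change (@plus R_AbelianMonoid) with Rplus. rewrite Rmult_plus_distr_l.
      generalize (hs (S m)). lra. }
  destruct n as [|n]; [lia|].
  destruct (Y_bound X D (RtoC 1)) as [K [hK hY]]; [rewrite Re_R; lra|].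
  assert (hKn : 1 <= K ^ n) by (apply pow_R1_Rle; auto).
  destruct (Y1_vanishes (besov_op a c t x) t (e / K ^ n)) as [U hU].
  { now apply dom_closure_op. } { lra. } { apply Rdiv_lt_0_compat; lra. }
  assert (hm : exists m, U <= tscale (i + S m)).
  { destruct (tscale_unbounded U) as [m hm]. exists m. apply hm. lia. }
  destruct hm as [m hm]. exists m. eapply Rle_trans; [apply (htel m)|].
  apply Rplus_le_compat_l. cbn [Opow].
  set (y := Y (RtoC 1) t (tscale (i + S m))) in *.
  replace (y * y ^ n * besov_op a c t)%op with (y ^ n * (y * besov_op a c t))%op by ring.
  change (norm ((y ^ n)%op (y (besov_op a c t x))) <= e).
  eapply Rle_trans; [apply (obnd_pow X D y K n)|].
  { apply (proj1 (hY t (tscale (i + S m)) (Rlt_le _ _ ht) (Rlt_le _ _ (tscale_pos _)))).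
    apply tscale_le; lia. }
  assert (h5 := hU _ hm). fold y in h5.
  apply Rle_trans with (K ^ n * (e / K ^ n)); [apply Rmult_le_compat_l; lra|]. right. field. lra.
Qed.

(** Telescoping of [Q_u = ((u/t) (t + A) R_u)^n] over the scales below [t]. It ends
    with [Q_t = 1]. The step from [u] to [2u] has the factor
    [2 (u + A) R_(2u) - 1 = A R_(2u)], which supplies the additional power
    [A (u + A)^(-1)]; at the lowest scale it is supplied by the invertibility
    of [A]. *)
Lemma lower_c a c : Cplus_star a -> 0 < Re c -> exists C, 0 <= C /\
  forall i x, norm (besov_op a c (tscale i) x) <=
    C * sum_n (fun k => Rpower (tscale k / tscale i) (Re c + Re a) *
       norm (besov_op a (Cplus c (RtoC 1)) (tscale k) x)) i.
Proof.
  intros ha hc.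
  set (p := Cplus c a). assert (hp : 0 < Re p) by (unfold p; rewrite Re_plus; generalize (star_ge_0 a ha); lra).
  destruct (nfloor_ex (Re p) (Rlt_le _ _ hp)) as [n0 [_ hn]]. rewrite <- S_INR in hn.
  set (n := S n0) in *.
  set (d := Cminus (RtoC (INR n)) p). assert (hd : 0 < Re d) by (unfold d; rewrite Re_minus, Re_R; lra).
  assert (hdp : RtoC (INR n) = Cplus d p) by (unfold d; ring).
  destruct (Y_bound X D d hd) as [K [hK hY]].
  destruct (Y_bound X D (RtoC 1)) as [K1 [hK1 hY1]]; [rewrite Re_R; lra|].
  destruct (Ogeom_bound (2 * K1) n ltac:(lra)) as [G [hG hg]].
  destruct (op_bdd _ _ b) as [N hN]. assert (hN0 : 0 <= N) by apply hN.
  assert (hn0 : (0 < n)%nat) by (unfold n; lia).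
  set (Q := fun t u => (sc (RtoC (u / t)) * Y (RtoC 1) t u)%op).
  assert (hQ : forall t u, 0 < t -> 0 < u -> (r t ^ n * Q t u ^ n = sc (RtoC (u / t)) ^ n * r u ^ n)%op).
  { intros t u ht hu. rewrite <- !Opow_mul. f_equal. unfold Q.
    rewrite <- (Or_Y1 X D t u) by lra. ring. }
  assert (hrn : forall t u, 0 < t -> 0 < u -> (J p t * r u ^ n = r t ^ n * Y d t u * J p u)%op).
  { intros t u ht hu. rewrite <- (J_nat X D n t), <- (J_nat X D n u), hdp, !J_plus by (auto; lra).
    transitivity (J d t * Y d t u * J p t * J p u)%op; [|ring]. rewrite Y_spec by (auto; lra). ring. }
  assert (hYb : forall t u, 0 < u <= t -> bnd (sc (RtoC (u / t)) ^ n * Y d t u)%op (K * Rpower (u / t) (Re c + Re a))).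
  { intros t u hut. rewrite Osc_pow.
    assert (hq : 0 < u / t) by (apply Rdiv_lt_0_compat; lra).
    assert (hq' : 0 < t / u) by (apply Rdiv_lt_0_compat; lra).
    eapply bnd_le.
    - apply obnd_mul; [apply obnd_scr, pow_le; lra|]. apply hY; lra.
    - rewrite <- Rpower_pow by auto. right.
      replace (Rpower (t / u) (Re d)) with (Rpower (u / t) (- Re d)).
      + replace (Re c + Re a) with (INR n + - Re d).
        * rewrite Rpower_plus. ring.
        * unfold d, p. rewrite Re_minus, Re_R, Re_plus. ring.
      + replace (t / u) with (/ (u / t)) by (field; lra). unfold Rpower. rewrite ln_Rinv by auto. f_equal. ring. }
  exists (G * K1 * K + K * (1 + th * N)).
  assert (hC1 : 0 <= G * K1 * K) by (repeat apply Rmult_le_pos; lra).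
  assert (hC2 : 0 <= K * (1 + th * N)) by (apply Rmult_le_pos; nra).
  split; [lra|]. intros i x.
  set (t := tscale i). assert (ht : 0 < t) by apply tscale_pos.
  set (g := fun k => Rpower (tscale k / t) (Re c + Re a) * norm (besov_op a (Cplus c (RtoC 1)) (tscale k) x)).
  assert (hg0 : forall k, 0 <= g k).
  { intros k. apply Rmult_le_pos; [apply Rlt_le, Rpower_pos|apply xnorm_ge_0]. }
  assert (hbase : norm ((Q t th ^ n * besov_op a c t)%op x) <= K * (1 + th * N) * g 0%nat).
  { assert (hE : (Q t th ^ n * besov_op a c t = sc (RtoC (th / t)) ^ n * Y d t th *
        ((1 + sc (RtoC th) * b) * besov_op a (Cplus c (RtoC 1)) th))%op).
    { rewrite besov_op_succ_c by (auto; lra).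
      apply (J_reg X D c 0); [auto|lra|]. apply (Or_pow_reg X D t n); [lra|].
      transitivity (r t ^ n * Q t th ^ n * (J c 0%R * besov_op a c t))%op; [ring|].
      rewrite hQ, besov_op_spec by (auto; lra). fold p.
      transitivity (sc (RtoC (th / t)) ^ n * (r t ^ n * Y d t th * (J c 0%R * besov_op a c th)) *
        (1 + sc (RtoC th) * (b - (r th + sc (RtoC th) * b * r th))))%op; [|ring].
      rewrite Or_spec, besov_op_spec by (auto; lra). fold p. rewrite <- hrn by auto. ring. }
    rewrite hE. unfold g. replace (tscale 0) with th by (unfold tscale; simpl; ring).
    set (F1 := besov_op a (Cplus c (RtoC 1)) th).
    change (norm ((sc (RtoC (th / t)) ^ n * Y d t th * (1 + sc (RtoC th) * b))%op (F1 x)) <=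
       K * (1 + th * N) * (Rpower (th / t) (Re c + Re a) * norm (F1 x))).
    eapply Rle_trans.
    - apply (obnd_mul X D _ _ (K * Rpower (th / t) (Re c + Re a)) (1 + th * N)).
      + apply hYb. split; auto. apply tscale_ge.
      + apply obnd_add; [apply obnd_1|]. apply obnd_mul; auto. apply obnd_scr; lra.
    - right. ring. }
  assert (hstep : forall u, 0 < u -> 2 * u <= t ->
    norm ((Q t (2 * u)%R ^ n * besov_op a c t)%op x) <= norm ((Q t u ^ n * besov_op a c t)%op x) +
     G * K1 * K * (Rpower (u / t) (Re c + Re a) * norm (besov_op a (Cplus c (RtoC 1)) u x))).
  { intros u hu hut.
    set (y := Y (RtoC 1) u (2 * u)).
    assert (hy : bnd y K1) by (apply hY1; lra).
    set (w := (sc (RtoC 2) * y)%op).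
    assert (hw : bnd w (2 * K1)) by (apply obnd_mul; auto; apply obnd_scr; lra).
    assert (hQw : Q t (2 * u) = (Q t u * w)%op).
    { unfold Q, w, y. rewrite <- (Y_trans X D (RtoC 1) t u (2 * u)) by (rewrite ?Re_R; lra).
      replace (2 * u / t) with (u / t * 2) by (field; lra). rewrite RtoC_mult, Osc_mult. ring. }
    assert (hyw : (w - 1 = (1 - sc (RtoC u) * r u) * y)%op) by (apply Y1_double_scaled; lra).
    assert (hE : (Q t (2 * u)%R ^ n * besov_op a c t - Q t u ^ n * besov_op a c t =
       Ogeom w n * y * (sc (RtoC (u / t)) ^ n * Y d t u) * besov_op a (Cplus c (RtoC 1)) u)%op).
    { rewrite besov_op_succ_c by (auto; lra).
      apply (J_reg X D c 0); [auto|lra|]. apply (Or_pow_reg X D t n); [lra|].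
      transitivity (r t ^ n * Q t u ^ n * (w ^ n - 1) * (J c 0%R * besov_op a c t))%op.
      { rewrite hQw, Opow_mul. ring. }
      replace (w ^ n - 1)%op with ((w - 1) * Ogeom w n)%op.
      2:{ transitivity (- ((1 - w) * Ogeom w n))%op; [ring|]. rewrite Ogeom_spec. ring. }
      rewrite hQ, hyw, besov_op_spec by (auto; lra). fold p.
      transitivity (Ogeom w n * y * sc (RtoC (u / t)) ^ n * (1 - sc (RtoC u) * r u) *
         (r t ^ n * Y d t u * (J c 0%R * besov_op a c u)))%op; [|ring].
      rewrite besov_op_spec by (auto; lra). fold p. rewrite <- hrn by auto. ring. }
    replace (Q t (2 * u)%R ^ n * besov_op a c t)%op with (Q t u ^ n * besov_op a c t +
       Ogeom w n * y * (sc (RtoC (u / t)) ^ n * Y d t u) * besov_op a (Cplus c (RtoC 1)) u)%op by (rewrite <- hE; ring).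
    eapply Rle_trans; [apply op_add_norm|]. apply Rplus_le_compat_l.
    set (F1 := besov_op a (Cplus c (RtoC 1)) u).
    change (norm ((Ogeom w n * y * (sc (RtoC (u / t)) ^ n * Y d t u))%op (F1 x)) <=
       G * K1 * K * (Rpower (u / t) (Re c + Re a) * norm (F1 x))).
    eapply Rle_trans.
    - apply (obnd_mul X D _ _ (G * K1) (K * Rpower (u / t) (Re c + Re a))).
      + apply obnd_mul; auto.
      + apply hYb. lra.
    - right. ring. }
  assert (hnext : forall j, (S j <= i)%nat -> norm ((Q t (tscale (S j)) ^ n * besov_op a c t)%op x) <=
     norm ((Q t (tscale j) ^ n * besov_op a c t)%op x) + G * K1 * K * g j).
  { intros j hj. rewrite tscale_S. apply hstep; [apply tscale_pos|].
    rewrite <- tscale_S. now apply tscale_le. }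
  assert (htel : forall j, (S j <= i)%nat -> norm ((Q t (tscale (S j)) ^ n * besov_op a c t)%op x) <=
     K * (1 + th * N) * g 0%nat + G * K1 * K * sum_n g j).
  { intros j. induction j as [|j IH]; intros hj; (eapply Rle_trans; [apply hnext; auto|]).
    - rewrite sum_O. apply Rplus_le_compat_r.
      replace (tscale 0) with th by (unfold tscale; simpl; ring). exact hbase.
    - rewrite sum_Sn. change (@plus R_AbelianMonoid) with Rplus. specialize (IH ltac:(lia)). lra. }
  assert (hlast : norm ((Q t t ^ n * besov_op a c t)%op x) <= (G * K1 * K + K * (1 + th * N)) * sum_n g i).
  { assert (h0 : g 0%nat <= sum_n g i) by (apply sum_n_term_le; auto; lia).
    assert (h1 : 0 <= sum_n g i) by (apply sum_n_nonneg; auto).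
    unfold t at 2. destruct i as [|j].
    - replace (tscale 0) with th by (unfold tscale; simpl; ring).
      eapply Rle_trans; [exact hbase|]. nra.
    - eapply Rle_trans; [apply htel; lia|].
      assert (h2 : sum_n g j <= sum_n g (S j)) by (apply sum_n_mono; auto; lia). nra. }
  replace (Q t t ^ n * besov_op a c t)%op with (besov_op a c t) in hlast; [exact hlast|].
  assert (h1 : Q t t = 1%op).
  { unfold Q. rewrite Y_refl by (rewrite ?Re_R; lra). unfold Rdiv. rewrite Rinv_r by lra.
    fold (@Oone X D). ring. }
  rewrite h1. clear. induction n; cbn [Opow]; [ring|]. rewrite IHn at 1. ring.
Qed.

End Scales.
End BesovOperators.

(** * Equivalence of the Besov quasi-norms *)

Lemma minus_trans_plus (G : AbelianGroup) (x y z : G) :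
  plus (minus x y) (minus y z) = minus x z.
Proof.
  unfold minus. rewrite <- plus_assoc. f_equal. rewrite plus_assoc, plus_opp_l. apply plus_zero_l.
Qed.

Lemma minus_minus_same (G : AbelianGroup) (x y z : G) :
  plus (minus x z) (opp (minus y z)) = minus x y.
Proof. rewrite opp_minus. apply minus_trans_plus. Qed.

Lemma minus_minus_same' (G : AbelianGroup) (v y z : G) :
  plus (minus v z) (opp (minus v y)) = minus y z.
Proof. rewrite opp_minus, plus_comm. apply minus_trans_plus. Qed.

Section Equivalence.

Variable X : CompleteNormedModule C_AbsRing.
Variable D : resolvents X.
Notation Op := (Op X D).
Notation r := (@Or X D).
Notation b := (@Ob X D).
Notation sc := (@Osc X D).
Notation J := (J X D).
Notation Y := (Y X D).
Notation W := (W X D).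
Notation Jz := (Jz X D).
Notation besov_op := (besov_op X D).
Notation dom_closure := (dom_closure X D).

Add Ring OpRing11 : (Op_ring_theory X D).

(** The [i]-th term of the Besov seminorm at the scales [th * 2^i], with [F_(a,c)]
    in place of the composition of fractional powers. *)
Definition besov_term (s th : R) (a c : C) (x : X) (i : nat) : R :=
  Rpower (tscale th i) (s + Re a) * norm (besov_op a c (tscale th i) x).

Lemma besov_term_eq s th a c x i :
  besov_term s th a c x i = Rpower (tscale th i) (s + Re a) * norm (besov_op a c (tscale th i) x).
Proof. reflexivity. Qed.

Lemma besov_term_ge_0 s th a c x i : 0 <= besov_term s th a c x i.
Proof. apply Rmult_le_pos; [apply Rlt_le, Rpower_pos|apply xnorm_ge_0]. Qed.

(** An inequality of [l^q] quasi-norms, in terms of upper bounds [M] so that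
    infinite quasi-norms need no separate treatment. *)
Definition dominates (q : Rbar) (n1 n2 : X -> nat -> R) : Prop :=
  exists C, 0 <= C /\ forall x, dom_closure x -> forall M, 0 <= M ->
    lq_le q (n1 x) M -> lq_le q (n2 x) (C * M).

Section FixedIndex.

Variable q : Rbar.
Hypothesis hq : Rbar_lt (Finite 0) q.

Lemma dominates_trans n1 n2 n3 : dominates q n1 n2 -> dominates q n2 n3 -> dominates q n1 n3.
Proof.
  intros [C1 [h1 k1]] [C2 [h2 k2]]. exists (C2 * C1). split; [nra|].
  intros x hx M hM h. rewrite Rmult_assoc. apply k2; auto. nra.
Qed.

Lemma dominates_refl n1 : dominates q n1 n1.
Proof. exists 1. split; [lra|]. intros x _ M _ h. now rewrite Rmult_1_l. Qed.

Lemma dominates_up s th a c e d : 0 < th -> Cplus_star a -> 0 < Re c -> 0 < Re e -> 0 < Re d ->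
  dominates q (besov_term s th a c) (besov_term s th (Cplus a e) (Cplus c d)).
Proof.
  intros hth ha hc he hd.
  destruct (W_bound X D d hd) as [K1 [hK1 h1]]. destruct (J_bound X D e he) as [K2 [hK2 h2]].
  exists (K1 * K2). split; [nra|]. intros x _ M hM h.
  apply (lq_le_scal q hq _ (besov_term s th a c x)); auto; [nra| |intros; apply besov_term_ge_0].
  intros j. split; [apply besov_term_ge_0|]. unfold besov_term. set (t := tscale th j).
  assert (ht : 0 < t) by (apply tscale_pos; auto).
  rewrite besov_op_up by (auto; lra). set (F := besov_op a c t).
  change (Rpower t (s + Re (Cplus a e)) * norm ((W d t * J e t)%op (F x)) <= K1 * K2 * (Rpower t (s + Re a) * norm (F x))).
  assert (h3 := obnd_mul X D _ _ _ _ (h1 t ltac:(lra)) (proj2 (h2 t ltac:(lra)) ht)).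
  eapply Rle_trans; [apply Rmult_le_compat_l; [apply Rlt_le, Rpower_pos|apply h3]|].
  rewrite Re_plus. right. rewrite <- Rplus_assoc, (Rpower_plus (s + Re a)), Rpower_Ropp. field.
  apply Rgt_not_eq, Rpower_pos.
Qed.

Lemma sum_n_shift_le (f : nat -> R) i m : (forall j, 0 <= f j) ->
  sum_n (fun k => f (i + k)%nat) m <= sum_n f (i + m).
Proof.
  intros hf. induction m as [|m IH].
  - rewrite sum_O. apply sum_n_term_le; auto.
  - rewrite Nat.add_succ_r, !sum_Sn, Nat.add_succ_r. apply Rplus_le_compat_r. exact IH.
Qed.

Lemma Rpower_2_small y : 0 < y -> 0 < Rpower 2 (- y) < 1.
Proof.
  intros hy. split; [apply Rpower_pos|]. rewrite <- (Rpower_O 2) by lra. apply Rpower_lt; lra.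
Qed.

(** [lower_a] reads, for the weighted terms, as a convolution with
    [2^(-(s + Re a) |i - j|)]; here [0 < s + Re a] is used. *)
Lemma dominates_lower_a s th a c : 0 < th -> 0 < s -> Cplus_star a -> 0 < Re c ->
  dominates q (besov_term s th (Cplus a (RtoC 1)) c) (besov_term s th a c).
Proof.
  intros hth hs ha hc. destruct (lower_a X D th hth a c ha hc) as [C [hC h]].
  set (y := s + Re a). assert (hy : 0 < y) by (unfold y; generalize (star_ge_0 a ha); lra).
  destruct (lq_conv q hq (Rpower 2 (- y)) C (Rpower_2_small y hy) hC) as [C' [hC' hconv]].
  exists C'. split; auto. intros x hx M hM hl.
  apply (hconv _ (besov_term s th (Cplus a (RtoC 1)) c x)); auto; try (intros; apply besov_term_ge_0).
  intros i e he.
  assert (hp := Rpower_pos (tscale th i) y).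
  destruct (h x hx i (e / Rpower (tscale th i) y)) as [m hm]; [apply Rdiv_lt_0_compat; auto|].
  exists (i + m)%nat. unfold besov_term at 1. fold y.
  eapply Rle_trans; [apply Rmult_le_compat_l; [lra|exact hm]|].
  rewrite Rmult_plus_distr_l.
  replace (Rpower (tscale th i) y * (e / Rpower (tscale th i) y)) with e by (field; lra).
  apply Rplus_le_compat_r. rewrite <- Rmult_assoc, (Rmult_comm _ C), Rmult_assoc.
  apply Rmult_le_compat_l; auto. rewrite <- sum_n_scal_l'.
  set (f := fun j => Rpower 2 (- y) ^ ndist i j * besov_term s th (Cplus a (RtoC 1)) c x j).
  eapply Rle_trans; [|apply (sum_n_shift_le f)].
  - apply sum_n_le_compat. intros k. unfold f, besov_term.
    replace (ndist i (i + k)) with k by (unfold ndist; lia).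
    rewrite <- (tscale_ratio th hth i k y), Re_plus, Re_R, <- (Rplus_assoc s). fold y.
    rewrite Rpower_plus, Rpower_1 by (apply tscale_pos; auto).
    right. set (u := tscale th i). set (v := tscale th (i + k)).
    assert (hu : 0 < u) by (apply tscale_pos; auto). assert (hv : 0 < v) by (apply tscale_pos; auto).
    replace (Rpower u y) with (Rpower (u / v) y * Rpower v y); [rewrite !Rmult_assoc; reflexivity|].
    rewrite Rpower_mult_distr by (auto; apply Rdiv_lt_0_compat; auto). f_equal. field. lra.
  - intros j. apply Rmult_le_pos; [apply pow_le, Rlt_le, Rpower_pos|apply besov_term_ge_0].
Qed.

(** [lower_c] reads, for the weighted terms, as a convolution with
    [2^(-(Re c - s) |i - j|)]; here [s < Re c] is used. *)
Lemma dominates_lower_c s th a c : 0 < th -> Cplus_star a -> 0 < Re c -> s < Re c ->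
  dominates q (besov_term s th a (Cplus c (RtoC 1))) (besov_term s th a c).
Proof.
  intros hth ha hc hs. destruct (lower_c X D th hth a c ha hc) as [C [hC h]].
  set (y := Re c - s). assert (hy : 0 < y) by (unfold y; lra).
  destruct (lq_conv q hq (Rpower 2 (- y)) C (Rpower_2_small y hy) hC) as [C' [hC' hconv]].
  exists C'. split; auto. intros x hx M hM hl.
  apply (hconv _ (besov_term s th a (Cplus c (RtoC 1)) x)); auto; try (intros; apply besov_term_ge_0).
  intros i e he. exists i. unfold besov_term at 1.
  apply Rle_trans with (C * sum_n (fun j => Rpower 2 (- y) ^ ndist i j * besov_term s th a (Cplus c (RtoC 1)) x j) i); [|lra].
  eapply Rle_trans; [apply Rmult_le_compat_l; [apply Rlt_le, Rpower_pos|apply h]|].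
  rewrite <- Rmult_assoc, (Rmult_comm _ C), Rmult_assoc.
  apply Rmult_le_compat_l; auto. rewrite <- sum_n_scal_l'.
  apply sum_n_le_upto. intros k hk. unfold besov_term.
  replace (ndist i k) with (i - k)%nat by (unfold ndist; lia).
  rewrite <- (tscale_ratio th hth k (i - k) y).
  replace (k + (i - k))%nat with i by lia.
  right. set (u := tscale th i). set (v := tscale th k).
  assert (hu : 0 < u) by (apply tscale_pos; auto). assert (hv : 0 < v) by (apply tscale_pos; auto).
  assert (hvu : 0 < v / u) by (apply Rdiv_lt_0_compat; auto).
  replace (Re c + Re a) with (y + (s + Re a)) by (unfold y; ring).
  rewrite (Rpower_plus y (s + Re a)).
  replace (Rpower v (s + Re a)) with (Rpower (v / u) (s + Re a) * Rpower u (s + Re a)); [ring|].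
  rewrite Rpower_mult_distr by auto. f_equal. field. lra.
Qed.

Lemma dominates_lower_a_nat s th a c m : 0 < th -> 0 < s -> Cplus_star a -> 0 < Re c ->
  dominates q (besov_term s th (Cplus a (RtoC (INR m))) c) (besov_term s th a c).
Proof.
  intros hth hs ha hc. induction m as [|m IH].
  - rewrite Cplus_0_r. apply dominates_refl.
  - apply dominates_trans with (2 := IH).
    replace (Cplus a (RtoC (INR (S m)))) with (Cplus (Cplus a (RtoC (INR m))) (RtoC 1)).
    + apply dominates_lower_a; auto. destruct m as [|m].
      * now rewrite Cplus_0_r.
      * left. rewrite Re_plus, Re_R. assert (0 < INR (S m)) by (apply lt_0_INR; lia).
        generalize (star_ge_0 a ha). lra.
    + rewrite S_INR, RtoC_plus. ring.
Qed.

Lemma dominates_lower_c_nat s th a c m : 0 < th -> Cplus_star a -> 0 < Re c -> s < Re c ->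
  dominates q (besov_term s th a (Cplus c (RtoC (INR m)))) (besov_term s th a c).
Proof.
  intros hth ha hc hs. induction m as [|m IH].
  - rewrite Cplus_0_r. apply dominates_refl.
  - apply dominates_trans with (2 := IH).
    replace (Cplus c (RtoC (INR (S m)))) with (Cplus (Cplus c (RtoC (INR m))) (RtoC 1)).
    + assert (0 <= INR m) by apply pos_INR.
      apply dominates_lower_c; auto; rewrite Re_plus, Re_R; lra.
    + rewrite S_INR, RtoC_plus. ring.
Qed.

(** Both exponents are raised beyond the given ones, and then lowered by integer
    steps. *)
Lemma dominates_exponents s th a c a' c' : 0 < th -> 0 < s -> Cplus_star a -> Cplus_star a' ->
  s < Re c -> s < Re c' -> dominates q (besov_term s th a c) (besov_term s th a' c').
Proof.
  intros hth hs ha ha' hc hc'.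
  assert (ha0 := star_ge_0 a ha). assert (ha0' := star_ge_0 a' ha').
  destruct (nfloor_ex (Re a + Re c)) as [n [_ hn]]; [lra|]. rewrite <- S_INR in hn.
  set (m := RtoC (INR (S n))).
  apply dominates_trans with (besov_term s th (Cplus a' m) (Cplus c' m)).
  - replace (Cplus a' m) with (Cplus a (Cminus (Cplus a' m) a)) by ring.
    replace (Cplus c' m) with (Cplus c (Cminus (Cplus c' m) c)) by ring.
    assert (hm : Re m = INR (S n)) by reflexivity.
    apply dominates_up; auto; try lra; rewrite Re_minus, Re_plus, hm; lra.
  - apply dominates_trans with (besov_term s th (Cplus a' m) c').
    + apply dominates_lower_c_nat; auto; [|lra]. left. rewrite Re_plus. unfold m. rewrite Re_R.
      assert (0 < INR (S n)) by (apply lt_0_INR; lia). lra.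
    + apply dominates_lower_a_nat; auto. lra.
Qed.

Lemma tscale_double th i : tscale (2 * th) i = tscale th (S i).
Proof. unfold tscale. simpl. ring. Qed.

Lemma dominates_start_up s th a c : dominates q (besov_term s th a c) (besov_term s (2 * th) a c).
Proof.
  exists 1. split; [lra|]. intros x _ M hM h. rewrite Rmult_1_l.
  assert (e : forall i, besov_term s (2 * th) a c x i = besov_term s th a c x (S i)).
  { intros i. unfold besov_term. now rewrite tscale_double. }
  destruct q as [p| |]; simpl in *; [| |tauto].
  - intros n. rewrite (sum_n_ext _ (fun j => nnpow (besov_term s th a c x (1 + j)) p)).
    2:{ intros j. now rewrite e. }
    eapply Rle_trans; [apply (sum_n_shift_le (fun j => nnpow (besov_term s th a c x j) p))|apply h].
    intros; apply nnpow_ge_0.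
  - intros j. rewrite e. apply h.
Qed.

Lemma lq_le_cons (C : R) : 0 <= C -> exists K, 0 <= K /\ forall (u : nat -> R) M,
  (forall j, 0 <= u j) -> 0 <= M -> u 0%nat <= C * M -> lq_le q (fun j => u (S j)) M -> lq_le q u (K * M).
Proof.
  intros hC. destruct q as [p| |]; simpl in *; [| |tauto].
  - exists (nnpow 2 (/ p) * (1 + C)). assert (h2 := nnpow_ge_0 2 (/ p)).
    split; [apply Rmult_le_pos; lra|]. intros u M hu hM h0 h n.
    assert (hCM : 0 <= (1 + C) * M) by nra.
    rewrite Rmult_assoc, nnpow_mult, nnpow_root' by lra.
    assert (k1 : nnpow (u 0%nat) p <= nnpow ((1 + C) * M) p) by (apply nnpow_le; auto; split; auto; nra).
    assert (k2 : nnpow M p <= nnpow ((1 + C) * M) p) by (apply nnpow_le; auto; nra).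
    assert (k3 := nnpow_ge_0 ((1 + C) * M) p).
    destruct n as [|n].
    + rewrite sum_O. lra.
    + assert (hs : forall m, sum_n (fun j => nnpow (u j) p) (S m) =
         nnpow (u 0%nat) p + sum_n (fun j => nnpow (u (S j)) p) m).
      { intros m. induction m as [|m IH].
        - rewrite sum_Sn, !sum_O. reflexivity.
        - rewrite sum_Sn, IH, (sum_Sn (fun j => nnpow (u (S j)) p)).
          change (@plus R_AbelianMonoid) with Rplus. apply Rplus_assoc. }
      rewrite hs. generalize (h n). lra.
  - exists (1 + C). split; [lra|]. intros u M hu hM h0 h j. destruct j as [|j].
    + nra.
    + generalize (h j). nra.
Qed.

(** The one additional term is controlled by the next one, through the bounded
    ratio of two powers at different shifts. *)
Lemma dominates_start_down s th a c : 0 < th -> Cplus_star a -> 0 < Re c ->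
  dominates q (besov_term s (2 * th) a c) (besov_term s th a c).
Proof.
  intros hth ha hc.
  set (p := Cplus c a). assert (hp : 0 < Re p) by (unfold p; rewrite Re_plus; generalize (star_ge_0 a ha); lra).
  assert (hE : besov_op a c th = (Y p (2 * th)%R th * besov_op a c (2 * th)%R)%op).
  { apply (J_reg X D c 0); auto; try lra.
    transitivity (Y p (2 * th)%R th * (J c 0%R * besov_op a c (2 * th)%R))%op; [|ring].
    rewrite !besov_op_spec by (auto; lra). fold p.
    transitivity (J p (2 * th)%R * Y p (2 * th)%R th)%op; [|ring]. rewrite Y_spec; auto; lra. }
  destruct (op_bdd _ _ (Y p (2 * th) th)) as [N hN]. assert (hN0 : 0 <= N) by apply hN.
  set (P := Rpower th (s + Re a) / Rpower (2 * th) (s + Re a)).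
  assert (hP0 := Rpower_pos (2 * th) (s + Re a)).
  assert (hP : 0 <= P) by (apply Rdiv_le_0_compat; auto; apply Rlt_le, Rpower_pos).
  destruct (lq_le_cons (P * N)) as [K [hK h]]; [nra|].
  exists K. split; auto. intros x _ M hM hl.
  assert (e : forall i, besov_term s (2 * th) a c x i = besov_term s th a c x (S i)).
  { intros i. unfold besov_term. now rewrite tscale_double. }
  apply h; auto.
  - intros; apply besov_term_ge_0.
  - assert (h0 := lq_le_term q hq _ M 0%nat (besov_term_ge_0 s (2 * th) a c x) hM hl).
    assert (t0 : forall u, tscale u 0 = u) by (intros u; unfold tscale; simpl; ring).
    unfold besov_term in *. rewrite t0 in *. rewrite hE.
    set (F := besov_op a c (2 * th)) in *.
    change (Rpower th (s + Re a) * norm (Y p (2 * th) th (F x)) <= P * N * M).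
    assert (hx := xnorm_ge_0 X (F x)).
    apply Rle_trans with (Rpower th (s + Re a) * (N * norm (F x))).
    { apply Rmult_le_compat_l; [apply Rlt_le, Rpower_pos|apply hN]. }
    apply Rle_trans with (P * N * (Rpower (2 * th) (s + Re a) * norm (F x))).
    { right. unfold P. field. lra. }
    apply Rmult_le_compat_l; auto. nra.
  - destruct q as [z| |]; simpl in *; [| |tauto].
    + intros n. rewrite (sum_n_ext _ (fun j => nnpow (besov_term s (2 * th) a c x j) z)); auto.
      intros j. now rewrite e.
    + intros j. rewrite <- e. apply hl.
Qed.

Lemma dominates_start_up_pow s th a c m : dominates q (besov_term s th a c) (besov_term s (th * 2 ^ m) a c).
Proof.
  induction m as [|m IH].
  - simpl. rewrite Rmult_1_r. apply dominates_refl.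
  - apply dominates_trans with (1 := IH). simpl.
    replace (th * (2 * 2 ^ m)) with (2 * (th * 2 ^ m)) by ring. apply dominates_start_up.
Qed.

Lemma dominates_start_down_pow s th a c m : 0 < th -> Cplus_star a -> 0 < Re c ->
  dominates q (besov_term s (th * 2 ^ m) a c) (besov_term s th a c).
Proof.
  intros hth ha hc. induction m as [|m IH].
  - simpl. rewrite Rmult_1_r. apply dominates_refl.
  - apply dominates_trans with (2 := IH). simpl.
    replace (th * (2 * 2 ^ m)) with (2 * (th * 2 ^ m)) by ring. apply dominates_start_down; auto.
    apply Rmult_lt_0_compat; auto. apply pow_lt; lra.
Qed.

Lemma powerRZ_2_pos k : 0 < powerRZ 2 k.
Proof. apply powerRZ_lt. lra. Qed.

Lemma dominates_all s k k' a c a' c' : 0 < s -> Cplus_star a -> Cplus_star a' ->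
  s < Re c -> s < Re c' ->
  dominates q (besov_term s (powerRZ 2 k) a c) (besov_term s (powerRZ 2 k') a' c').
Proof.
  intros hs ha ha' hc hc'.
  apply dominates_trans with (besov_term s (powerRZ 2 k) a' c').
  { apply dominates_exponents; auto. apply powerRZ_2_pos. }
  destruct (Z.le_gt_cases k k') as [h|h].
  - replace (powerRZ 2 k') with (powerRZ 2 k * 2 ^ Z.to_nat (k' - k)).
    + apply dominates_start_up_pow.
    + rewrite pow_powerRZ, <- powerRZ_add by lra. f_equal. lia.
  - replace (powerRZ 2 k) with (powerRZ 2 k' * 2 ^ Z.to_nat (k - k')).
    + apply dominates_start_down_pow; auto; [apply powerRZ_2_pos|lra].
    + rewrite pow_powerRZ, <- powerRZ_add by lra. f_equal. lia.
Qed.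

(** The low-frequency part of the quasi-norm is controlled by the first term of
    the seminorm: [(th + A)^c A^(-c)] is bounded as [A] is invertible. The
    quasi-norm is thus equivalent to the seminorm. *)
Lemma low_frequency s th a c : 0 < th -> Cplus_star a -> 0 < Re c -> exists C, 0 <= C /\
  forall x M, 0 <= M -> lq_le q (besov_term s th a c x) M -> norm (Jz a th x) <= C * M.
Proof.
  intros hth ha hc.
  assert (hE : Jz a th = (Y c th 0 * besov_op a c th)%op).
  { rewrite besov_op_eq. transitivity (W c th * Y c th 0%R * Jz a th)%op; [|ring].
    rewrite W_eq. rewrite Y_trans, Y_refl by lra. ring. }
  destruct (op_bdd _ _ (Y c th 0)) as [N hN]. assert (hN0 : 0 <= N) by apply hN.
  assert (hP := Rpower_pos th (s + Re a)).
  exists (N / Rpower th (s + Re a)). split; [apply Rdiv_le_0_compat; auto|].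
  intros x M hM hl.
  assert (h0 := lq_le_term q hq _ M 0%nat (besov_term_ge_0 s th a c x) hM hl).
  assert (t0 : tscale th 0 = th) by (unfold tscale; simpl; ring).
  unfold besov_term in h0. rewrite t0 in h0. rewrite hE.
  set (F := besov_op a c th) in *.
  change (norm (Y c th 0 (F x)) <= N / Rpower th (s + Re a) * M).
  eapply Rle_trans; [apply hN|].
  apply Rle_trans with (N / Rpower th (s + Re a) * (Rpower th (s + Re a) * norm (F x))).
  { right. field. lra. }
  apply Rmult_le_compat_l; auto. apply Rdiv_le_0_compat; auto.
Qed.

Lemma besov_term_zero s th a c x : 0 < th -> Cplus_star a -> 0 < Re c ->
  lq_le q (besov_term s th a c x) 0 -> x = zero.
Proof.
  intros hth ha hc hl. destruct (low_frequency s th a c hth ha hc) as [C [hC h]].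
  assert (h1 := h x 0 (Rle_refl 0) hl). rewrite Rmult_0_r in h1.
  assert (h2 : Jz a th x = zero).
  { apply xnorm_eq_0. apply Rle_antisym; auto. apply xnorm_ge_0. }
  destruct ha as [ha|ha].
  - rewrite Jz_pos in h2 by auto. apply (J_zero_inj X D a th); auto; lra.
  - subst a. rewrite Jz_0 in h2. rewrite <- h2. symmetry. apply (@scal_one C_Ring X).
Qed.

(** Smoothness is traded for exponents:
    [A^c (t + A)^(-a-c) A^(-g) = A^(c-g) (t + A)^(-(a+g)-(c-g))]. *)
Lemma besov_op_J a c g t : Cplus_star a -> 0 < Re g < Re c -> 0 <= t ->
  (besov_op a c t * J g 0%R)%op = besov_op (Cplus a g) (Cminus c g) t.
Proof.
  intros ha hg ht.
  assert (hcg : 0 < Re (Cminus c g)) by (rewrite Re_minus; lra).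
  assert (hag : Cplus_star (Cplus a g)) by (apply star_plus; auto; left; lra).
  apply (J_reg X D c 0); try lra.
  transitivity (J g 0%R * (J c 0%R * besov_op a c t))%op; [ring|].
  rewrite besov_op_spec by (auto; lra).
  transitivity (J g 0%R * (J (Cminus c g) 0%R * besov_op (Cplus a g) (Cminus c g) t))%op.
  - rewrite besov_op_spec by auto. f_equal. f_equal. ring.
  - replace c with (Cplus g (Cminus c g)) at 3 by ring. rewrite J_plus by (auto; lra). ring.
Qed.

Lemma besov_term_J s th a c g x i : 0 < th -> Cplus_star a -> 0 < Re g < Re c ->
  besov_term (s + Re g) th a c (J g 0 x) i = besov_term s th (Cplus a g) (Cminus c g) x i.
Proof.
  intros hth ha hg. unfold besov_term. rewrite <- besov_op_J; auto.
  - rewrite Re_plus. f_equal. f_equal. ring.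
  - apply Rlt_le, tscale_pos; auto.
Qed.

End FixedIndex.

(** ** Elements of the Besov space lie in the domain of low powers *)

Lemma Or_scaled_strong n x e : dom_closure x -> 0 < e -> exists U, 1 <= U /\
  forall t, U <= t -> norm (minus (((sc (RtoC t) * r t) ^ n)%op x) x) < e.
Proof.
  intros hx he.
  destruct (Or_scaled_limit X D n) as [K [hK hlim]].
  destruct (Or_bound X D) as [M [hM [_ hr]]].
  assert (hMn : 1 <= M ^ n) by (apply pow_R1_Rle; auto).
  destruct (hx (e / (2 * (M ^ n + 1)))) as [z hz]; [apply Rdiv_lt_0_compat; lra|].
  set (P := K * norm z). assert (hP : 0 <= P) by (apply Rmult_le_pos; auto; apply xnorm_ge_0).
  exists (2 * P / e + 1).
  assert (hP2 : 0 <= 2 * P / e) by (apply Rdiv_le_0_compat; lra).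
  split; [lra|]. intros t ht.
  set (T := ((sc (RtoC t) * r t) ^ n)%op).
  assert (hT : bnd T (M ^ n)).
  { apply obnd_pow. eapply bnd_le; [apply obnd_mul; [apply obnd_scr; lra|apply hr; lra]|].
    right. field. lra. }
  assert (e1 : minus (T x) x = (T - 1)%op x).
  { unfold minus. change ((T - 1)%op x) with (plus (T x) (opp (scal (RtoC 1) x))).
    now rewrite (@scal_one C_Ring X). }
  rewrite e1. eapply Rle_lt_trans; [apply (norm_le_minus X _ ((T - 1)%op (b z)))|].
  assert (hT1 : bnd (T - 1)%op (M ^ n + 1)) by (apply obnd_sub; auto; apply obnd_1).
  assert (h1 : norm (minus ((T - 1)%op x) ((T - 1)%op (b z))) < e / 2).
  { eapply Rle_lt_trans; [apply op_norm_minus; exact hT1|].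
    apply Rlt_le_trans with ((M ^ n + 1) * (e / (2 * (M ^ n + 1)))); [apply Rmult_lt_compat_l; lra|].
    right. field. lra. }
  assert (h2 : norm ((T - 1)%op (b z)) <= P / t).
  { change (norm (((T - 1) * b)%op z) <= P / t).
    replace ((T - 1) * b)%op with (T * b - b)%op by ring.
    eapply Rle_trans; [apply hlim; lra|]. right. unfold P. field. lra. }
  assert (h3 : P / t <= e / 2).
  { apply Rle_div_l; [lra|]. assert (h4 : 2 * P / e <= t) by lra.
    apply Rle_div_l in h4; lra. }
  lra.
Qed.

Lemma geometric_cauchy (v : nat -> X) (C rho : R) : 0 <= C -> 0 < rho < 1 ->
  (forall j, norm (minus (v (S j)) (v j)) <= C * rho ^ j) ->
  exists y, forall e, 0 < e -> exists N, forall j, (N <= j)%nat -> norm (minus (v j) y) < e.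
Proof.
  intros hC hrho hstep.
  assert (hdist : forall k j, norm (minus (v (j + k)%nat) (v j)) <= C * rho ^ j / (1 - rho)).
  { intros k j.
    assert (h : norm (minus (v (j + k)%nat) (v j)) <= C * rho ^ j * (1 - rho ^ k) / (1 - rho)).
    { induction k as [|k IH].
      - rewrite Nat.add_0_r. replace (minus (v j) (v j)) with (zero : X).
        + rewrite xnorm_zero. right. simpl. field. lra.
        + symmetry. apply xplus_opp_r.
      - rewrite Nat.add_succ_r.
        replace (minus (v (S (j + k))) (v j)) with
          (plus (minus (v (S (j + k))) (v (j + k)%nat)) (minus (v (j + k)%nat) (v j))).
        + eapply Rle_trans; [apply xnorm_plus|].
          eapply Rle_trans; [apply Rplus_le_compat; [apply hstep|exact IH]|].
          rewrite pow_add. right. simpl. field. lra.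
        + exact (minus_trans_plus (CompleteNormedModule.AbelianGroup C_AbsRing X) _ _ _). }
    eapply Rle_trans; [exact h|]. unfold Rdiv. apply Rmult_le_compat_r; [apply Rlt_le, Rinv_0_lt_compat; lra|].
    assert (0 <= rho ^ k) by (apply pow_le; lra). assert (0 <= rho ^ j) by (apply pow_le; lra).
    assert (0 <= C * rho ^ j) by nra. nra. }
  assert (hsmall : forall e, 0 < e -> exists N, C * rho ^ N / (1 - rho) < e).
  { intros e he. destruct (pow_lt_1_zero rho ltac:(rewrite Rabs_pos_eq; lra) (e * (1 - rho) / (C + 1)))
      as [N hN]; [apply Rdiv_lt_0_compat; [apply Rmult_lt_0_compat; lra|lra]|].
    exists N. specialize (hN N (le_n _)). rewrite Rabs_pos_eq in hN by (apply pow_le; lra).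
    apply Rlt_div_l; [lra|].
    apply Rlt_div_r in hN; [|lra]. assert (0 <= rho ^ N) by (apply pow_le; lra). nra. }
  destruct (proj1 (filterlim_locally_cauchy (U := X) (F := eventually) v)) as [y hy].
  { intros eps. 
    destruct (hsmall (eps / 2)) as [N hN]; [destruct eps; simpl; lra|].
    exists (fun j => (N <= j)%nat). split; [exists N; auto|].
    intros i j hi hj. apply (@norm_compat1 C_AbsRing X).
    match goal with |- norm ?m < _ => replace m with (plus (minus (v j) (v N)) (opp (minus (v i) (v N)))) end.
    - eapply Rle_lt_trans; [apply xnorm_plus|]. rewrite xnorm_opp.
      assert (h1 := hdist (j - N)%nat N). assert (h2 := hdist (i - N)%nat N).
      replace (N + (j - N))%nat with j in h1 by lia. replace (N + (i - N))%nat with i in h2 by lia.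
      eapply Rle_lt_trans; [apply Rplus_le_compat; [exact h1|exact h2]|]. lra.
    - exact (minus_minus_same (CompleteNormedModule.AbelianGroup C_AbsRing X) _ _ _). }
  exists y. intros e he.
  assert (he' : 0 < e / @norm_factor C_AbsRing X) by (apply Rdiv_lt_0_compat; auto; apply norm_factor_gt_0).
  destruct (hy _ (locally_ball y (mkposreal _ he'))) as [N hN].
  exists N. intros j hj. specialize (hN j hj).
  apply (@norm_compat2 C_AbsRing X) in hN. simpl in hN.
  replace (norm_factor * (e / norm_factor)) with e in hN; [exact hN|].
  field. apply Rgt_not_eq, norm_factor_gt_0.
Qed.

(** Put [V_u = A^g (u R_u)^n] with [n > Re g + 1]. The increment
    [(V_(2u) - V_u) x] is a bounded operator applied to
    [u^n A^(g+1) (u + A)^(-n-1) x], and so is [O(u^(Re g - s'))] for any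
    [s' <= s] with [Re g < s' < Re g + 1]. The limit [y] of [V_u x]
    satisfies [A^(-g) y = x], as [(u R_u)^n x -> x] on the closure of the
    domain. *)
Lemma negative_power_preimage q s th a c g x M : Rbar_lt (Finite 0) q -> 0 < th -> Cplus_star a ->
  0 < Re g < s -> s < Re c -> dom_closure x -> 0 <= M -> lq_le q (besov_term s th a c x) M ->
  exists y, dom_closure y /\ J g 0 y = x.
Proof.
  intros hq hth ha hg hc hx hM hl.
  (* the exponent [g + 1] below has to exceed the smoothness *)
  set (s' := Rmin s (Re g + 1 / 2)).
  assert (hs' : Re g < s' /\ s' <= s /\ s' < Re g + 1).
  { unfold s'. split; [apply Rmin_glb_lt; lra|]. split; [apply Rmin_l|].
    eapply Rle_lt_trans; [apply Rmin_r|lra]. }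
  destruct hs' as [hs1 [hs2 hs3]].
  (* only the decay of the single terms is used, hence [q] is replaced by
     infinity *)
  assert (h1 : lq_le p_infty (besov_term s' th a c x) (Rpower th (s' - s) * M)).
  { intros j. assert (h0 := lq_le_term q hq _ M j (besov_term_ge_0 s th a c x) hM hl).
    unfold besov_term in *. replace (s' + Re a) with (s' - s + (s + Re a)) by ring.
    rewrite Rpower_plus, Rmult_assoc.
    apply Rmult_le_compat; auto; [apply Rlt_le, Rpower_pos| |].
    - apply Rmult_le_pos; [apply Rlt_le, Rpower_pos|apply xnorm_ge_0].
    - apply Rle_Rpower_neg; [lra|]. split; auto. apply tscale_ge; auto. }
  destruct (nfloor_ex (Re g + 1)) as [n0 [_ hn]]; [lra|]. rewrite <- S_INR in hn.
  set (n := S n0) in *.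
  set (d := Cminus (RtoC (INR n)) g).
  assert (hd : 0 < Re d) by (unfold d; rewrite Re_minus, Re_R; lra).
  assert (hds : Cplus_star d) by now left.
  destruct (dominates_exponents p_infty I s' th a c d (Cplus g (RtoC 1))) as [C [hC hdom]]; auto; try lra.
  set (M' := C * (Rpower th (s' - s) * M)).
  assert (hM' : 0 <= M').
  { unfold M'. apply Rmult_le_pos; auto. apply Rmult_le_pos; auto. apply Rlt_le, Rpower_pos. }
  assert (h2 : forall j, besov_term s' th d (Cplus g (RtoC 1)) x j <= M').
  { apply (hdom x hx _); auto. apply Rmult_le_pos; auto. apply Rlt_le, Rpower_pos. }
  destruct (Y_bound X D (RtoC 1)) as [K1 [hK1 hY1]]; [rewrite Re_R; lra|].
  destruct (Ogeom_bound X D (2 * K1) n ltac:(lra)) as [G [hG hgeom]].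
  set (V := fun u => (sc (RtoC u) ^ n * besov_op d g u)%op).
  assert (hV : forall u, 0 <= u -> (J g 0%R * V u = (sc (RtoC u) * r u) ^ n)%op).
  { intros u hu. unfold V. transitivity (sc (RtoC u) ^ n * (J g 0%R * besov_op d g u))%op; [ring|].
    rewrite besov_op_spec by (auto; lra). replace (Cplus g d) with (RtoC (INR n)) by (unfold d; ring).
    rewrite J_nat by (auto; unfold n; lia). now rewrite Opow_mul. }
  assert (hstep : forall u, 0 < u -> norm (minus (V (2 * u) x) (V u x)) <=
     G * K1 * (u ^ n * norm (besov_op d (Cplus g (RtoC 1)) u x))).
  { intros u hu.
    set (y := Y (RtoC 1) u (2 * u)).
    assert (hy : bnd y K1) by (apply hY1; lra).
    set (w := (sc (RtoC 2) * y)%op).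
    assert (hw : bnd w (2 * K1)) by (apply obnd_mul; auto; apply obnd_scr; lra).
    assert (h2u : (sc (RtoC (2 * u)) * r (2 * u)%R = sc (RtoC u) * r u * w)%op).
    { unfold w. rewrite RtoC_mult, Osc_mult.
      assert (e : (r u * y = r (2 * u)%R)%op) by (apply Or_Y1; lra).
      rewrite <- e. ring. }
    assert (hyw : (w - 1 = (1 - sc (RtoC u) * r u) * y)%op) by (apply Y1_double_scaled; lra).
    assert (hE : (V (2 * u)%R - V u = Ogeom X D w n * y * sc (RtoC u) ^ n * besov_op d (Cplus g (RtoC 1)) u)%op).
    { rewrite besov_op_succ_c by lra. apply (J_reg X D g 0); try lra.
      transitivity (J g 0%R * V (2 * u)%R - J g 0%R * V u)%op; [ring|].
      rewrite !hV, h2u, (Opow_mul X D (sc (RtoC u) * r u)%op w) by lra.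
      transitivity ((sc (RtoC u) * r u) ^ n * (- ((1 - w) * Ogeom X D w n)))%op; [rewrite Ogeom_spec; ring|].
      transitivity ((sc (RtoC u) * r u) ^ n * ((w - 1) * Ogeom X D w n))%op; [ring|].
      rewrite hyw, <- hV by lra. unfold V. ring. }
    assert (e1 : minus (V (2 * u) x) (V u x) = (V (2 * u)%R - V u)%op x) by reflexivity.
    rewrite e1, hE. set (F := besov_op d (Cplus g (RtoC 1)) u).
    change (norm ((Ogeom X D w n * y * sc (RtoC u) ^ n)%op (F x)) <= G * K1 * (u ^ n * norm (F x))).
    eapply Rle_trans.
    - apply (obnd_mul X D _ _ (G * K1) (u ^ n)).
      + apply obnd_mul; auto.
      + apply obnd_pow, obnd_scr. lra.
    - right. ring. }
  set (rho := Rpower 2 (- (s' - Re g))).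
  assert (hrho : 0 < rho < 1) by (apply Rpower_2_small; lra).
  set (P := G * K1 * (M' * Rpower th (- (s' - Re g)))).
  assert (hP : 0 <= P).
  { unfold P. apply Rmult_le_pos; [apply Rmult_le_pos; lra|].
    apply Rmult_le_pos; [exact hM'|apply Rlt_le, Rpower_pos]. }
  destruct (geometric_cauchy (fun j => V (tscale th j) x) P rho hP hrho) as [y hy].
  { intros j. set (u := tscale th j). assert (hu : 0 < u) by (apply tscale_pos; auto).
    rewrite tscale_S. fold u. eapply Rle_trans; [apply hstep; auto|].
    unfold P. rewrite !Rmult_assoc. apply Rmult_le_compat_l; auto. apply Rmult_le_compat_l; [lra|].
    assert (h3 := h2 j). unfold besov_term in h3. fold u in h3.
    rewrite <- Rpower_pow by auto.
    replace (INR n) with (- (s' - Re g) + (s' + Re d)).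
    2:{ unfold d. rewrite Re_minus, Re_R. ring. }
    rewrite Rpower_plus.
    replace (Rpower th (- (s' - Re g)) * rho ^ j) with (Rpower u (- (s' - Re g))).
    - rewrite (Rmult_comm M'), Rmult_assoc. apply Rmult_le_compat_l; auto. apply Rlt_le, Rpower_pos.
    - unfold u, tscale, rho. rewrite Rpower_nat_pow, <- Rpower_mult_distr; auto; [|apply pow_lt; lra].
      f_equal. rewrite <- Rpower_pow, Rpower_mult by lra. reflexivity. }
  exists y. split.
  - intros e he. destruct (hy (e / 2)) as [N hN]; [lra|]. specialize (hN N (le_n _)).
    destruct (dom_closure_op X D (V (tscale th N)) x hx (e / 2)) as [z hz]; [lra|].
    exists z. set (v := V (tscale th N) x) in *.
    replace (minus y (b z)) with (plus (minus v (b z)) (opp (minus v y))).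
    + eapply Rle_lt_trans; [apply xnorm_plus|]. rewrite xnorm_opp. lra.
    + exact (minus_minus_same' (CompleteNormedModule.AbelianGroup C_AbsRing X) _ _ _).
  - destruct (op_bdd _ _ (J g 0)) as [N hN]. assert (hN0 : 0 <= N) by apply hN.
    assert (h0 : minus (J g 0 y) x = zero).
    { apply xnorm_eq_0. apply Rle_antisym; [|apply xnorm_ge_0].
      apply le_epsilon. intros e he. rewrite Rplus_0_l.
      destruct (hy (e / (2 * (N + 1)))) as [N1 hN1]; [apply Rdiv_lt_0_compat; lra|].
      destruct (Or_scaled_strong n x (e / 2) hx ltac:(lra)) as [U [hU1 hU]].
      destruct (tscale_unbounded th hth U) as [m hm].
      set (j := Nat.max N1 m).
      assert (hj : U <= tscale th j) by (apply hm; unfold j; lia).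
      specialize (hN1 j ltac:(unfold j; lia)). specialize (hU _ hj).
      set (u := tscale th j) in *. assert (hu : 0 < u) by (apply tscale_pos; auto).
      rewrite <- hV in hU by lra. change ((J g 0 * V u)%op x) with (J g 0 (V u x)) in hU.
      set (v := V u x) in *.
      replace (minus (J g 0 y) x) with (plus (minus (J g 0 v) x) (opp (minus (J g 0 v) (J g 0 y)))).
      - eapply Rle_trans; [apply xnorm_plus|]. rewrite xnorm_opp.
        assert (h6 := op_norm_minus X D (J g 0) v y N hN).
        assert (h7 : N * norm (minus v y) <= e / 2).
        { apply Rle_trans with (N * (e / (2 * (N + 1)))); [apply Rmult_le_compat_l; lra|].
          apply Rle_trans with ((N + 1) * (e / (2 * (N + 1)))); [|right; field; lra].
          apply Rmult_le_compat_r; [|lra]. apply Rdiv_le_0_compat; lra. }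
        lra.
      - exact (minus_minus_same' (CompleteNormedModule.AbelianGroup C_AbsRing X) _ _ _). }
    rewrite <- (minus_plus_cancel (CompleteNormedModule.AbelianGroup C_AbsRing X) (J g 0 y) x).
    transitivity (plus (zero : X) x); [|apply plus_zero_l].
    f_equal. exact h0.
Qed.

End Equivalence.

(** * The resolvents of a positive operator *)

Section PositiveOperator.

Variable X : CompleteNormedModule C_AbsRing.
Variable A : operator X.
Hypothesis hA : positive_operator A.

Lemma positive_resolvent (t : R) : 0 <= t -> bounded_operator (op_inv (op_shift (RtoC t) A)).
Proof.
  intros [ht|ht].
  - assert (h := nonneg_resolvent (proj1 hA) (l := - t) ltac:(lra)). unfold in_resolvent_set in h.
    replace (Copp (RtoC (- t))) with (RtoC t) in h; auto.
    rewrite RtoC_opp. ring.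
  - subst t. assert (h := proj2 hA). unfold in_resolvent_set in h.
    replace (Copp (RtoC 0)) with (RtoC 0) in h; auto. ring.
Qed.

Definition res (t : R) (x : X) : X := iota (fun y => op_shift (RtoC t) A y x).

Lemma res_iff t x y : 0 <= t -> (op_shift (RtoC t) A y x <-> y = res t x).
Proof.
  intros ht. destruct (positive_resolvent t ht) as [h _].
  destruct (h x) as [z [hz huniq]]. unfold op_inv in *.
  assert (e : res t x = z).
  { unfold res. apply (iota_unique (fun y => op_shift (RtoC t) A y x)); auto.
    intros w hw. symmetry. now apply huniq. }
  rewrite e. split; intros k; [symmetry; now apply huniq|subst; auto].
Qed.

Lemma A_iff x y : A y x <-> y = res 0 x.
Proof.
  rewrite <- res_iff by lra. unfold op_shift. split.
  - intros h. exists x. split; auto. now rewrite xscal_0_l, plus_zero_l.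
  - intros [z [h e]]. rewrite xscal_0_l, plus_zero_l in e. now subst.
Qed.

Lemma res_lin t : 0 <= t -> linear_map (res t).
Proof.
  intros ht. assert (hl := nonneg_linear (proj1 hA)).
  split.
  - intros x y. symmetry. apply res_iff; auto.
    destruct (proj2 (res_iff t x (res t x) ht) eq_refl) as [x' [h1 e1]].
    destruct (proj2 (res_iff t y (res t y) ht) eq_refl) as [y' [h2 e2]].
    exists (plus x' y'). split; [now apply (Defs.linear_plus hl)|].
    rewrite xscal_plus. rewrite e1 at 1. rewrite e2 at 1. apply xplus_swap.
  - intros z x. symmetry. apply res_iff; auto.
    destruct (proj2 (res_iff t x (res t x) ht) eq_refl) as [x' [h1 e1]].
    exists (scal z x'). split; [now apply (Defs.linear_scal hl)|].
    rewrite e1 at 1. rewrite xscal_plus, !xscal_mult. f_equal. f_equal. apply Cmult_comm.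
Qed.

Lemma res_bdd t : 0 <= t -> exists M, bnd (res t) M.
Proof.
  intros ht. destruct (positive_resolvent t ht) as [_ [M hM]].
  exists (Rmax 0 M). split; [apply Rmax_l|]. intros x.
  eapply Rle_trans; [apply (hM x (res t x))|].
  - apply res_iff; auto.
  - apply Rmult_le_compat_r; [apply xnorm_ge_0|apply Rmax_r].
Qed.

Definition positive_resolvents : resolvents X.
Proof.
  refine (Build_resolvents X (res 0) res (res_lin 0 (Rle_refl 0)) (res_bdd 0 (Rle_refl 0))
    _ res_lin res_bdd _ _ _).
  - intros x hx. symmetry in hx. apply A_iff in hx.
    exact (Defs.linear_functional (nonneg_linear (proj1 hA)) _ _ _ hx (Defs.linear_zero (nonneg_linear (proj1 hA)))).
  - intros t x ht. set (y := res t x).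
    destruct (proj2 (res_iff t x y ht) eq_refl) as [y' [h1 e1]].
    rewrite e1. destruct (res_lin 0 (Rle_refl 0)) as [l1 l2]. rewrite l1, l2.
    apply A_iff in h1. rewrite <- h1. apply plus_comm.
  - intros t x ht. symmetry. apply res_iff; auto. exists x. split; [now apply A_iff|].
    apply plus_comm.
  - destruct (nonneg_bound (proj1 hA)) as [M hM]. exists M. intros t x ht. apply hM; auto.
    apply res_iff; lra || auto.
Defined.

End PositiveOperator.

(** * The fractional powers and the family [J] *)

Section Translation.

Variable X : CompleteNormedModule C_AbsRing.
Variable D : resolvents X.
Notation XR := (real_CompleteNormedModule X).
Notation Op := (Op X D).
Notation r := (@Or X D).
Notation b := (@Ob X D).
Notation sc := (@Osc X D).
Notation J := (J X D).
Notation Jz := (Jz X D).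
Notation besov_op := (besov_op X D).

Add Ring OpRing12 : (Op_ring_theory X D).

(** [T] is the operator [t + A], where [A] is the inverse of [rb D]. *)
Definition shifted (T : operator X) (t : R) : Prop := forall x y, T x y <-> x = r t y.

Definition graph (T : operator X) (S : Op) : Prop := forall x y, T x y <-> y = S x.

Lemma op_iter_graph T S n : graph T S -> graph (op_iter T n) (S ^ n)%op.
Proof.
  intros h. induction n as [|n IH]; intros x y; cbn [op_iter Opow].
  - unfold op_id. change ((1%op : Op) x) with (scal (RtoC 1) x). now rewrite xscal_1_l.
  - change ((S * S ^ n)%op x) with (S ((S ^ n)%op x)). unfold op_comp. split.
    + intros [z [h1 h2]]. apply IH in h1. apply h in h2. now subst.
    + intros e. exists ((S ^ n)%op x). split; [now apply IH|now apply h].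
Qed.

Lemma op_comp_graph T T' S S' : graph T S -> graph T' S' -> graph (op_comp T T') (S * S')%op.
Proof.
  intros h h' x y. change ((S * S')%op x) with (S (S' x)). unfold op_comp. split.
  - intros [z [h1 h2]]. apply h' in h1. apply h in h2. now subst.
  - intros e. exists (S' x). split; [now apply h'|now apply h].
Qed.

Lemma op_app_graph T S x : graph T S -> op_app T x = S x.
Proof.
  intros h. unfold op_app. apply iota_unique.
  - intros y hy. now apply h.
  - now apply h.
Qed.

Lemma graph_inverse T S E (l : R) : graph T S -> ((sc (RtoC l) + S) * E = 1)%op ->
  graph (op_inv (op_shift (RtoC l) T)) E.
Proof.
  intros h hE x y. unfold op_inv, op_shift.
  assert (hx : forall z, (sc (RtoC l) + S)%op (E z) = z).
  { intros z. change (((sc (RtoC l) + S) * E)%op z = z). rewrite hE. apply xscal_1_l. }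
  assert (hy : forall z, E ((sc (RtoC l) + S)%op z) = z).
  { intros z. change ((E * (sc (RtoC l) + S))%op z = z). 
    replace (E * (sc (RtoC l) + S))%op with ((sc (RtoC l) + S) * E)%op by ring. rewrite hE. apply xscal_1_l. }
  split.
  - intros [y' [h1 e]]. apply h in h1. subst y'. rewrite e.
    change (y = E ((sc (RtoC l) + S)%op y)). now rewrite hy.
  - intros e. subst y. exists (S (E x)). split; [now apply h|].
    change (x = (sc (RtoC l) + S)%op (E x)). now rewrite hx.
Qed.

Lemma J_inj a t y z : 0 < Re a -> 0 <= t -> J a t y = J a t z -> y = z.
Proof.
  intros ha ht h.
  assert (h0 : minus y z = zero).
  { apply (J_zero_inj X D a t); auto. unfold minus. rewrite op_lin_plus, op_lin_opp, h. apply xplus_opp_r. }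
  rewrite <- (minus_plus_cancel (CompleteNormedModule.AbelianGroup C_AbsRing X) y z).
  transitivity (plus (zero : X) z); [f_equal; exact h0|apply plus_zero_l].
Qed.

Lemma shifted_inverse T t : 0 <= t -> shifted T t -> in_resolvent_set T (RtoC 0).
Proof.
  intros ht hT. unfold in_resolvent_set.
  replace (Copp (RtoC 0)) with (RtoC 0) by ring.
  assert (h : forall x y, op_inv (op_shift (RtoC 0) T) x y <-> y = r t x).
  { intros x y. unfold op_inv, op_shift. rewrite <- (hT y x). split.
    - intros [z [h e]]. rewrite xscal_0_l, plus_zero_l in e. now subst.
    - intros h. exists x. split; auto. now rewrite xscal_0_l, plus_zero_l. }
  split.
  - intros x. exists (r t x). split; [now apply h|]. intros y hy. symmetry. now apply h.
  - destruct (op_bdd _ _ (r t)) as [M [_ hM]]. exists M. intros x y hy. apply h in hy. subst. apply hM.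
Qed.

(** Boundedness of [A] decides which case of the definition of the fractional
    powers applies; in the ring it means that [R_t] is a unit. *)
Lemma shifted_bounded T t : 0 <= t -> shifted T t ->
  (bounded_operator T <-> exists S : Op, (r t * S = 1)%op).
Proof.
  intros ht hT. split.
  - intros [h [M hM]].
    assert (hS : exists S : X -> X, forall x, T x (S x)).
    { exists (fun x => iota (T x)). intros x. apply iota_correct. apply h. }
    destruct hS as [S hS].
    assert (hr : forall x, r t (S x) = x) by (intros x; symmetry; apply hT, hS).
    assert (hinj : forall y z, r t y = r t z -> y = z).
    { intros y z e. destruct (h (r t y)) as [w [_ hw]].
      transitivity w; [symmetry|]; apply hw; apply hT; auto. }
    assert (hl : linear_map S).
    { split; intros; apply hinj; rewrite ?op_lin_plus, ?op_lin_scal, !hr; auto. }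
    assert (hb : exists M, bnd S M).
    { exists (Rmax 0 M). split; [apply Rmax_l|]. intros x. eapply Rle_trans; [apply (hM x), hS|].
      apply Rmult_le_compat_r; [apply xnorm_ge_0|apply Rmax_r]. }
    assert (hc : forall U : X -> X, linear_map U -> (exists M, bnd U M) ->
      (forall x, U (rb D x) = rb D (U x)) -> forall x, U (S x) = S (U x)).
    { intros U h1 h2 h3 x. apply hinj. rewrite hr, <- (op_comm _ _ (r t) U) by auto. now rewrite hr. }
    exists (mkOp S hl hb hc). apply op_eq. intros x. simpl fn at 2.
    change (r t (S x) = scal (RtoC 1) x). now rewrite hr, xscal_1_l.
  - intros [S hS].
    assert (h : forall x y, T x y <-> y = S x).
    { intros x y. rewrite (hT x y). split; intros e; subst.
      - change (y = (S * r t)%op y). replace (S * r t)%op with (r t * S)%op by ring. rewrite hS.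
        symmetry. apply xscal_1_l.
      - change (x = (r t * S)%op x). rewrite hS. symmetry. apply xscal_1_l. }
    split.
    + intros x. exists (S x). split; [now apply h|]. intros y hy. symmetry. now apply h.
    + destruct (op_bdd _ _ S) as [M [_ hM]]. exists M. intros x y hy. apply h in hy. subst. apply hM.
Qed.

Lemma bounded_shift t : 0 <= t -> ((exists S : Op, (r t * S = 1)%op) <-> (exists S : Op, (b * S = 1)%op)).
Proof.
  intros ht. split; intros [S hS].
  - exists (S - sc (RtoC t))%op.
    transitivity ((r t + sc (RtoC t) * b * r t) * S - sc (RtoC t) * b)%op; [rewrite Or_spec by auto; ring|].
    transitivity (r t * S + sc (RtoC t) * b * (r t * S) - sc (RtoC t) * b)%op; [ring|]. rewrite hS. ring.
  - exists (S + sc (RtoC t))%op.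
    transitivity ((r t + sc (RtoC t) * b * r t) * S + (sc (RtoC t) * r t) * (1 - b * S))%op; [ring|].
    rewrite Or_spec, hS by auto. ring.
Qed.

(** The constant in front of the integral that defines a fractional power. *)
Definition gamma_const (a : C) : C :=
  Cdiv (CGamma (RtoC (INR (pexp a)))) (Cmult (CGamma a) (CGamma (Cminus (RtoC (INR (pexp a))) a))).

Lemma Cinv_neq_0 (z : C) : z <> RtoC 0 -> Cinv z <> RtoC 0.
Proof.
  intros h e. assert (h1 := Cinv_l z h). rewrite e, Cmult_0_l in h1.
  assert (h2 : 0 = 1) by (apply RtoC_inj; auto). lra.
Qed.

Lemma gamma_const_neq_0 a : 0 < Re a -> gamma_const a <> RtoC 0.
Proof.
  intros ha. assert (hn := pexp_spec a ha). unfold gamma_const, Cdiv.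
  apply Cmult_neq_0; [apply CGamma_neq_0; rewrite Re_R; lra|].
  apply Cinv_neq_0, Cmult_neq_0; apply CGamma_neq_0; auto. rewrite Re_minus, Re_R. lra.
Qed.

Lemma xint_unique (f g : R -> X) (v w : X) : (forall z, 0 < z -> f z = g z) ->
  int0oo (f : R -> XR) (v : XR) ->
  int0oo (g : R -> XR) (w : XR) -> v = w.
Proof.
  intros h hf hg. apply (int0oo_unique XR g); auto. now apply (int0oo_ext XR f).
Qed.

Definition bounded_const (a : C) : C :=
  Cmult (gamma_const a) (kconst (pexp a) (Cminus (RtoC (INR (pexp a))) a)).

Definition unbounded_const (a : C) : C := Cmult (gamma_const a) (kconst (pexp a) a).

(** The defining integral is [(t + A)^n] times the Balakrishnan integral of
    [(t + A)^(a-n)], hence a multiple of [(t + A)^n J (n-a) t], the inverse of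
    [J a t]. *)
Lemma fpow_bounded_iff T t a S x y : 0 <= t -> 0 < Re a -> shifted T t -> (r t * S = 1)%op ->
  (fpow_bounded T a x y <-> J a t y = scal (bounded_const a) x).
Proof.
  intros ht ha hT hS. assert (hn := pexp_spec a ha).
  set (n := pexp a) in *. set (d := Cminus (RtoC (INR n)) a).
  assert (hd : 0 < Re d < INR n) by (unfold d; rewrite Re_minus, Re_R; lra).
  assert (hn0 : (0 < n)%nat) by (apply INR_lt; simpl; lra).
  assert (hg : graph T S).
  { intros u v. rewrite (hT u v). split; intros e; subst.
    - change (v = (S * r t)%op v). replace (S * r t)%op with (r t * S)%op by ring. rewrite hS.
      symmetry. apply xscal_1_l.
    - change (u = (r t * S)%op u). rewrite hS. symmetry. apply xscal_1_l. }
  assert (hinv : forall l, 0 < l -> graph (op_inv (op_shift (RtoC l) T)) (r (t + l))).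
  { intros l hl. apply (graph_inverse T S); auto. apply (Or_reg X D t); auto.
    transitivity ((sc (RtoC l) * r t + r t * S) * r (t + l))%op; [ring|]. rewrite hS.
    assert (e := Or_resolvent X D t (t + l) ht ltac:(lra)). replace (t + l - t) with l in e by ring.
    apply Osub_eq. transitivity (sc (RtoC l) * r t * r (t + l) - (r t - r (t + l)))%op; [ring|]. rewrite e. ring. }
  assert (hint : forall l, 0 < l ->
     scal (Cdiv (rcpow l a) (RtoC l)) (op_app (op_comp (op_iter T n) (op_iter (op_inv (op_shift (RtoC l) T)) n)) x)
      = (S ^ n * kern X D n d t l)%op x).
  { intros l hl. rewrite (op_app_graph _ (S ^ n * r (t + l) ^ n)%op).
    - unfold kern. replace (kexp n d) with (Cminus a (RtoC 1)) by (unfold kexp, d; ring).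
      rewrite rcpow_minus_1 by auto.
      change ((sc (Cdiv (rcpow l a) (RtoC l)) * (S ^ n * r (t + l) ^ n))%op x =
         (S ^ n * (sc (Cdiv (rcpow l a) (RtoC l)) * r (t + l) ^ n))%op x).
      apply (f_equal (fun U : Op => U x)). ring.
    - apply op_comp_graph; apply op_iter_graph; auto. }
  destruct (Kfam_spec X D n d hd) as [C0 [_ hK]]. destruct (hK t ht) as [hK1 _].
  assert (hI := oint_mul X D (S ^ n)%op _ _ hK1 x).
  assert (hval : (J a t * (S ^ n * Kfam X D n d t) = sc (kconst n d))%op).
  { rewrite Kfam_J by auto.
    transitivity (sc (kconst n d) * S ^ n * (J a t * J d t))%op; [ring|].
    rewrite <- J_plus by (auto; lra). replace (Cplus a d) with (RtoC (INR n)) by (unfold d; ring).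
    rewrite J_nat by auto.
    transitivity (sc (kconst n d) * (r t * S) ^ n)%op; [rewrite Opow_mul; ring|]. rewrite hS.
    clear. induction n; cbn [Opow]; [ring|]. transitivity (sc (kconst (Datatypes.S n) d))%op; [|reflexivity].
    assert (h1 : forall m, ((1 : Op) ^ m = 1)%op) by (induction m; cbn [Opow]; [ring|rewrite IHm; ring]).
    rewrite h1. ring. }
  assert (hJv : forall c, J a t (scal c ((S ^ n * Kfam X D n d t)%op x)) = scal (Cmult c (kconst n d)) x).
  { intros c. rewrite op_lin_scal. 
    change (J a t ((S ^ n * Kfam X D n d t)%op x)) with ((J a t * (S ^ n * Kfam X D n d t))%op x).
    rewrite hval. apply xscal_mult. }
  unfold fpow_bounded. change (Z.to_nat (up (Re a))) with n.
  change (Cdiv (CGamma (RtoC (INR n))) (Cmult (CGamma a) (CGamma (Cminus (RtoC (INR n)) a)))) with (gamma_const a).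
  unfold bounded_const. fold n d. split.
  - intros [v [h1 h2]].
    assert (hv : v = (S ^ n * Kfam X D n d t)%op x) by exact (xint_unique _ _ _ _ hint h1 hI).
    rewrite h2, hv. apply hJv.
  - intros h. exists ((S ^ n * Kfam X D n d t)%op x). split.
    + revert hI. apply (int0oo_ext XR). intros l hl. symmetry. now apply hint.
    + apply (J_inj a t); auto. rewrite h, hJv. reflexivity.
Qed.

(** For the inverse [R_t] of [t + A], the resolvent at [l] is
    [(1/l) (1 - R_(t+1/l) / l)], and multiplying by [R_t] leaves [R_(t+1/l) / l]; the
    substitution [z = 1/l] gives the Balakrishnan integral of [J a t]. *)
Lemma fpow_bounded_inv_iff T t a x y : 0 <= t -> 0 < Re a -> shifted T t ->
  (fpow_bounded (op_inv T) a y x <-> x = scal (unbounded_const a) (J a t y)).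
Proof.
  intros ht ha hT. assert (hn := pexp_spec a ha).
  set (n := pexp a) in *.
  assert (hn' : 0 < Re a < INR n) by lra.
  assert (hg : graph (op_inv T) (r t)).
  { intros u v. unfold op_inv. apply hT. }
  set (E := fun l => (sc (RtoC (/ l)) * (1 - sc (RtoC (/ l)) * r (t + / l)))%op).
  assert (hres : forall l, 0 < l -> (r t - r (t + / l) = sc (RtoC (/ l)) * r t * r (t + / l))%op).
  { intros l hl. assert (h := Rinv_0_lt_compat l hl).
    rewrite Or_resolvent by lra. replace (t + / l - t) with (/ l) by ring. reflexivity. }
  assert (hunit : forall l, 0 < l -> (sc (RtoC l) * sc (RtoC (/ l)) = 1)%op).
  { intros l hl. rewrite <- Osc_mult, <- RtoC_mult, Rinv_r by lra. reflexivity. }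
  assert (hinv : forall l, 0 < l -> graph (op_inv (op_shift (RtoC l) (op_inv T))) (E l)).
  { intros l hl. apply (graph_inverse (op_inv T) (r t)); auto. unfold E.
    transitivity ((sc (RtoC l) * sc (RtoC (/ l)) + sc (RtoC (/ l)) * r t) * (1 - sc (RtoC (/ l)) * r (t + / l)))%op; [ring|].
    rewrite hunit by auto. apply Osub_eq.
    transitivity (sc (RtoC (/ l)) * (r t - r (t + / l) - sc (RtoC (/ l)) * r t * r (t + / l)))%op; [ring|].
    rewrite hres by auto. ring. }
  assert (hrE : forall l, 0 < l -> (r t * E l = sc (RtoC (/ l)) * r (t + / l))%op).
  { intros l hl. unfold E. apply Osub_eq.
    transitivity (sc (RtoC (/ l)) * (r t - r (t + / l) - sc (RtoC (/ l)) * r t * r (t + / l)))%op; [ring|].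
    rewrite hres by auto. ring. }
  destruct (Kfam_spec X D n a hn') as [C0 [_ hK]]. destruct (hK t ht) as [hK1 _].
  assert (hI := int0oo_inv XR _ _ (fun z hz => pcont_kern X D n a t z ht hz y) (hK1 y)).
  assert (hint : forall l, 0 < l ->
     scal (Cdiv (rcpow l a) (RtoC l)) (op_app (op_comp (op_iter (op_inv T) n)
        (op_iter (op_inv (op_shift (RtoC l) (op_inv T))) n)) y)
      = scal (RtoC (/ l ^ 2)) (kern X D n a t (/ l) y)).
  { intros l hl. assert (hli := Rinv_0_lt_compat l hl).
    rewrite (op_app_graph _ (r t ^ n * E l ^ n)%op).
    - rewrite <- Opow_mul, hrE, Opow_mul, Osc_pow by auto. unfold kern.
      assert (hs : Cmult (Cdiv (rcpow l a) (RtoC l)) (RtoC ((/ l) ^ n)) =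
         Cmult (RtoC (/ l ^ 2)) (rcpow (/ l) (kexp n a))).
      { unfold kexp. rewrite rcpow_minus_1 by auto. unfold Cminus. rewrite rcpow_plus, rcpow_pow by auto.
        rewrite rcpow_inv by auto. replace (Copp (Copp a)) with a by ring.
        unfold Cdiv. rewrite <- !RtoC_inv by (try apply Rinv_neq_0_compat; lra). rewrite Rinv_inv.
        replace (/ l ^ 2) with (/ l * / l) by (field; lra). rewrite RtoC_mult.
        assert (hll : Cmult (RtoC (/ l)) (RtoC l) = RtoC 1) by (rewrite <- RtoC_mult, Rinv_l; auto; lra).
        transitivity (Cmult (Cmult (Cmult (RtoC (/ l)) (RtoC l)) (RtoC (/ l))) (Cmult (RtoC ((/ l) ^ n)) (rcpow l a))).
        - rewrite hll. ring.
        - ring. }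
      change ((sc (Cdiv (rcpow l a) (RtoC l)) * (sc (RtoC ((/ l) ^ n)) * r (t + / l) ^ n))%op y =
        (sc (RtoC (/ l ^ 2)) * (sc (rcpow (/ l) (kexp n a)) * r (t + / l) ^ n))%op y).
      apply (f_equal (fun U : Op => U y)).
      transitivity (sc (Cmult (Cdiv (rcpow l a) (RtoC l)) (RtoC ((/ l) ^ n))) * r (t + / l) ^ n)%op.
      + rewrite Osc_mult. ring.
      + rewrite hs, Osc_mult. ring.
    - apply op_comp_graph; apply op_iter_graph; auto. }
  unfold fpow_bounded. change (Z.to_nat (up (Re a))) with n.
  change (Cdiv (CGamma (RtoC (INR n))) (Cmult (CGamma a) (CGamma (Cminus (RtoC (INR n)) a)))) with (gamma_const a).
  unfold unbounded_const. fold n.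
  assert (hval : forall c, scal c (Kfam X D n a t y) = scal (Cmult c (kconst n a)) (J a t y)).
  { intros c. rewrite Kfam_J by auto. apply xscal_mult. }
  split.
  - intros [v [h1 h2]].
    assert (hv : v = Kfam X D n a t y) by exact (xint_unique _ _ _ _ hint h1 hI).
    rewrite h2, hv. apply hval.
  - intros h. exists (Kfam X D n a t y). split.
    + revert hI. apply (int0oo_ext XR). intros l hl. symmetry. now apply hint.
    + rewrite h, hval. reflexivity.
Qed.

(** The same factor [kap a] serves all shifts [t], so that it cancels or factors
    out in the compositions that define the Besov quasi-norms. *)
Lemma fpow_J : exists kap : C -> C, (forall a, 0 < Re a -> kap a <> RtoC 0) /\
  forall T t a x y, 0 <= t -> 0 < Re a -> shifted T t ->
    (fpow T a x y <-> x = scal (kap a) (J a t y)).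
Proof.
  destruct (classic (exists S : Op, (b * S = 1)%op)) as [hb|hb].
  - exists (fun a => Cinv (bounded_const a)).
    assert (hne : forall a, 0 < Re a -> bounded_const a <> RtoC 0).
    { intros a ha. assert (hn := pexp_spec a ha). apply Cmult_neq_0; [now apply gamma_const_neq_0|].
      apply kconst_neq_0. rewrite Re_minus, Re_R. lra. }
    split; [intros a ha; apply Cinv_neq_0; auto|].
    intros T t a x y ht ha hT.
    assert (hB : bounded_operator T) by (apply (shifted_bounded T t ht hT), bounded_shift; auto).
    destruct (proj2 (bounded_shift t ht) hb) as [S hS].
    assert (h := fpow_bounded_iff T t a S x y ht ha hT hS).
    transitivity (fpow_bounded T a x y).
    + unfold fpow, fpow_regular. tauto.
    + rewrite h. split; intros e.
      * rewrite e, xscal_mult, Cinv_l by auto. symmetry. apply xscal_1_l.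
      * rewrite e, xscal_mult, Cinv_r by auto. symmetry. apply xscal_1_l.
  - exists unbounded_const. split.
    { intros a ha. assert (hn := pexp_spec a ha). apply Cmult_neq_0; [now apply gamma_const_neq_0|].
      apply kconst_neq_0. lra. }
    intros T t a x y ht ha hT.
    assert (hB : ~ bounded_operator T).
    { intros h. apply hb. apply (bounded_shift t ht), (shifted_bounded T t ht hT), h. }
    assert (h0 := shifted_inverse T t ht hT).
    rewrite <- fpow_bounded_inv_iff with (T := T) by auto.
    unfold fpow, fpow_regular. unfold op_inv at 1. tauto.
Qed.

End Translation.

(** * Besov spaces and the isomorphism [A^(-g)] *)

Lemma lq_le_mono q (a : nat -> R) M M' : Rbar_lt (Finite 0) q -> 0 <= M <= M' -> lq_le q a M -> lq_le q a M'.
Proof.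
  intros hq hM h. destruct q as [r| |]; simpl in *; [| |tauto].
  - intros n. eapply Rle_trans; [apply h|]. apply nnpow_le; auto.
  - intros j. eapply Rle_trans; [apply h|]. lra.
Qed.

Lemma lq_norm_scal q (a : nat -> R) c : Rbar_lt (Finite 0) q -> 0 <= c -> (forall j, 0 <= a j) ->
  Rbar_lt (lq_norm q a) p_infty -> real (lq_norm q (fun j => c * a j)) = c * real (lq_norm q a).
Proof.
  intros hq hc ha h.
  destruct (lq_norm_finite q hq a ha h) as [h0 hl].
  assert (hca : forall j, 0 <= c * a j) by (intros; now apply Rmult_le_pos).
  assert (hcl : lq_le q (fun j => c * a j) (c * real (lq_norm q a))).
  { apply (lq_le_scal q hq _ a); auto. intros j. split; auto. lra. }
  destruct (lq_norm_le q hq _ (c * real (lq_norm q a)) hca) as [h1 h2]; auto; [nra|].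
  apply Rle_antisym; [lra|].
  destruct hc as [hc|hc]; [|subst c; rewrite Rmult_0_l; lra].
  destruct (lq_norm_finite q hq _ hca h1) as [h3 hl'].
  destruct (lq_norm_le q hq a (/ c * real (lq_norm q (fun j => c * a j))) ha) as [_ h4].
  - apply Rmult_le_pos; auto. apply Rlt_le, Rinv_0_lt_compat, hc.
  - apply (lq_le_scal q hq _ (fun j => c * a j)); auto.
    + apply Rlt_le, Rinv_0_lt_compat, hc.
    + intros j. split; auto. right. field. lra.
  - apply (Rmult_le_reg_l (/ c)); [now apply Rinv_0_lt_compat|].
    rewrite <- Rmult_assoc, Rinv_l, Rmult_1_l by lra. lra.
Qed.

Section Spaces.

Variable X : CompleteNormedModule C_AbsRing.
Variable D : resolvents X.
Notation Op := (Op X D).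
Notation r := (@Or X D).
Notation b := (@Ob X D).
Notation sc := (@Osc X D).
Notation J := (J X D).
Notation Jz := (Jz X D).
Notation besov_op := (besov_op X D).
Notation besov_term := (besov_term X D).
Notation dom_closure := (dom_closure X D).

Variable kap : C -> C.
Hypothesis kap_neq_0 : forall a, 0 < Re a -> kap a <> RtoC 0.
Hypothesis kap_spec : forall T t a x y, 0 <= t -> 0 < Re a -> shifted X D T t ->
  (fpow T a x y <-> x = scal (kap a) (J a t y)).

Variable A : operator X.
Hypothesis A_shifted : shifted X D A 0.
Hypothesis shift_shifted : forall t, 0 <= t -> shifted X D (op_shift (RtoC t) A) t.

Definition kapz (a : C) : C := if Ceq_dec a (RtoC 0) then RtoC 1 else kap a.

Lemma kapz_pos a : 0 < Re a -> kapz a = kap a.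
Proof.
  intros ha. unfold kapz. destruct (Ceq_dec a (RtoC 0)); auto. exfalso. now apply (Re_gt_neq_0 a).
Qed.

Lemma op_pow_pos T t a x y : 0 <= t -> 0 < Re a -> shifted X D T t ->
  (op_pow T a x y <-> x = scal (kap a) (J a t y)).
Proof.
  intros ht ha hT. rewrite <- (kap_spec T t) by auto. unfold op_pow. split; [|tauto].
  intros [h|[[e _]|[h _]]]; [tauto| |lra]. exfalso. now apply (Re_gt_neq_0 a).
Qed.

Lemma op_pow_neg T t a x y : 0 <= t -> Cplus_star a -> shifted X D T t ->
  (op_pow T (Copp a) x y <-> y = scal (kapz a) (Jz a t x)).
Proof.
  intros ht [ha|ha] hT.
  - rewrite kapz_pos, Jz_pos by auto. rewrite <- (kap_spec T t) by auto.
    unfold op_pow, op_inv. replace (Copp (Copp a)) with a by ring.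
    assert (hr : Re (Copp a) < 0) by (change (- Re a < 0); lra).
    split; [|tauto]. intros [[h _]|[[e _]|h]]; [lra| |tauto].
    exfalso. rewrite e, Re_R in hr. lra.
  - subst a. rewrite Jz_0. unfold kapz. destruct (Ceq_dec (RtoC 0) (RtoC 0)) as [_|h]; [|tauto].
    replace (Copp (RtoC 0)) with (RtoC 0) by ring.
    change ((1%op : Op) x) with (scal (RtoC 1) x). rewrite !xscal_1_l.
    unfold op_pow, op_id. rewrite Re_R. intuition lra.
Qed.

Definition besov_op_const (a c : C) : C := Cdiv (kap (Cplus c a)) (kap c).

Lemma besov_op_const_neq_0 a c : Cplus_star a -> 0 < Re c -> besov_op_const a c <> RtoC 0.
Proof.
  intros ha hc. apply Cmult_neq_0; [|now apply Cinv_neq_0, kap_neq_0].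
  apply kap_neq_0. rewrite Re_plus. generalize (star_ge_0 a ha). lra.
Qed.

(** The composition of the unbounded [A^c] with [(t + A)^(-a-c)] is everywhere
    defined, since [(t + A)^(-a-c)] maps into the range of [A^(-c)]. *)
Lemma besov_op_app a c t x : Cplus_star a -> 0 < Re c -> 0 <= t ->
  op_app (op_comp (op_pow A c) (op_pow (op_shift (RtoC t) A) (Cminus (Copp a) c))) x
    = scal (besov_op_const a c) (besov_op a c t x).
Proof.
  intros ha hc ht.
  assert (hca : 0 < Re (Cplus c a)) by (rewrite Re_plus; generalize (star_ge_0 a ha); lra).
  assert (h : forall z, op_comp (op_pow A c) (op_pow (op_shift (RtoC t) A) (Cminus (Copp a) c)) x z <->
    z = scal (besov_op_const a c) (besov_op a c t x)).
  { intros z. replace (Cminus (Copp a) c) with (Copp (Cplus c a)) by ring.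
    assert (hF : J c 0 (besov_op a c t x) = J (Cplus c a) t x).
    { rewrite <- besov_op_spec by auto. reflexivity. }
    unfold op_comp. split.
    - intros [y [h1 h2]]. apply (op_pow_neg _ t) in h1; auto; [|now left].
      apply (op_pow_pos A 0) in h2; auto; [|lra]. rewrite kapz_pos, Jz_pos in h1 by auto.
      assert (e : scal (kap c) z = scal (kap (Cplus c a)) (besov_op a c t x)).
      { apply (J_inj X D c 0); auto; [lra|]. rewrite !op_lin_scal, hF. congruence. }
      rewrite <- (xscal_1_l X z), <- (Cinv_l (kap c)), <- xscal_mult, e, xscal_mult by auto.
      unfold besov_op_const, Cdiv. now rewrite (Cmult_comm (Cinv _)).
    - intros e. exists (scal (kap (Cplus c a)) (J (Cplus c a) t x)). split.
      + apply (op_pow_neg _ t); auto; [now left|]. now rewrite kapz_pos, Jz_pos.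
      + apply (op_pow_pos A 0); auto; [lra|]. rewrite e, op_lin_scal, hF, xscal_mult. f_equal.
        unfold besov_op_const. field. auto. }
  unfold op_app. apply iota_unique.
  - intros y hy. now apply h.
  - now apply h.
Qed.

Section FixedIndex.

Variable q : Rbar.
Hypothesis hq : Rbar_lt (Finite 0) q.

Definition param_term {s : R} (p : besov_param s) : X -> nat -> R :=
  besov_term s (powerRZ 2 (bp_k p)) (bp_alpha p) (bp_beta p).

Definition param_const {s : R} (p : besov_param s) : R := Cmod (besov_op_const (bp_alpha p) (bp_beta p)).

Notation N := (besov_norm A q).
Notation B := (besov_space A q).

Lemma powerRZ_tscale k j : powerRZ 2 (k + Z.of_nat j) = tscale (powerRZ 2 k) j.
Proof. unfold tscale. rewrite powerRZ_add, pow_powerRZ by lra. reflexivity. Qed.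

Lemma bp_beta_pos s (p : besov_param s) : 0 < s -> 0 < Re (bp_beta p).
Proof. intros hs. generalize (bp_upper p). lra. Qed.

Lemma param_const_pos s (p : besov_param s) : 0 < s -> 0 < param_const p.
Proof.
  intros hs. apply Cmod_gt_0, besov_op_const_neq_0; [apply bp_alpha_star|now apply bp_beta_pos].
Qed.

Lemma besov_seminorm_term s (p : besov_param s) x : 0 < s ->
  besov_seminorm A q p x = lq_norm q (fun j => param_const p * param_term p x j).
Proof.
  intros hs. unfold besov_seminorm. f_equal. apply functional_extensionality. intros j.
  assert (hi : 0 < powerRZ 2 (bp_k p + Z.of_nat j)) by apply powerRZ_2_pos.
  rewrite besov_op_app; [|apply bp_alpha_star|now apply bp_beta_pos|lra].
  rewrite !xnorm_scal. unfold param_const, param_term. rewrite besov_term_eq. rewrite <- powerRZ_tscale.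
  rewrite Cmod_rcpow.
  replace (Rpower (powerRZ 2 (bp_k p + Z.of_nat j)) (s + Re (bp_alpha p)))
    with (Rpower 2 (Re (Cmult (RtoC (IZR (bp_k p + Z.of_nat j))) (Cplus (RtoC s) (bp_alpha p))))).
  - ring.
  - rewrite (powerRZ_Rpower 2), Rpower_mult by lra. f_equal. unfold Cmult, Cplus, RtoC, Re; cbn [fst snd]; ring.
Qed.

Lemma besov_norm_term s (p : besov_param s) x : 0 < s ->
  N p x = Cmod (kapz (bp_alpha p)) * norm (Jz (bp_alpha p) (powerRZ 2 (bp_k p)) x) +
    real (lq_norm q (fun j => param_const p * param_term p x j)).
Proof.
  intros hs. unfold besov_norm. rewrite besov_seminorm_term by auto. f_equal.
  assert (hk := powerRZ_2_pos (bp_k p)).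
  assert (h : forall y, op_pow (op_shift (RtoC (powerRZ 2 (bp_k p))) A) (Copp (bp_alpha p)) x y <->
    y = scal (kapz (bp_alpha p)) (Jz (bp_alpha p) (powerRZ 2 (bp_k p)) x)).
  { intros y. apply op_pow_neg; [lra|apply bp_alpha_star|apply shift_shifted; lra]. }
  rewrite <- xnorm_scal. f_equal. unfold op_app. apply iota_unique.
  - intros y hy. now apply h.
  - now apply h.
Qed.

Lemma in_closure_dom x : in_closure X (op_dom A) x <-> dom_closure x.
Proof.
  assert (h : forall z, op_dom A z <-> exists y, z = b y).
  { intros z. unfold op_dom. split; intros [y hy]; exists y.
    - apply A_shifted in hy. now rewrite <- Or_0.
    - apply A_shifted. now rewrite Or_0. }
  split.
  - intros hx e he. destruct (hx (mkposreal e he)) as [z [h1 h2]]. apply h in h1.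
    destruct h1 as [y hy]. exists y. now subst z.
  - intros hx e. destruct (hx e (cond_pos e)) as [y hy]. exists (b y). split; auto.
    apply h. now exists y.
Qed.

Lemma param_term_ge_0 s (p : besov_param s) x j : 0 <= param_term p x j.
Proof. apply besov_term_ge_0. Qed.

Lemma besov_space_iff s (p : besov_param s) x : 0 < s ->
  (B p x <-> dom_closure x /\ exists M, 0 <= M /\ lq_le q (param_term p x) M).
Proof.
  intros hs. assert (hw := param_const_pos s p hs).
  assert (h0 : forall j, 0 <= param_const p * param_term p x j).
  { intros j. apply Rmult_le_pos; [lra|apply param_term_ge_0]. }
  unfold besov_space. rewrite in_closure_dom, besov_seminorm_term by auto.
  split; intros [hx h]; (split; [exact hx|]).
  - destruct (lq_norm_finite q hq _ h0 h) as [h1 h2].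
    exists (/ param_const p * real (lq_norm q (fun j => param_const p * param_term p x j))).
    assert (hi : 0 < / param_const p) by now apply Rinv_0_lt_compat.
    split; [now apply Rmult_le_pos; [lra|]|].
    apply (lq_le_scal q hq _ (fun j => param_const p * param_term p x j)); auto; [lra|].
    intros j. split; [apply param_term_ge_0|]. right. field. lra.
  - destruct h as [M [hM h]]. apply (lq_norm_le q hq _ (param_const p * M) h0); [nra|].
    apply (lq_le_scal q hq _ (param_term p x)); auto; [lra| |apply param_term_ge_0].
    intros j. split; auto. lra.
Qed.

Lemma besov_norm_upper s (p : besov_param s) : 0 < s -> exists C, 0 <= C /\
  forall x M, 0 <= M -> lq_le q (param_term p x) M -> N p x <= C * M.
Proof.
  intros hs. assert (hw := param_const_pos s p hs).
  destruct (low_frequency X D q hq s (powerRZ 2 (bp_k p)) (bp_alpha p) (bp_beta p)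
    (powerRZ_2_pos _) (bp_alpha_star p) (bp_beta_pos s p hs)) as [C [hC h]].
  assert (hk := Cmod_ge_0 (kapz (bp_alpha p))).
  exists (Cmod (kapz (bp_alpha p)) * C + param_const p). split; [nra|].
  intros x M hM hl. rewrite besov_norm_term by auto.
  rewrite Rmult_plus_distr_r, Rmult_assoc. apply Rplus_le_compat.
  - apply Rmult_le_compat_l; auto.
  - apply lq_norm_le; auto.
    + intros j. apply Rmult_le_pos; [lra|apply param_term_ge_0].
    + nra.
    + apply (lq_le_scal q hq _ (param_term p x)); auto; [lra| |apply param_term_ge_0].
      intros j. split; [apply Rmult_le_pos; [lra|apply param_term_ge_0]|lra].
Qed.

Lemma besov_norm_lower s (p : besov_param s) x : 0 < s -> B p x ->
  0 <= N p x /\ lq_le q (param_term p x) (/ param_const p * N p x).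
Proof.
  intros hs [_ h]. assert (hw := param_const_pos s p hs). rewrite besov_seminorm_term in h by auto.
  assert (h0 : forall j, 0 <= param_const p * param_term p x j).
  { intros j. apply Rmult_le_pos; [lra|apply param_term_ge_0]. }
  destruct (lq_norm_finite q hq _ h0 h) as [h1 h2].
  assert (h3 : 0 <= Cmod (kapz (bp_alpha p)) * norm (Jz (bp_alpha p) (powerRZ 2 (bp_k p)) x)).
  { apply Rmult_le_pos; [apply Cmod_ge_0|apply xnorm_ge_0]. }
  assert (hi : 0 < / param_const p) by now apply Rinv_0_lt_compat.
  rewrite besov_norm_term by auto. split; [lra|].
  apply (lq_le_scal q hq _ (fun j => param_const p * param_term p x j)); auto; try lra.
  - intros j. split; [apply param_term_ge_0|]. right. field. lra.
  - eapply lq_le_mono; eauto. lra.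
Qed.

Lemma param_term_scal s (p : besov_param s) z x j : param_term p (scal z x) j = Cmod z * param_term p x j.
Proof. unfold param_term. rewrite !besov_term_eq. rewrite op_lin_scal, xnorm_scal. ring. Qed.

Lemma besov_space_scal s (p : besov_param s) z x : 0 < s -> B p x -> B p (scal z x).
Proof.
  intros hs. rewrite !besov_space_iff by auto. intros [hx [M [hM h]]]. split.
  - exact (dom_closure_op X D (sc z) x hx).
  - assert (hz := Cmod_ge_0 z). exists (Cmod z * M). split; [nra|].
    apply (lq_le_scal q hq _ (param_term p x)); auto; [|apply param_term_ge_0].
    intros j. split; [apply param_term_ge_0|]. rewrite param_term_scal. lra.
Qed.

Lemma param_term_plus s (p : besov_param s) x y j : param_term p (plus x y) j <= param_term p x j + param_term p y j.
Proof.
  unfold param_term. rewrite !besov_term_eq. rewrite op_lin_plus, <- Rmult_plus_distr_l.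
  apply Rmult_le_compat_l; [apply Rlt_le, Rpower_pos|apply xnorm_plus].
Qed.

Lemma lq_le_param_term_plus : exists K, 0 <= K /\ forall s (p : besov_param s) x y M M',
  0 <= M -> 0 <= M' -> lq_le q (param_term p x) M -> lq_le q (param_term p y) M' ->
  lq_le q (param_term p (plus x y)) (K * (M + M')).
Proof.
  destruct (lq_le_plus q hq) as [K [hK h]]. exists K. split; auto.
  intros s p x y M M' hM hM' h1 h2.
  rewrite <- (Rmult_1_l (K * _)).
  apply (lq_le_scal q hq _ (fun j => param_term p x j + param_term p y j)); try lra.
  - apply Rmult_le_pos; lra.
  - intros j. split; [apply param_term_ge_0|]. rewrite Rmult_1_l. apply param_term_plus.
  - intros j. apply Rplus_le_le_0_compat; apply param_term_ge_0.
  - apply h; auto; intros; apply param_term_ge_0.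
Qed.

Lemma dom_closure_plus x y : dom_closure x -> dom_closure y -> dom_closure (plus x y).
Proof.
  intros hx hy e he. destruct (hx (e / 2)) as [z hz]; [lra|]. destruct (hy (e / 2)) as [w hw]; [lra|].
  exists (plus z w). rewrite op_lin_plus.
  replace (minus (plus x y) (plus (b z) (b w))) with (plus (minus x (b z)) (minus y (b w))).
  - eapply Rle_lt_trans; [apply xnorm_plus|]. lra.
  - unfold minus. rewrite xopp_plus. apply xplus_swap.
Qed.

Lemma besov_space_plus s (p : besov_param s) x y : 0 < s -> B p x -> B p y -> B p (plus x y).
Proof.
  intros hs. rewrite !besov_space_iff by auto. intros [hx [M [hM h]]] [hy [M' [hM' h']]]. split.
  - now apply dom_closure_plus.
  - destruct lq_le_param_term_plus as [K [hK hp]]. exists (K * (M + M')). split; auto.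
    apply Rmult_le_pos; lra.
Qed.

Lemma besov_space_minus s (p : besov_param s) x y : 0 < s -> B p x -> B p y -> B p (minus x y).
Proof.
  intros hs hx hy. apply besov_space_plus; auto.
  replace (opp y) with (scal (Copp (RtoC 1)) y).
  - now apply besov_space_scal.
  - transitivity (opp (scal (RtoC 1) y)); [apply (@scal_opp_l C_Ring X)|]. now rewrite xscal_1_l.
Qed.

Lemma besov_norm_scal s (p : besov_param s) z x : 0 < s -> B p x -> N p (scal z x) = Cmod z * N p x.
Proof.
  intros hs [_ h]. assert (hw := param_const_pos s p hs). rewrite besov_seminorm_term in h by auto.
  rewrite !besov_norm_term by auto. rewrite op_lin_scal, xnorm_scal, Rmult_plus_distr_l.
  f_equal; [ring|].
  rewrite <- lq_norm_scal; auto.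
  - f_equal. f_equal. apply functional_extensionality. intros j. rewrite param_term_scal. ring.
  - apply Cmod_ge_0.
  - intros j. apply Rmult_le_pos; [lra|apply param_term_ge_0].
Qed.

Lemma besov_norm_eq_0 s (p : besov_param s) x : 0 < s -> B p x -> (N p x = 0 <-> x = zero).
Proof.
  intros hs hx. split; intros e.
  - destruct (besov_norm_lower s p x hs hx) as [_ h]. rewrite e, Rmult_0_r in h.
    apply (besov_term_zero X D q hq s (powerRZ 2 (bp_k p)) (bp_alpha p) (bp_beta p)); auto.
    + apply powerRZ_2_pos.
    + apply bp_alpha_star.
    + now apply bp_beta_pos.
  - replace x with (scal (RtoC 0) x) by (rewrite xscal_0_l; auto).
    rewrite besov_norm_scal, Cmod_0 by auto. ring.
Qed.

Lemma besov_norm_triangle s (p : besov_param s) : 0 < s -> exists K, 0 <= K /\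
  forall x y, B p x -> B p y -> N p (plus x y) <= K * (N p x + N p y).
Proof.
  intros hs. destruct (besov_norm_upper s p hs) as [C [hC h]].
  destruct lq_le_param_term_plus as [K [hK hp]].
  assert (hi : 0 < / param_const p) by now apply Rinv_0_lt_compat, param_const_pos.
  exists (C * (K * / param_const p)). split; [apply Rmult_le_pos; [auto|apply Rmult_le_pos; lra]|].
  intros x y hx hy.
  destruct (besov_norm_lower s p x hs hx) as [hx0 hx1].
  destruct (besov_norm_lower s p y hs hy) as [hy0 hy1].
  replace (C * (K * / param_const p) * (N p x + N p y)) with (C * (K * (/ param_const p * N p x + / param_const p * N p y))) by ring.
  assert (h1 : 0 <= / param_const p * N p x) by (apply Rmult_le_pos; lra).
  assert (h2 : 0 <= / param_const p * N p y) by (apply Rmult_le_pos; lra).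
  apply h; [apply Rmult_le_pos; lra|]. auto.
Qed.

(** Definiteness and the quasi-triangle inequality pass from the Besov quasi-norm
    to [N'] by comparison; homogeneity does not, and is assumed. *)
Lemma equivalent_of_bounds s (p : besov_param s) (N' : X -> R) c C : 0 < s -> 0 < c -> 0 < C ->
  (forall x, B p x -> c * N p x <= N' x <= C * N p x) ->
  (forall z x, B p x -> N' (scal z x) = Cmod z * N' x) ->
  equivalent_quasi_norm (B p) (N p) N'.
Proof.
  intros hs hc hC hb hz. split; [|now exists c, C].
  assert (h0 : forall x, B p x -> 0 <= N p x) by (intros; now apply besov_norm_lower).
  split.
  - intros x hx. assert (h1 := h0 x hx). destruct (hb x hx). nra.
  - intros x hx. rewrite <- (besov_norm_eq_0 s p) by auto.
    assert (h1 := h0 x hx). destruct (hb x hx). split; intros e; nra.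
  - auto.
  - destruct (besov_norm_triangle s p hs) as [K [hK h]].
    exists (C * K * / c). intros x y hx hy.
    assert (hxy := besov_space_plus s p x y hs hx hy).
    eapply Rle_trans; [apply (hb _ hxy)|]. rewrite !Rmult_assoc. apply Rmult_le_compat_l; [lra|].
    eapply Rle_trans; [now apply h|]. apply Rmult_le_compat_l; auto.
    apply (Rmult_le_reg_l c); auto. rewrite <- Rmult_assoc, Rinv_r, Rmult_1_l by lra.
    destruct (hb x hx), (hb y hy). lra.
Qed.

(** By [besov_term_J] the terms of [A^(-g) z] for [p2] are terms of [z] for the
    smoothness [s1], with the exponents [bp_alpha p2 + g] and [bp_beta p2 - g]; these
    are admissible, and [dominates_all] compares them with those of [p1]. *)
Lemma besov_shift s1 s2 g (p1 : besov_param s1) (p2 : besov_param s2) :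
  0 < s1 -> 0 < Re g -> s2 = s1 + Re g -> exists c C, 0 < c /\ 0 < C /\
  forall z, dom_closure z -> (B p1 z <-> B p2 (scal (kap g) (J g 0 z))) /\
    (B p1 z -> c * N p1 z <= N p2 (scal (kap g) (J g 0 z)) <= C * N p1 z).
Proof.
  intros hs1 hg e. assert (hs2 : 0 < s2) by lra.
  assert (hbeta := bp_upper p2).
  assert (hu : forall z, param_term p2 (J g 0 z) =
    besov_term s1 (powerRZ 2 (bp_k p2)) (Cplus (bp_alpha p2) g) (Cminus (bp_beta p2) g) z).
  { intros z. apply functional_extensionality. intros i. unfold param_term. rewrite <- besov_term_J; [now rewrite <- e| | |].
    - apply powerRZ_2_pos.
    - apply bp_alpha_star.
    - lra. }
  assert (ha : Cplus_star (Cplus (bp_alpha p2) g)).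
  { apply star_plus; [apply bp_alpha_star|now left]. }
  assert (hb : s1 < Re (Cminus (bp_beta p2) g)) by (rewrite Re_minus; lra).
  destruct (dominates_all X D q hq s1 (bp_k p1) (bp_k p2) (bp_alpha p1) (bp_beta p1) _ _
    hs1 (bp_alpha_star p1) ha (bp_upper p1) hb) as [C1 [hC1 h1]].
  destruct (dominates_all X D q hq s1 (bp_k p2) (bp_k p1) _ _ (bp_alpha p1) (bp_beta p1)
    hs1 ha (bp_alpha_star p1) hb (bp_upper p1)) as [C2 [hC2 h2]].
  destruct (besov_norm_upper s1 p1 hs1) as [U1 [hU1 hup1]].
  destruct (besov_norm_upper s2 p2 hs2) as [U2 [hU2 hup2]].
  assert (hi1 : 0 < / param_const p1) by now apply Rinv_0_lt_compat, param_const_pos.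
  assert (hi2 : 0 < / param_const p2) by now apply Rinv_0_lt_compat, param_const_pos.
  assert (hk : 0 < Cmod (kap g)) by now apply Cmod_gt_0, kap_neq_0.
  assert (hmem : forall z, dom_closure z -> (B p1 z <-> B p2 (J g 0 z))).
  { intros z hz. rewrite !besov_space_iff by auto. rewrite hu. split; intros [_ [M [hM h]]].
    - split; [now apply dom_closure_op|]. exists (C1 * M). split; [nra|]. now apply h1.
    - split; auto. exists (C2 * M). split; [nra|]. now apply h2. }
  set (V1 := U2 * (C1 * / param_const p1)). set (V2 := U1 * (C2 * / param_const p2)).
  assert (hV1 : 0 <= V1) by (apply Rmult_le_pos; [auto|apply Rmult_le_pos; lra]).
  assert (hV2 : 0 <= V2) by (apply Rmult_le_pos; [auto|apply Rmult_le_pos; lra]).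
  exists (Cmod (kap g) * / (V2 + 1)), (Cmod (kap g) * (V1 + 1)).
  assert (hV2i : 0 < / (V2 + 1)) by (apply Rinv_0_lt_compat; lra).
  split; [nra|]. split; [nra|]. intros z hz. split.
  - rewrite (hmem z hz). split; [now apply besov_space_scal|]. intros h.
    replace (J g 0 z) with (scal (Cinv (kap g)) (scal (kap g) (J g 0 z))).
    + now apply besov_space_scal.
    + rewrite xscal_mult, Cinv_l by auto. apply xscal_1_l.
  - intros hz1. assert (hz2 := proj1 (hmem z hz) hz1).
    rewrite besov_norm_scal, !Rmult_assoc by auto.
    destruct (besov_norm_lower s1 p1 z hs1 hz1) as [hn1 hl1].
    destruct (besov_norm_lower s2 p2 _ hs2 hz2) as [hn2 hl2].
    assert (b1 : N p2 (J g 0 z) <= V1 * N p1 z).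
    { unfold V1. rewrite !Rmult_assoc.
      assert (hn1' : 0 <= / param_const p1 * N p1 z) by (apply Rmult_le_pos; lra).
      apply hup2; [nra|]. rewrite hu. exact (h1 z hz _ hn1' hl1). }
    assert (b2 : N p1 z <= V2 * N p2 (J g 0 z)).
    { unfold V2. rewrite !Rmult_assoc.
      assert (hn2' : 0 <= / param_const p2 * N p2 (J g 0 z)) by (apply Rmult_le_pos; lra).
      apply hup1; [nra|]. refine (h2 z hz _ hn2' _). rewrite <- hu. exact hl2. }
    split; apply Rmult_le_compat_l; try lra.
    apply (Rmult_le_reg_l (V2 + 1)); [lra|]. rewrite <- Rmult_assoc, Rinv_r, Rmult_1_l by lra. lra.
Qed.

Lemma negative_power_app g x : 0 < Re g ->
  op_dom (op_pow A (Copp g)) x /\ op_app (op_pow A (Copp g)) x = scal (kap g) (J g 0 x).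
Proof.
  intros hg.
  assert (h : forall y, op_pow A (Copp g) x y <-> y = scal (kap g) (J g 0 x)).
  { intros y. rewrite (op_pow_neg A 0) by (auto; lra || now left). now rewrite kapz_pos, Jz_pos. }
  split; [exists (scal (kap g) (J g 0 x)); now apply h|].
  unfold op_app. apply iota_unique.
  - intros y hy. now apply h.
  - now apply h.
Qed.

Lemma positive_power_app g x y : 0 < Re g -> x = scal (kap g) (J g 0 y) ->
  op_dom (op_pow A g) x /\ op_app (op_pow A g) x = y.
Proof.
  intros hg hx.
  assert (h : op_pow A g x y) by (apply (op_pow_pos A 0); auto; lra).
  split; [now exists y|]. unfold op_app. apply iota_unique; auto.
  intros w hw. apply (op_pow_pos A 0) in hw; auto; [|lra].
  apply (J_inj X D g 0); auto; [lra|].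
  rewrite <- (xscal_1_l X (J g 0 w)), <- (xscal_1_l X (J g 0 y)), <- (Cinv_l (kap g)), <- !xscal_mult by auto.
  congruence.
Qed.

Lemma besov_space_dom_closure s (p : besov_param s) x : B p x -> dom_closure x.
Proof. intros [h _]. now apply in_closure_dom. Qed.

Lemma negative_power_maps s g (p : besov_param s) (p' : besov_param (s + Re g)) :
  0 < s -> 0 < Re g -> maps_into (B p) (B p') (op_pow A (Copp g)).
Proof.
  intros hs hg x hx. destruct (negative_power_app g x hg) as [h1 h2].
  split; [exact h1|]. rewrite h2.
  destruct (besov_shift s (s + Re g) g p p' hs hg eq_refl) as [c [C [_ [_ h]]]].
  exact (proj1 (proj1 (h x (besov_space_dom_closure s p x hx))) hx).
Qed.

Lemma negative_power_continuous s g (p : besov_param s) (p' : besov_param (s + Re g)) :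
  0 < s -> 0 < Re g ->
  continuous_between (B p) (N p) (B p') (N p') (op_pow A (Copp g)).
Proof.
  intros hs hg. split; [now apply negative_power_maps|].
  destruct (besov_shift s (s + Re g) g p p' hs hg eq_refl) as [c [C [_ [hC h]]]].
  intros x hx eps.
  assert (hd : 0 < eps / C) by (apply Rdiv_lt_0_compat; [apply cond_pos|auto]).
  exists (mkposreal _ hd). intros y hy hlt. simpl in hlt.
  rewrite !(proj2 (negative_power_app g _ hg)).
  assert (hyx := besov_space_minus s p y x hs hy hx).
  match goal with |- N p' ?w < _ => assert (em : w = scal (kap g) (J g 0 (minus y x))) end.
  { unfold minus. now rewrite op_lin_plus, op_lin_opp, xscal_plus, xscal_opp. }
  rewrite em. destruct (h (minus y x) (besov_space_dom_closure s p _ hyx)) as [_ h2].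
  eapply Rle_lt_trans; [apply (h2 hyx)|].
  apply (Rmult_lt_compat_l C) in hlt; auto. replace (C * (eps / C)) with (pos eps) in hlt by (field; lra).
  exact hlt.
Qed.

Lemma negative_power_equivalent s g (p : besov_param s) (p' : besov_param (s + Re g)) :
  0 < s -> 0 < Re g ->
  equivalent_quasi_norm (B p) (N p) (fun x => N p' (op_app (op_pow A (Copp g)) x)).
Proof.
  intros hs hg.
  destruct (besov_shift s (s + Re g) g p p' hs hg eq_refl) as [c [C [hc [hC h]]]].
  apply (equivalent_of_bounds s p _ c C hs hc hC).
  - intros x hx. rewrite (proj2 (negative_power_app g x hg)).
    exact (proj2 (h x (besov_space_dom_closure s p x hx)) hx).
  - intros z x hx. rewrite !(proj2 (negative_power_app g _ hg)).
    rewrite op_lin_scal, xscal_mult, (Cmult_comm (kap g)), <- xscal_mult.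
    apply besov_norm_scal; [lra|]. exact (proj1 (proj1 (h x (besov_space_dom_closure s p x hx))) hx).
Qed.

Lemma positive_power_lift s g (p : besov_param s) x : 0 < Re g < s -> B p x ->
  exists y, dom_closure y /\ x = scal (kap g) (J g 0 y).
Proof.
  intros hg hx. assert (hs : 0 < s) by lra. apply besov_space_iff in hx; auto.
  destruct hx as [hx [M [hM hl]]].
  destruct (negative_power_preimage X D q s (powerRZ 2 (bp_k p)) (bp_alpha p) (bp_beta p) g x M hq
    (powerRZ_2_pos _) (bp_alpha_star p) hg (bp_upper p) hx hM hl) as [y [hy e]].
  exists (scal (Cinv (kap g)) y). split; [exact (dom_closure_op X D (sc (Cinv (kap g))) y hy)|].
  rewrite op_lin_scal, xscal_mult, Cinv_r, xscal_1_l by (apply kap_neq_0; lra). auto.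
Qed.

(** [x] is [A^(-g) y] with [y = A^g x], and [besov_shift] compares [y] for the
    smoothness [s - Re g] with [x] for [s]. *)
Lemma positive_power_equivalent s g (p : besov_param s) (p' : besov_param (s - Re g)) :
  0 < Re g < s ->
  maps_into (B p) (B p') (op_pow A g) /\
  equivalent_quasi_norm (B p) (N p) (fun x => N p' (op_app (op_pow A g) x)).
Proof.
  intros hg. assert (hs : 0 < s) by lra. assert (hg0 : 0 < Re g) by lra.
  destruct (besov_shift (s - Re g) s g p' p) as [c [C [hc [hC h]]]]; try lra.
  assert (hlift : forall x, B p x -> exists y, x = scal (kap g) (J g 0 y) /\ B p' y).
  { intros x hx. destruct (positive_power_lift s g p x hg hx) as [y [hy e]]. exists y. split; [exact e|].
    apply (proj1 (h y hy)). now rewrite <- e. }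
  split.
  - intros x hx. destruct (hlift x hx) as [y [e hy]].
    destruct (positive_power_app g x y hg0 e) as [h1 h2]. split; [exact h1|].
    now rewrite h2.
  - apply (equivalent_of_bounds s p _ (/ C) (/ c) hs); try now apply Rinv_0_lt_compat.
    + intros x hx. destruct (hlift x hx) as [y [e hy]].
      rewrite (proj2 (positive_power_app g x y hg0 e)).
      assert (hb := proj2 (h y (besov_space_dom_closure _ p' y hy)) hy). rewrite <- e in hb. split.
      * apply (Rmult_le_reg_l C); auto. rewrite <- Rmult_assoc, Rinv_r, Rmult_1_l by lra. lra.
      * apply (Rmult_le_reg_l c); auto. rewrite <- Rmult_assoc, Rinv_r, Rmult_1_l by lra. lra.
    + intros z x hx. destruct (hlift x hx) as [y [e hy]].
      rewrite (proj2 (positive_power_app g x y hg0 e)).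
      rewrite (proj2 (positive_power_app g (scal z x) (scal z y) hg0
        ltac:(rewrite op_lin_scal, xscal_mult, (Cmult_comm (kap g)), <- xscal_mult, <- e; reflexivity))).
      apply besov_norm_scal; [lra|exact hy].
Qed.

End FixedIndex.

End Spaces.

Theorem theorem5p2 (X : CompleteNormedModule C_AbsRing) (A : operator X)
  (hA : positive_operator A) (s : R) (hs : 0 < s) (q : Rbar)
  (hq : Rbar_lt (Finite 0) q) :
  (forall gamma : C, 0 < Re gamma ->
     forall (p : besov_param s) (p' : besov_param (s + Re gamma)),
       continuous_between (besov_space A q p) (besov_norm A q p)
         (besov_space A q p') (besov_norm A q p') (op_pow A (Copp gamma)))
  /\
  (forall gamma : C, 0 < Re gamma ->
     forall (p : besov_param s) (p' : besov_param (s + Re gamma)),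
       maps_into (besov_space A q p) (besov_space A q p')
         (op_pow A (Copp gamma)) /\
       equivalent_quasi_norm (besov_space A q p) (besov_norm A q p)
         (fun x => besov_norm A q p' (op_app (op_pow A (Copp gamma)) x)))
  /\
  (forall gamma : C, 0 < Re gamma < s ->
     forall (p : besov_param s) (p' : besov_param (s - Re gamma)),
       maps_into (besov_space A q p) (besov_space A q p')
         (op_pow A gamma) /\
       equivalent_quasi_norm (besov_space A q p) (besov_norm A q p)
         (fun x => besov_norm A q p' (op_app (op_pow A gamma) x))).
Proof.
  set (D := positive_resolvents X A hA).
  assert (h0 : shifted X D A 0).
  { intros x y. rewrite Or_0. apply (A_iff X A hA). }
  assert (ht : forall t, 0 <= t -> shifted X D (op_shift (RtoC t) A) t).
  { intros t ht x y. change (@Or X D t y) with (res X A (Rmax 0 t) y). rewrite Rmax_right by auto.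
    apply (res_iff X A hA); auto. }
  destruct (fpow_J X D) as [kap [hk1 hk2]].
  split; [|split].
  - intros g hg p p'. now apply (negative_power_continuous X D kap hk1 hk2 A h0 ht q hq).
  - intros g hg p p'. split.
    + now apply (negative_power_maps X D kap hk1 hk2 A h0 ht q hq).
    + now apply (negative_power_equivalent X D kap hk1 hk2 A h0 ht q hq).
  - intros g hg p p'. now apply (positive_power_equivalent X D kap hk1 hk2 A h0 ht q hq).
Qed.
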